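(* Let $p$ be a prime number. There exists a complete discretely valued field $(E,v)$ with $\operatorname{char} E = 0$ and residue characteristic $\operatorname{char} Ev = p$ such that the existential $\mathcal{L}_{\mathrm{ring}}$-theory of the residue field $Ev$ is decidable, but the existential $\mathcal{L}_{\mathrm{ring}}$-theory of $E$ is undecidable. Furthermore, $E$ can be chosen such that, in addition, the set of one-variable polynomials in $\mathbb{Q}[X]$ having a zero in $E$ is decidable.
   Context: $\mathcal{L}_{\mathrm{ring}} = \{+,-,\cdot,0,1\}$; sentences and polynomials are identified with natural numbers via standard codings. A discretely valued field is a field with a valuation whose value group is isomorphic to $\mathbb{Z}$; complete means complete with respect to this valuation. *)

(* Defs.v *)
From HB Require Import structures.
From mathcomp Require Import all_boot all_order all_algebra generic_quotient.
From mathcomp Require Import ring_quotient.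

Set Implicit Arguments.
Unset Strict Implicit.
Unset Printing Implicit Defensive.

Import Order.TTheory GRing.Theory Num.Theory.

Local Open Scope nat_scope.

(* [partrec n] is the type of programs for n-ary partial recursive functions.
   In [PRComp] the family [g] is just an m-tuple of programs. *)
Inductive partrec : nat -> Type :=
| PRZero n : partrec n
| PRSucc : partrec 1
| PRProj n (i : 'I_n) : partrec n
| PRComp m n (f : partrec m) (g : 'I_m -> partrec n) : partrec n
| PRRec n (f : partrec n) (g : partrec n.+2) : partrec n.+1
| PRMin n (f : partrec n.+1) : partrec n.

Fixpoint rec_graph (F : nat -> Prop) (G : nat -> nat -> nat -> Prop)
    (k y : nat) : Prop :=
  if k is k'.+1 then exists2 z, rec_graph F G k' z & G k' z y else F y.

(* [computes f s y]: the program f halts on input s with output y. *)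
Fixpoint computes n (f : partrec n) : n.-tuple nat -> nat -> Prop :=
  match f in partrec n return n.-tuple nat -> nat -> Prop with
  | PRZero n => fun _ y => y = 0
  | PRSucc => fun s y => y = (thead s).+1
  | PRProj n i => fun s y => y = tnth s i
  | PRComp m n f g => fun s y =>
      exists2 t : m.-tuple nat,
        forall i, computes (g i) s (tnth t i) & computes f t y
  | PRRec n f g => fun s y =>
      rec_graph (computes f [tuple of behead s])
        (fun k z => computes g [tuple of k :: z :: behead s]) (thead s) y
  | PRMin n f => fun s y =>
      computes f [tuple of y :: s] 0 /\
      forall z, z < y -> exists k, computes f [tuple of z :: s] k.+1
  end.

Definition decidable_set (A : nat -> Prop) : Prop :=
  exists f : partrec 1, forall n,
    exists b : bool, computes f [tuple n] b /\ (A n <-> b).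

(* Cantor's pairing function *)
Definition pair_code (x y : nat) : nat := ((x + y) * (x + y).+1)./2 + y.

Fixpoint seq_code (s : seq nat) : nat :=
  if s is x :: s' then (pair_code x (seq_code s')).+1 else 0.

Definition int_code (z : int) : nat :=
  match z with Posz n => n.*2 | Negz n => n.*2.+1 end.

Definition rat_code (q : rat) : nat :=
  pair_code (int_code (numq q)) (int_code (denq q)).

Definition poly_code (f : {poly rat}) : nat :=
  seq_code [seq rat_code c | c <- (f : seq rat)].

Inductive ring_term : Type :=
| TVar of nat
| TZero
| TOne
| TAdd of ring_term & ring_term
| TSub of ring_term & ring_term
| TMul of ring_term & ring_term.

Inductive ring_formula : Type :=
| FEq of ring_term & ring_term
| FNot of ring_formula
| FAnd of ring_formula & ring_formula
| FOr of ring_formula & ring_formula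
| FExists of nat & ring_formula
| FForall of nat & ring_formula.

Fixpoint term_vars (t : ring_term) : seq nat :=
  match t with
  | TVar i => [:: i]
  | TZero | TOne => [::]
  | TAdd t u | TSub t u | TMul t u => term_vars t ++ term_vars u
  end.

Fixpoint free_vars (phi : ring_formula) : seq nat :=
  match phi with
  | FEq t u => term_vars t ++ term_vars u
  | FNot f => free_vars f
  | FAnd f g | FOr f g => free_vars f ++ free_vars g
  | FExists i f | FForall i f => [seq j <- free_vars f | j != i]
  end.

Definition sentence (phi : ring_formula) : bool := free_vars phi == [::].

Fixpoint quantifier_free (phi : ring_formula) : bool :=
  match phi with
  | FEq _ _ => true
  | FNot f => quantifier_free f
  | FAnd f g | FOr f g => quantifier_free f && quantifier_free g
  | FExists _ _ | FForall _ _ => false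
  end.

Fixpoint existential (phi : ring_formula) : bool :=
  if phi is FExists _ f then existential f else quantifier_free phi.

Fixpoint term_code (t : ring_term) : nat :=
  match t with
  | TVar i => pair_code 0 i
  | TZero => pair_code 1 0
  | TOne => pair_code 2 0
  | TAdd t u => pair_code 3 (pair_code (term_code t) (term_code u))
  | TSub t u => pair_code 4 (pair_code (term_code t) (term_code u))
  | TMul t u => pair_code 5 (pair_code (term_code t) (term_code u))
  end.

Fixpoint formula_code (phi : ring_formula) : nat :=
  match phi with
  | FEq t u => pair_code 0 (pair_code (term_code t) (term_code u))
  | FNot f => pair_code 1 (formula_code f)
  | FAnd f g => pair_code 2 (pair_code (formula_code f) (formula_code g))
  | FOr f g => pair_code 3 (pair_code (formula_code f) (formula_code g))
  | FExists i f => pair_code 4 (pair_code i (formula_code f))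
  | FForall i f => pair_code 5 (pair_code i (formula_code f))
  end.

Local Open Scope ring_scope.

Section Semantics.
Variable K : fieldType.

Fixpoint term_eval (e : nat -> K) (t : ring_term) : K :=
  match t with
  | TVar i => e i
  | TZero => 0
  | TOne => 1
  | TAdd t u => term_eval e t + term_eval e u
  | TSub t u => term_eval e t - term_eval e u
  | TMul t u => term_eval e t * term_eval e u
  end.

Definition update (e : nat -> K) (i : nat) (x : K) : nat -> K :=
  fun j => if j == i then x else e j.

Fixpoint satisfies (e : nat -> K) (phi : ring_formula) : Prop :=
  match phi with
  | FEq t u => term_eval e t = term_eval e u
  | FNot f => ~ satisfies e f
  | FAnd f g => satisfies e f /\ satisfies e g
  | FOr f g => satisfies e f \/ satisfies e g
  | FExists i f => exists x, satisfies (update e i x) f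
  | FForall i f => forall x, satisfies (update e i x) f
  end.

Definition holds_in (phi : ring_formula) : Prop :=
  forall e : nat -> K, satisfies e phi.

Definition existential_theory (phi : ring_formula) : Prop :=
  [/\ sentence phi, existential phi & holds_in phi].

(* In characteristic 0, [ratr] is the embedding of the rationals into K. *)
Definition has_zero_in (f : {poly rat}) : Prop :=
  exists x : K, root (map_poly ratr f) x.

End Semantics.

Definition decidable_formulas (T : ring_formula -> Prop) : Prop :=
  decidable_set (fun n => exists2 phi, T phi & formula_code phi = n).

Definition decidable_polys (P : {poly rat} -> Prop) : Prop :=
  decidable_set (fun n => exists2 f, P f & poly_code f = n).

(* The value group is identified with the ordered group of integers. The value
   at 0, which should be +oo, is left unspecified; hence the conditions
   [x != 0] here and the tests [x == 0] below. *)
Record discrete_valuation (K : fieldType) := DiscreteValuation {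
  dval :> K -> int;
  dvalM : forall x y, x != 0 -> y != 0 -> dval (x * y) = dval x + dval y;
  dvalD : forall x y, x != 0 -> y != 0 -> x + y != 0 ->
    Order.min (dval x) (dval y) <= dval (x + y);
  dval_surj : forall n : int, exists2 x, x != 0 & dval x = n
}.

Section Valued.
Variables (K : fieldType) (v : discrete_valuation K).

Definition dval_ge (n : int) (x : K) : bool := (x == 0) || (n <= v x).

Definition dval_cauchy (u : nat -> K) : Prop :=
  forall n : int, exists N : nat, forall i j : nat,
    (N <= i)%N -> (N <= j)%N -> dval_ge n (u i - u j).

Definition dval_cvg (u : nat -> K) (l : K) : Prop :=
  forall n : int, exists N : nat, forall i : nat,
    (N <= i)%N -> dval_ge n (u i - l).

Definition dval_complete : Prop :=
  forall u, dval_cauchy u -> exists l, dval_cvg u l.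

Lemma dval1 : v 1 = 0.
Proof.
have := dvalM v (oner_neq0 K) (oner_neq0 K).
by rewrite mulr1 => /eqP; rewrite -subr_eq0 opprD addNKr oppr_eq0 => /eqP.
Qed.

Lemma dvalN1 : v (-1) = 0.
Proof.
have N1 : (-1 : K) != 0 by rewrite oppr_eq0 oner_neq0.
have := dvalM v N1 N1; rewrite mulrNN mulr1 dval1 => /esym/eqP.
by rewrite -mulr2n mulrn_eq0 => /eqP.
Qed.

Lemma dvalV x : x != 0 -> v x^-1 = - v x.
Proof.
move=> x0; apply/eqP; rewrite -addr_eq0.
by rewrite -dvalM ?invr_eq0 // mulVf // dval1.
Qed.

Lemma dval_ge0 n : dval_ge n 0. Proof. by rewrite /dval_ge eqxx. Qed.

Lemma dval_geM m n x y :
  dval_ge m x -> dval_ge n y -> dval_ge (m + n) (x * y).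
Proof.
rewrite /dval_ge mulf_eq0; case: eqVneq => //= x0; case: eqVneq => //= y0.
by move=> mx ny; rewrite dvalM // lerD.
Qed.

Lemma dval_geB n x y : dval_ge n x -> dval_ge n y -> dval_ge n (x - y).
Proof.
move=> nx ny; have {ny} : dval_ge n (- y).
  by rewrite -mulN1r -[n]add0r; apply: dval_geM; rewrite // /dval_ge dvalN1 orbT.
move: nx; rewrite /dval_ge; case: (eqVneq x 0) => [->|x0]; first by rewrite add0r.
case: (eqVneq (- y) 0) => [->|y0]; first by rewrite addr0 (negPf x0).
case: (eqVneq (x - y) 0) => //= xy0 nx ny.
by apply: le_trans (dvalD v x0 y0 xy0); rewrite le_min nx.
Qed.

Definition valuation_ring_pred : {pred K} := dval_ge 0.

Lemma valuation_ring_closed : subring_closed valuation_ring_pred.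
Proof.
split=> [|x y|x y]; first by rewrite unfold_in /dval_ge dval1 orbT.
- exact: dval_geB.
- exact: (@dval_geM 0 0).
Qed.

HB.instance Definition _ :=
  GRing.isSubringClosed.Build K valuation_ring_pred valuation_ring_closed.

Record valuation_ring := ValuationRing {
  valuation_ring_val : K;
  _ : valuation_ring_val \in valuation_ring_pred }.

HB.instance Definition _ := [isSub for valuation_ring_val].
HB.instance Definition _ := [Choice of valuation_ring by <:].
HB.instance Definition _ :=
  [SubChoice_isSubComNzRing of valuation_ring by <:].

(* Values are integers, so positive value means value at least 1. *)
Definition maximal_ideal : {pred valuation_ring} :=
  fun x => dval_ge 1 (val x).

Lemma maximal_ideal_closed : idealr_closed maximal_ideal.
Proof.
split=> [||a x y mx my]; rewrite ?unfold_in ?rmorph0 ?rmorph1 ?dval_ge0 //.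
- by rewrite /dval_ge dval1 (negPf (oner_neq0 K)).
- rewrite rmorphD rmorphM /= -[val y]opprK; apply: dval_geB; last first.
    by rewrite -[- _]add0r; apply: dval_geB => //; apply: dval_ge0.
  by rewrite -[1]add0r; apply: dval_geM => //; case: a.
Qed.

HB.instance Definition _ :=
  isIdealr.Build valuation_ring maximal_ideal maximal_ideal_closed.

Definition residue : Type := {ideal_quot maximal_ideal}.

HB.instance Definition _ := GRing.ComNzRing.on residue.

Local Open Scope quotient_scope.

Definition residue_inv (x : residue) : residue :=
  if x == 0 then 0 else
  if insub (val (repr x))^-1 is Some y then \pi_({ideal_quot maximal_ideal}) y
  else 0.

Lemma residue_mulVf (x : residue) : x != 0 -> residue_inv x * x = 1.
Proof.
move=> x0; rewrite /residue_inv (negPf x0).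
rewrite -[X in _ * X = _](reprK (x : {ideal_quot maximal_ideal})).
have: repr x \notin maximal_ideal.
  apply: contra x0; rewrite -[repr x]subr0 Quotient.idealrBE reprK => /eqP xE.
  by apply/eqP; rewrite [LHS]xE; apply: raddf0.
move: (repr x) => a; rewrite unfold_in /dval_ge negb_or -ltNge.
case/andP=> a0 va; have: dval_ge 0 (val a) by case: a {a0 va}.
rewrite /dval_ge (negPf a0) => /= va0.
have {va0} va : v (val a) = 0 by apply/le_anti; rewrite va0 andbT -ltzD1 add0r.
case: insubP => [y _ yE|/negP[]]; last first.
  by rewrite unfold_in /dval_ge dvalV // va oppr0 lexx orbT.
rewrite -rmorphM /= -[RHS](rmorph1 (\pi_{ideal_quot maximal_ideal})).
by congr (\pi _); apply: val_inj; rewrite rmorphM rmorph1 /= yE mulVf.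
Qed.

Lemma residue_inv0 : residue_inv 0 = 0.
Proof. by rewrite /residue_inv eqxx. Qed.

HB.instance Definition _ :=
  GRing.ComNzRing_isField.Build residue residue_mulVf residue_inv0.

Definition residue_field : fieldType := residue.

End Valued.

(* Main.v *)
(* Write t for an element transcendental over F_p. The residue field k of E is
   generated over the algebraic closure of F_p by compatible roots of t, with a
   q_j-th root exactly for the indices j in a set A obtained by diagonalization
   against all programs, where the q_j are distinct primes. Let M be an unramified
   field with residue field k, let T in M lift t, let w be a root of the Eisenstein
   equation w^p = p (1 + T w), and let E be the completion of M(w).

   If p (1 + z pi) = pi^p in E with z integral, then z reduces to t. Hence the
   existential sentences expressing that such a z is a q_j-th power encode A, and
   the existential theory of E is undecidable.

   The existential theory of k does not depend on A: by specialization, a finite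
   system of polynomial equations and inequations solvable in some extension of F_p
   is solvable in the algebraic closure of F_p.

   Similarly, an algebraic element of E whose value is prime to p would make t
   algebraic over F_p, so the algebraic elements of E form an unramified field. In an
   unramified field an algebraic integer has a p-adic expansion with Teichmueller
   digits; congruences between such digits are determined by the residues, so by
   Newton approximation a zero of a rational polynomial in one unramified field
   yields a zero in E.

   Both decidability statements follow because each property and its negation is
   equivalent to the unsatisfiability of a computable set of propositional clauses,
   which is semidecidable by compactness. *)
From HB Require Import structures.
Require Import Defs.
From mathcomp Require Import all_boot all_order all_algebra.
From mathcomp Require Import all_field cyclic generic_quotient zify ring.
From mathcomp Require Import boolp classical_sets.

Set Implicit Arguments.
Unset Strict Implicit.
Unset Printing Implicit Defensive.

Import Order.TTheory GRing.Theory Num.Theory.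

Local Open Scope nat_scope.

(** * Computable functions *)

Definition computable n (F : seq nat -> nat) :=
  exists f : partrec n, forall s : n.-tuple nat, computes f s (F s).

Lemma computable_ext n F G :
  (forall s, size s = n -> F s = G s) -> computable n F -> computable n G.
Proof. by move=> FG [f fP]; exists f => s; rewrite -FG ?size_tuple. Qed.

Lemma computable_proj n i : i < n -> computable n (nth 0 ^~ i).
Proof.
by move=> ltin; exists (PRProj (Ordinal ltin)) => s; rewrite /= (tnth_nth 0).
Qed.

Lemma computable_comp m n G (F : nat -> seq nat -> nat) :
  computable m G -> (forall i, i < m -> computable n (F i)) ->
  computable n (fun s => G (mkseq (F ^~ s) m)).
Proof.
move=> [f fP] cF.
have /fin_all_exists[g gP] (i : 'I_m) :
  exists h : partrec n, forall s : n.-tuple nat, computes h s (F i s) by exact: cF.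
exists (PRComp f g) => s /=.
have sz : size (mkseq (F ^~ s) m) == m by rewrite size_mkseq.
exists (Tuple sz) => [i|]; last exact: (fP (Tuple sz)).
by rewrite (tnth_nth 0) /= nth_mkseq.
Qed.

Lemma computable_const n c : computable n (fun=> c).
Proof.
elim: c => [|c [f fP]]; first by exists (PRZero n).
exists (PRComp PRSucc (fun=> f)) => s /=.
by exists [tuple c] => // i; rewrite (ord1 i); apply: fP.
Qed.

Lemma computable_op1 (op : nat -> nat) n F :
  computable 1 (fun s => op (nth 0 s 0)) -> computable n F ->
  computable n (fun s => op (F s)).
Proof. by move=> cop cF; apply: (computable_comp (F := fun=> F)) cop _. Qed.

Lemma computable_op2 (op : nat -> nat -> nat) n F G :
  computable 2 (fun s => op (nth 0 s 0) (nth 0 s 1)) ->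
  computable n F -> computable n G -> computable n (fun s => op (F s) (G s)).
Proof.
move=> cop cF cG.
by apply: (computable_comp (F := fun i => if i == 0 then F else G)) cop _ => -[|[]].
Qed.

Lemma computable_succ n F : computable n F -> computable n (fun s => (F s).+1).
Proof.
by apply: (computable_op1 (op := succn)); exists PRSucc => s; rewrite /= /thead (tnth_nth 0).
Qed.

Lemma computable_primrec n F G :
  computable n F -> computable n.+2 G ->
  computable n.+1 (fun s => nat_rect (fun=> nat) (F (behead s))
    (fun k z => G [:: k, z & behead s]) (head 0 s)).
Proof.
move=> [f fP] [g gP]; exists (PRRec f g) => s /=.
rewrite /thead (tnth_nth 0) nth0; elim: (head 0 s) => [|k IH] /=.
  exact: (fP [tuple of behead s]).
eexists; first exact: IH.
exact: (gP [tuple of _]).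
Qed.

Lemma computable_cons n m G (F : nat -> seq nat -> nat) :
  computable (m + n) G -> (forall i, i < m -> computable n (F i)) ->
  computable n (fun s => G (mkseq (F ^~ s) m ++ s)).
Proof.
move=> cG cF; pose H i := if i < m then F i else nth 0 ^~ (i - m).
have cH i : i < m + n -> computable n (H i).
  rewrite /H; case: (ltnP i m) => [lt _|ge lt]; first exact: cF.
  by apply: computable_proj; rewrite ltn_subLR.
apply: computable_ext (computable_comp cG cH) => s sz; congr G.
apply: (@eq_from_nth _ 0) => [|i]; first by rewrite size_cat !size_mkseq sz.
rewrite size_mkseq => lti; rewrite nth_mkseq // nth_cat size_mkseq /H.
by case: (ltnP i m) => // ltm; rewrite nth_mkseq.
Qed.

Lemma computable_rec n N B G :
  computable n N -> computable n B -> computable n.+2 G ->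
  computable n (fun s => nat_rect (fun=> nat) (B s)
    (fun k z => G [:: k, z & s]) (N s)).
Proof.
move=> cN cB cG.
have := @computable_cons n 1 _ (fun=> N) (computable_primrec cB cG).
by move=> /(_ (fun _ _ => cN)).
Qed.

Lemma computable_lift n F : computable n.+1 F ->
  computable n.+2 (fun s => F (head 0 s :: behead (behead s))).
Proof.
pose p i : seq nat -> nat := nth 0 ^~ (if i == 0 then 0 else i.+1).
move=> cF; have cp i : i < n.+1 -> computable n.+2 (p i).
  by move=> lti; apply: computable_proj; case: ifP.
apply: computable_ext (computable_comp cF cp) => s sz; congr F.
case: s sz => [|a [|b s]] //= [sz].
apply: (@eq_from_nth _ 0) => [|i]; first by rewrite size_mkseq /= sz.
by rewrite size_mkseq => lti; rewrite nth_mkseq // /p; case: i lti.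
Qed.

Lemma computable_min n F M :
  computable n.+1 F ->
  (forall s, size s = n -> F (M s :: s) = 0) ->
  (forall s z, size s = n -> z < M s -> F (z :: s) <> 0) ->
  computable n M.
Proof.
move=> [f fP] M0 Mmin; exists (PRMin f) => s /=; split.
  by have := fP [tuple of M s :: s]; rewrite /= M0 ?size_tuple.
move=> z ltz; have := fP [tuple of z :: s]; have := Mmin s z (size_tuple s) ltz.
by rewrite /=; case: (F _) => // k _; exists k.
Qed.

Section Arithmetic.
Variable n : nat.
Implicit Types F G : seq nat -> nat.

Lemma computable_add F G :
  computable n F -> computable n G -> computable n (fun s => F s + G s).
Proof.
apply: (computable_op2 (op := addn)).
apply: computable_ext (computable_rec (computable_proj (ltn0Sn 1))
  (computable_proj (ltnSn 1)) (computable_succ (computable_proj (i := 1) _))) => //.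
by move=> s _; elim: (nth 0 s 0) => //= k ->; rewrite addSn.
Qed.

End Arithmetic.

Lemma computable_mul n F G :
  computable n F -> computable n G -> computable n (fun s => F s * G s).
Proof.
apply: (computable_op2 (op := muln)).
apply: computable_ext (computable_rec (computable_proj (ltn0Sn 1))
  (computable_const 2 0) (computable_add (computable_proj (i := 1) _)
   (computable_proj (i := 3) _))) => //.
by move=> s _; elim: (nth 0 s 0) => //= k ->; rewrite mulSn addnC.
Qed.

Lemma computable_pred n F : computable n F -> computable n (fun s => (F s).-1).
Proof.
apply: (computable_op1 (op := predn)).
apply: computable_ext (computable_rec (computable_proj (ltnSn 0))
  (computable_const 1 0) (computable_proj (i := 0) _)) => //.
by move=> s _; case: (nth 0 s 0).
Qed.

Lemma computable_sub n F G :
  computable n F -> computable n G -> computable n (fun s => F s - G s).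
Proof.
apply: (computable_op2 (op := subn)).
apply: computable_ext (computable_rec (computable_proj (ltnSn 1))
  (computable_proj (ltn0Sn 1)) (computable_pred (computable_proj (i := 1) _))) => //.
by move=> s _; elim: (nth 0 s 1) => [|k /= ->]; rewrite ?subn0 ?subnS.
Qed.

Lemma computable_negb n (P : seq nat -> bool) :
  computable n P -> computable n (fun s => ~~ P s).
Proof.
move=> cP; apply: computable_ext (computable_sub (computable_const n 1) cP) => s _.
by case: (P s).
Qed.

Lemma computable_andb n (P Q : seq nat -> bool) :
  computable n P -> computable n Q -> computable n (fun s => P s && Q s).
Proof.
move=> cP cQ; apply: computable_ext (computable_mul cP cQ) => s _.
by case: (P s); case: (Q s).
Qed.

Lemma computable_orb n (P Q : seq nat -> bool) :
  computable n P -> computable n Q -> computable n (fun s => P s || Q s).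
Proof.
move=> cP cQ; apply: computable_ext (computable_negb (computable_andb
  (computable_negb cP) (computable_negb cQ))) => s _.
by rewrite negb_and !negbK.
Qed.

Lemma computable_leq n F G :
  computable n F -> computable n G -> computable n (fun s => F s <= G s).
Proof.
move=> cF cG; apply: computable_ext
  (computable_sub (computable_const n 1) (computable_sub cF cG)) => s _.
by rewrite -subn_eq0; case: (F s - G s) => //= k; rewrite subSS sub0n.
Qed.

Lemma computable_eqn n F G :
  computable n F -> computable n G -> computable n (fun s => F s == G s).
Proof.
move=> cF cG; apply: computable_ext
  (computable_andb (computable_leq cF cG) (computable_leq cG cF)) => s _.
by rewrite eqn_leq.
Qed.

Lemma computable_has n N (P : seq nat -> bool) :
  computable n N -> computable n.+1 P ->
  computable n (fun s => has (fun y => P (y :: s)) (iota 0 (N s))).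
Proof.
move=> cN /computable_lift cP; pose Q s := (nth 0 s 1 == 1) || P (head 0 s :: behead (behead s)).
have cQ : computable n.+2 Q.
  by apply/computable_orb/cP; apply/computable_eqn/computable_const; apply: computable_proj.
apply: computable_ext (computable_rec cN (computable_const n 0) cQ) => s _.
elim: (N s) => // k IH; have -> : iota 0 k.+1 = iota 0 k ++ [:: k].
  by rewrite -addn1 iotaD.
by rewrite has_cat [LHS]/= IH /Q /= orbF eqb1.
Qed.

Lemma computable_all n N (P : seq nat -> bool) :
  computable n N -> computable n.+1 P ->
  computable n (fun s => all (fun y => P (y :: s)) (iota 0 (N s))).
Proof.
move=> cN cP; apply: computable_ext
  (computable_negb (computable_has cN (computable_negb cP))) => s _.
by rewrite -all_predC; congr (nat_of_bool _); apply: eq_all => y /=; rewrite negbK.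
Qed.

Lemma computable_half n F : computable n F -> computable n (fun s => (F s)./2).
Proof.
apply: (computable_op1 (op := half)).
have c0 : computable 1 (nth 0 ^~ 0) by apply: computable_proj.
pose P s := (nth 0 s 0).*2.+1 < nth 0 s 1.
have cdbl m G : computable m G -> computable m (fun s => (G s).*2).
  by move=> cG; apply: computable_ext (computable_add cG cG) => s _; rewrite addnn.
pose Q s := ~~ (nth 0 s 1 <= (nth 0 s 0).*2.+1).
have cQ : computable 2 Q.
  apply/computable_negb/computable_leq; first exact: computable_proj.
  by apply/computable_succ/cdbl; apply: computable_proj.
by apply: (computable_min cQ) => [[|x []]|[|x []] z] //= _; rewrite /Q /=; lia.
Qed.

Lemma computable_odd n F : computable n F -> computable n (fun s => odd (F s)).
Proof.
move=> cF; have ch := computable_half cF.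
apply: computable_ext (computable_sub cF (computable_add ch ch)) => s _.
by rewrite addnn; have := odd_double_half (F s); lia.
Qed.

Definition bit (sigma i : nat) := odd (iter i half sigma).

Lemma computable_bit n F G :
  computable n F -> computable n G -> computable n (fun s => bit (F s) (G s)).
Proof.
move=> cF cG; apply: computable_odd.
exact: computable_ext (computable_rec cG cF (computable_half (computable_proj (i := 1) _))).
Qed.

Lemma computable_pow2 n F : computable n F -> computable n (fun s => 2 ^ F s).
Proof.
move=> cF; apply: computable_ext (computable_rec cF (computable_const n 1)
  (computable_add (computable_proj (i := 1) _) (computable_proj (i := 1) _))) => //.
by move=> s _; elim: (F s) => //= k ->; rewrite expnS mul2n addnn.
Qed.

Lemma bit_surj (b : nat -> bool) L :
  exists2 sigma, sigma < 2 ^ L & forall i, i < L -> bit sigma i = b i.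
Proof.
elim: L b => [|L IH] b; first by exists 0.
have [s sL sb] := IH (b \o succn); exists (b 0 + s.*2).
  by rewrite expnS mul2n; case: (b 0); lia.
case=> [|i] lti; rewrite /bit.
  by rewrite /= oddD odd_double addbF; case: (b 0).
by rewrite iterSr half_bit_double; apply: sb.
Qed.

Lemma computable_pair n F G :
  computable n F -> computable n G -> computable n (fun s => pair_code (F s) (G s)).
Proof.
move=> cF cG; have c := computable_add cF cG.
exact: computable_add (computable_half (computable_mul c (computable_succ c))) cG.
Qed.

(** * The pairing function *)

Fixpoint unpair n :=
  if n is m.+1 then
    let: (x, y) := unpair m in if x is x'.+1 then (x', y.+1) else (y.+1, 0)
  else (0, 0).

Definition fst_code n := (unpair n).1.
Definition snd_code n := (unpair n).2.

Lemma pair_codeE x y : (pair_code x y).*2 = (x + y) * (x + y).+1 + y.*2.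
Proof.
rewrite /pair_code doubleD; congr (_ + _).
by rewrite -[RHS]odd_double_half oddM /= andbN.
Qed.

Lemma unpairK n : pair_code (fst_code n) (snd_code n) = n.
Proof.
rewrite /fst_code /snd_code; elim: n => //= n IH.
case: (unpair n) IH => [[|x] y] /= <-; apply: double_inj;
  by rewrite doubleS !pair_codeE -!addnn; nia.
Qed.

Lemma pair_code_inj x y x' y' : pair_code x y = pair_code x' y' -> (x = x') * (y = y').
Proof.
move=> /(congr1 double); rewrite !pair_codeE => E.
suff: x + y = x' + y' by move=> S; rewrite S in E; split; lia.
case: (ltngtP (x + y) (x' + y')) => // lt.
- have : (x + y).+1 * (x + y).+2 <= (x' + y') * (x' + y').+1 by apply: leq_mul.
  lia.
- have : (x' + y').+1 * (x' + y').+2 <= (x + y) * (x + y).+1 by apply: leq_mul.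
  lia.
Qed.

Lemma pairK1 x y : fst_code (pair_code x y) = x.
Proof. by have /pair_code_inj[] := unpairK (pair_code x y). Qed.

Lemma pairK2 x y : snd_code (pair_code x y) = y.
Proof. by have /pair_code_inj[] := unpairK (pair_code x y). Qed.

Lemma leq_pair2 x y : y <= pair_code x y.
Proof. by rewrite leq_addl. Qed.

Lemma leq_pair1 x y : x <= pair_code x y.
Proof. by rewrite -leq_double pair_codeE; nia. Qed.

Lemma ltn_pair2 x y : 0 < x -> y < pair_code x y.
Proof. by move=> x0; rewrite -ltn_double pair_codeE; nia. Qed.

Lemma computable_fst n F : computable n F -> computable n (fun s => fst_code (F s)).
Proof.
apply: (computable_op1 (op := fst_code)).
pose P s := ~~ has (fun y => pair_code (nth 0 (y :: s) 1) (nth 0 (y :: s) 0) == nth 0 (y :: s) 2)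
  (iota 0 (nth 0 s 1).+1).
have cP : computable 2 P.
  apply: computable_negb; apply: (@computable_has 2 (fun s => (nth 0 s 1).+1)
    (fun s => pair_code (nth 0 s 1) (nth 0 s 0) == nth 0 s 2)).
    by apply/computable_succ/computable_proj.
  by apply: computable_eqn; [apply: computable_pair|]; apply: computable_proj.
apply: (computable_min cP) => [[|n' []]|[|n' []] z] //= _; rewrite /P.
  apply/eqP; rewrite eqb0 negbK; apply/hasP; exists (snd_code n'); rewrite ?unpairK //.
  by rewrite mem_iota /= add0n ltnS -{2}[n']unpairK leq_pair2.
move=> lt; apply/eqP; rewrite eqb0 negbK; apply/hasPn => y _ /=.
by apply: contraTneq lt => <-; rewrite pairK1 ltnn.
Qed.

Lemma computable_snd n F : computable n F -> computable n (fun s => snd_code (F s)).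
Proof.
apply: (computable_op1 (op := snd_code)).
have c0 : computable 2 (nth 0 ^~ 1) by apply: computable_proj.
pose P s := ~~ (pair_code (fst_code (nth 0 s 1)) (nth 0 s 0) == nth 0 s 1).
have cP : computable 2 P.
  apply: computable_negb; apply: computable_eqn => //.
  by apply: computable_pair; [apply: computable_fst|apply: computable_proj].
apply: (computable_min cP) => [[|n' []]|[|n' []] z] //= _; rewrite /P /=.
  by rewrite unpairK eqxx.
move=> lt; apply/eqP; rewrite eqb0 negbK.
by apply: contraTneq lt => <-; rewrite pairK2 ltnn.
Qed.

Lemma computable_behead n F :
  computable n F -> computable n.+1 (fun s => F (behead s)).
Proof.
move=> cF; have cp i : i < n -> computable n.+1 (nth 0 ^~ i.+1).
  by move=> lti; apply: computable_proj.
apply: computable_ext (computable_comp cF cp) => s sz; congr F.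
apply: (@eq_from_nth _ 0); first by rewrite size_mkseq size_behead sz.
by move=> i; rewrite size_mkseq => lti; rewrite nth_mkseq // nth_behead.
Qed.

(** * Clausal theories *)

Inductive expr : Type :=
| EIn
| EWit
| EVar of nat
| ECst of nat
| ESucc of expr
| EAdd of expr & expr
| EPair of expr & expr
| EFst of expr
| ESnd of expr.

HB.instance Definition _ := gen_eqMixin expr.

Definition clause := seq (bool * expr).

Section Clauses.
Variables a w : nat.

Fixpoint eval (env : nat -> nat) (e : expr) : nat :=
  match e with
  | EIn => a
  | EWit => w
  | EVar i => env i
  | ECst n => n
  | ESucc e => (eval env e).+1
  | EAdd e f => eval env e + eval env f
  | EPair e f => pair_code (eval env e) (eval env f)
  | EFst e => fst_code (eval env e)
  | ESnd e => snd_code (eval env e)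
  end.

Definition clause_true (S : nat -> bool) env (c : clause) :=
  has (fun l => S (eval env l.2) == l.1) c.

Fixpoint clause_holds (S : nat -> Prop) env (c : clause) : Prop :=
  match c with
  | [::] => False
  | [:: (true, e)] => S (eval env e)
  | (true, e) :: c => S (eval env e) \/ clause_holds S env c
  | (false, e) :: c => S (eval env e) -> clause_holds S env c
  end.

Fixpoint holds (S : nat -> Prop) (th : seq clause) : Prop :=
  if th is c :: th then (forall env, clause_holds S env c) /\ holds S th else True.

Lemma clause_holdsP (S : nat -> bool) env c :
  clause_true S env c <-> clause_holds S env c.
Proof.
elim: c => [|[[] e] [|l c] IH] //=; first by rewrite orbF eqb_id.
- case: IH => H1 H2; rewrite eqb_id; split=> [/orP[|/H1]|[->//|/H2]]; try by [left|right].
  by move=> H; apply/orP; right.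
- by rewrite eqbF_neg; split=> [/orP[/negP|//]|/negP ->].
- case: IH => H1 H2; rewrite eqbF_neg; split=> [/orP[/negP|/H1]|] //.
  by case: (S _) => //= /(_ isT)/H2.
Qed.

Definition models (S : nat -> bool) (th : seq clause) :=
  forall env, all (clause_true S env) th.

Definition unsat th := forall S, ~ models S th.

Lemma holds_models (S : nat -> bool) th : holds S th <-> models S th.
Proof.
elim: th => [|c th IH] //=; split=> [[H /IH m] env|m].
  by rewrite /= m andbT; apply/clause_holdsP.
split=> [env|]; first by have /andP[/clause_holdsP] := m env.
by apply/IH => env; have /andP[] := m env.
Qed.

Lemma unsatP th : unsat th <-> forall S, ~ holds S th.
Proof.
split=> [un S HS|un S /holds_models]; last exact: un.
apply: (un (fun n => `[< S n >])); apply/holds_models.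
suff -> : (fun n => `[< S n >] : Prop) = S by [].
by apply: funext => n; apply: propext; split=> [/asboolP //|Sn]; apply/asboolP.
Qed.

Lemma holds_cat S th th' : holds S (th ++ th') <-> holds S th /\ holds S th'.
Proof. by elim: th => [|c th IH] /=; rewrite ?IH; tauto. Qed.

Lemma holds_nth S th i env :
  holds S th -> i < size th -> clause_holds S env (nth [::] th i).
Proof. by elim: th i => [|c th IH] [|i] //= [H HS] //; apply: IH. Qed.

Definition env_of n i := fst_code (iter i snd_code n).

Lemma env_of_surj (env : nat -> nat) k :
  exists n, forall i, i < k -> env_of n i = env i.
Proof.
elim: k env => [|k IH] env; first by exists 0.
have [n nP] := IH (env \o succn); exists (pair_code (env 0) n) => -[|i] lti.
  by rewrite /env_of /= pairK1.
by rewrite /env_of iterSr pairK2 [LHS]nP.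
Qed.

Fixpoint ewidth e :=
  match e with
  | EIn | EWit | ECst _ => 0
  | EVar i => i.+1
  | ESucc e | EFst e | ESnd e => ewidth e
  | EAdd e f | EPair e f => maxn (ewidth e) (ewidth f)
  end.

Lemma eq_eval env env' e :
  (forall i, i < ewidth e -> env i = env' i) -> eval env e = eval env' e.
Proof.
by elim: e => //= [i -> | e IH /IH-> | e IHe f IHf H | e IHe f IHf H | e IH /IH-> | e IH /IH->] //;
  rewrite IHe ?IHf // => i lti; apply: H; rewrite leq_max lti ?orbT.
Qed.

Lemma modelsP S th :
  (forall n, all (clause_true S (env_of n)) th) -> models S th.
Proof.
move=> H env.
pose k := \max_(c <- th) \max_(l <- c) ewidth l.2.
have [n nP] := env_of_surj env k; apply: etrans (H n); apply: eq_in_all => c cth.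
apply: eq_in_has => l lc; congr (S _ == _); apply: eq_eval => i lti; rewrite nP //.
apply: leq_trans lti _; apply: (@leq_trans (\max_(l <- c) ewidth l.2)).
  exact: (leq_bigmax_seq (F := fun l : bool * expr => ewidth l.2)).
exact: (leq_bigmax_seq (F := fun c : clause => \max_(l <- c) ewidth l.2)).
Qed.

Definition falsified (S : nat -> bool) L env (c : clause) :=
  all (fun l => (eval env l.2 < L) && (S (eval env l.2) != l.1)) c.

Definition refutes (S : nat -> bool) L th :=
  has (fun n => has (falsified S L (env_of n)) th) (iota 0 L).

Definition refuted L th :=
  all (fun sigma => refutes (bit sigma) L th) (iota 0 (2 ^ L)).

Lemma eq_refutes S S' L th :
  (forall i, i < L -> S i = S' i) -> refutes S L th = refutes S' L th.
Proof.
move=> SS'; apply: eq_has => n; apply: eq_has => c; apply: eq_all => l.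
by case: ltnP => //= /SS' ->.
Qed.

Lemma refutesS S L L' th : L <= L' -> refutes S L th -> refutes S L' th.
Proof.
move=> leL /hasP[n]; rewrite mem_iota /= add0n => ltn /hasP[c cth /allP fc].
apply/hasP; exists n; first by rewrite mem_iota /= add0n (leq_trans ltn).
by apply/hasP; exists c => //; apply/allP => l /fc/andP[lt ->]; rewrite (leq_trans lt).
Qed.

Lemma not_modelsP S th : ~ models S th <-> exists L, refutes S L th.
Proof.
split=> [nm|[L /hasP[n _ /hasP[c cth /allP fc]]] m]; last first.
  have /allP/(_ c cth)/hasP[l lc /eqP E] := m (env_of n).
  by have /andP[_] := fc l lc; rewrite E eqxx.
apply: contrapT => nL; apply: nm; apply: modelsP => n; apply/allP => c cth.
apply: contrapT => /negP/hasPn H; apply: nL.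
pose k := \max_(l <- c) eval (env_of n) l.2.
exists (maxn n.+1 k.+1); apply/hasP; exists n; first by rewrite mem_iota leq_max leqnn.
apply/hasP; exists c => //; apply/allP => l lc; rewrite H // andbT leq_max; apply/orP; right.
by rewrite ltnS; apply: (leq_bigmax_seq (F := fun l : bool * expr => eval (env_of n) l.2)).
Qed.

Lemma refuted_unsat L th : refuted L th -> unsat th.
Proof.
move=> /allP rL S; apply/not_modelsP; exists L.
have [sigma lts bS] := bit_surj S L; rewrite -(eq_refutes _ bS).
by apply: rL; rewrite mem_iota.
Qed.

Lemma unsat_refuted th : unsat th -> exists L, refuted L th.
Proof.
move=> un; apply: contrapT => nL.
have ex L : exists S, ~~ refutes S L th.
  apply: contrapT => nS; apply: nL; exists L; apply/allP => s _.
  by apply: contrapT => /negP H; apply: nS; exists (bit s).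
pose good s := forall L, exists S,
  ~~ refutes S L th /\ forall i, i < size s -> S i = nth false s i.
have good_rcons s : good s -> good (rcons s true) \/ good (rcons s false).
  move=> gs; apply: contrapT => /not_orP[/existsNP[L1 H1] /existsNP[L2 H2]].
  have [S [rS Ss]] := gs (maxn L1 L2).
  have agree b : S (size s) = b ->
      forall i, i < size (rcons s b) -> S i = nth false (rcons s b) i.
    move=> E i; rewrite size_rcons nth_rcons ltnS leq_eqVlt.
    by case: ltngtP => [/Ss||->].
  case E: (S (size s)); [apply: H1|apply: H2]; exists S; split; try exact: agree.
  - by apply: contra rS; apply/refutesS/leq_maxl.
  - by apply: contra rS; apply/refutesS/leq_maxr.
pose ext := fix ext n := if n is m.+1 then
  rcons (ext m) `[< good (rcons (ext m) true) >] else [::].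
have gext n : good (ext n).
  elim: n => [|n /good_rcons IH]; first by move=> L; have [S] := ex L; exists S.
  by rewrite /=; case: asboolP => // ?; case: IH.
have sext n : size (ext n) = n by elim: n => //= n IH; rewrite size_rcons IH.
have nthext n i : i < n -> nth false (ext n) i = nth false (ext i.+1) i.
  elim: n => // n IH; rewrite ltnS leq_eqVlt => /orP[/eqP -> //|lti].
  by rewrite [LHS]/= nth_rcons sext lti IH.
apply: (un (fun i => nth false (ext i.+1) i)); apply: contrapT => /not_modelsP[L].
apply/negP; have [S [rS Ss]] := gext L L; rewrite (@eq_refutes _ S) // => i lti.
by rewrite Ss ?sext // nthext.
Qed.

End Clauses.

Lemma computable_eval n A W N e :
  computable n A -> computable n W -> computable n N ->
  computable n (fun s => eval (A s) (W s) (env_of (N s)) e).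
Proof.
move=> cA cW cN; elim: e => //=.
- move=> i; apply: computable_fst; elim: i => //= i IH; exact: computable_snd.
- exact: computable_const.
- by move=> e IH; apply: computable_succ.
- by move=> e IHe f IHf; apply: computable_add.
- by move=> e IHe f IHf; apply: computable_pair.
- by move=> e IH; apply: computable_fst.
- by move=> e IH; apply: computable_snd.
Qed.

Lemma computable_all_seq n T (P : T -> seq nat -> bool) l :
  (forall x, computable n (P x)) -> computable n (fun s => all (P ^~ s) l).
Proof.
move=> cP; elim: l => [|x l IH] /=; first exact: computable_const.
exact: computable_andb.
Qed.

Lemma computable_has_seq n T (P : T -> seq nat -> bool) l :
  (forall x, computable n (P x)) -> computable n (fun s => has (P ^~ s) l).
Proof.
move=> cP; elim: l => [|x l IH] /=; first exact: computable_const.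
exact: computable_orb.
Qed.

Lemma computable_refuted n A W L th :
  computable n A -> computable n W -> computable n L ->
  computable n (fun s => refuted (A s) (W s) (L s) th).
Proof.
move=> cA cW cL; apply: (@computable_all n (fun s => 2 ^ L s)
  (fun s => refutes (A (behead s)) (W (behead s)) (bit (head 0 s)) (L (behead s)) th)).
  exact: computable_pow2.
have [{}cA {}cW {}cL] : [/\ computable n.+1 (fun s => A (behead s)),
    computable n.+1 (fun s => W (behead s)) & computable n.+1 (fun s => L (behead s))].
  by split; apply: computable_behead.
apply: (@computable_has n.+1 (fun s => L (behead s)) (fun s => has (falsified
  (A (behead (behead s))) (W (behead (behead s))) (bit (nth 0 s 1))
  (L (behead (behead s))) (env_of (head 0 s))) th)) => //.
apply: computable_has_seq => c; apply: computable_all_seq => -[b e] /=.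
have ce := computable_eval e (computable_behead cA) (computable_behead cW)
  (computable_proj (ltn0Sn n.+1)).
apply: computable_andb.
  by apply: computable_leq; [exact: computable_succ | exact: (computable_behead cL)].
apply: computable_negb; case: b.
  apply: computable_ext (computable_bit (computable_proj (i := 1) _) ce) => // s _.
  by rewrite eqb_id.
apply: computable_ext (computable_negb (computable_bit (computable_proj (i := 1) _) ce)) => // s _.
by rewrite eqbF_neg.
Qed.

Theorem decidable_by_refutation (P N : seq clause) (D : nat -> Prop) :
  (forall a, D a <-> exists w, unsat a w P) ->
  (forall a, ~ D a <-> exists w, unsat a w N) -> decidable_set D.
Proof.
move=> DP DN; pose R th a l := refuted a (fst_code l) (snd_code l) th.
have ex_unsat th a : (exists w, unsat a w th) -> exists l, R th a l.
  move=> [w /unsat_refuted[L rL]]; exists (pair_code w L).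
  by rewrite /R pairK1 pairK2.
have R_unsat th a l : R th a l -> exists w, unsat a w th.
  by move=> /refuted_unsat; exists (fst_code l).
have ex a : exists l, R P a l || R N a l.
  have [/DP/ex_unsat[l]|/DN/ex_unsat[l]] := EM (D a) => H; exists l; rewrite H ?orbT //.
pose M s := ex_minn (ex (nth 0 s 0)).
have cR th n A B : computable n A -> computable n B ->
    computable n (fun s => R th (A s) (B s)).
  move=> cA cB; apply: computable_refuted => //; first exact: computable_fst.
  exact: computable_snd.
have cM : computable 1 M.
  have c2 : computable 2 (fun s => ~~ (R P (nth 0 s 1) (nth 0 s 0) || R N (nth 0 s 1) (nth 0 s 0))).
    by apply/computable_negb/computable_orb; apply: cR; apply: computable_proj.
  apply: (computable_min c2) => [s|s z] _; rewrite /M /=; case: ex_minnP => l Pl Hl.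
    by rewrite Pl.
  by move=> lt; case E: (_ || _) => // _; have /Hl := E; rewrite leqNgt lt.
have [f fP] : computable 1 (fun s => R P (nth 0 s 0) (M s)).
  by apply: cR cM; apply: computable_proj.
exists f => a; exists (R P a (M [:: a])); split; first exact: (fP [tuple a]).
rewrite /M /=; case: ex_minnP => l; case E: (R P a l) => /= RN _.
  by split=> // _; apply/DP/R_unsat/E.
by split=> // Da; case: (DN a).2 => //; apply: R_unsat RN.
Qed.

(** * Countability of programs *)

Fixpoint program_code n (f : partrec n) : nat :=
  match f with
  | PRZero n => pair_code 0 n
  | PRSucc => pair_code 1 0
  | PRProj n i => pair_code 2 (pair_code n i)
  | PRComp m n f g => pair_code 3 (pair_code (pair_code m n)
      (pair_code (program_code f) (seq_code [seq program_code (g i) | i <- enum 'I_m])))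
  | PRRec n f g => pair_code 4 (pair_code (program_code f) (program_code g))
  | PRMin n f => pair_code 5 (program_code f)
  end.

Lemma seq_code_inj : injective seq_code.
Proof. by elim=> [|x s IH] [|y t] //= [/pair_code_inj[-> /IH ->]]. Qed.

Lemma program_code_inj n (f : partrec n) m (g : partrec m) :
  program_code f = program_code g -> existT partrec n f = existT partrec m g.
Proof.
elim: f m g => [n0||n0 i|m0 n0 f IHf g IHg|n0 f IHf g IHg|n0 f IHf] m
  [n1||n1 j|m1 n1 f' g'|n1 f' g'|n1 f'] /=; try by move/pair_code_inj=> [].
- by move/pair_code_inj=> [_ ->].
- move/pair_code_inj=> [_ /pair_code_inj[e]]; rewrite e in i *.
  by move/ord_inj => ->.
- move/pair_code_inj=> [_ /pair_code_inj[/pair_code_inj[em en]]].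
  move/pair_code_inj=> [/IHf ef /seq_code_inj eg].
  rewrite {}em {}en in f g IHf IHg ef eg *.
  rewrite (Eqdep_dec.inj_pair2_eq_dec _ PeanoNat.Nat.eq_dec _ _ _ _ ef).
  congr (existT _ _ (PRComp _ _)); apply: funext => i.
  have /(congr1 (fun s => nth 0 s i)) := eg.
  rewrite !(nth_map i) -?enumT ?size_enum_ord // !nth_ord_enum => /IHg E.
  exact: (Eqdep_dec.inj_pair2_eq_dec _ PeanoNat.Nat.eq_dec _ _ _ _ E).
- move/pair_code_inj=> [_ /pair_code_inj[/IHf ef /IHg eg]].
  have e : n0 = n1 by have := congr1 (@projT1 _ _) ef.
  rewrite {}e in f g IHf IHg ef eg *.
  rewrite (Eqdep_dec.inj_pair2_eq_dec _ PeanoNat.Nat.eq_dec _ _ _ _ ef).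
  by rewrite (Eqdep_dec.inj_pair2_eq_dec _ PeanoNat.Nat.eq_dec _ _ _ _ eg).
- move/pair_code_inj=> [_ /IHf ef].
  have e : n0 = n1 by have := congr1 (fun x => (projT1 x).-1) ef.
  rewrite {}e in f IHf ef *.
  by rewrite (Eqdep_dec.inj_pair2_eq_dec _ PeanoNat.Nat.eq_dec _ _ _ _ ef).
Qed.

Definition accepts (j n : nat) :=
  exists2 f : partrec 1, program_code f = j & computes f [tuple n] 1.

Lemma computes_inj n (f : partrec n) s y z :
  computes f s y -> computes f s z -> y = z.
Proof.
elim: f s y z => [n0||n0 i|m0 n0 f IHf g IHg|n0 f IHf g IHg|n0 f IHf] s y z /=;
  try by move=> -> ->.
- move=> [t gt ft] [u gu fu]; suff E : t = u by rewrite E in ft; apply: IHf ft fu.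
  by apply: eq_from_tnth => i; apply: IHg (gt i) (gu i).
- elim: (thead s) y z => [|k IH] y z /=; first exact: IHf.
  by move=> [a /IH Ea ga] [b /Ea E gb]; rewrite E in ga; apply: IHg ga gb.
- move=> [f0 fy] [f1 fz]; case: (ltngtP y z) => // lt.
    by have [k /(IHf _ _ _ f0)] := fz _ lt.
  by have [k /(IHf _ _ _ f1)] := fy _ lt.
Qed.

Lemma decidable_accepts (A : nat -> Prop) :
  decidable_set A -> exists j, forall n, A n <-> accepts j n.
Proof.
move=> [f fP]; exists (program_code f) => n; have [b [fb Ab]] := fP n.
split=> [/Ab b1|[g /program_code_inj e g1]].
  by exists f => //; move: fb; rewrite b1.
have {}e := Eqdep_dec.inj_pair2_eq_dec _ PeanoNat.Nat.eq_dec _ _ _ _ e.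
rewrite e in g1; apply/Ab; have := computes_inj fb g1.
by case: b {Ab fb}.
Qed.

(** * Fields presented by generators up to equivalence *)

Section FieldOfSetoid.
Local Open Scope ring_scope.
Local Open Scope quotient_scope.
Variables (T : Type) (R : T -> T -> Prop) (zero one : T).
Variables (add mul : T -> T -> T) (opp inv : T -> T).
Hypothesis Rrefl : forall x, R x x.
Hypothesis Rsym : forall x y, R x y -> R y x.
Hypothesis Rtrans : forall x y z, R x y -> R y z -> R x z.
Hypothesis addR : forall x x' y y', R x x' -> R y y' -> R (add x y) (add x' y').
Hypothesis mulR : forall x x' y y', R x x' -> R y y' -> R (mul x y) (mul x' y').
Hypothesis oppR : forall x x', R x x' -> R (opp x) (opp x').
Hypothesis addA : forall x y z, R (add x (add y z)) (add (add x y) z).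
Hypothesis addC : forall x y, R (add x y) (add y x).
Hypothesis add0 : forall x, R (add zero x) x.
Hypothesis addN : forall x, R (add (opp x) x) zero.
Hypothesis mulA : forall x y z, R (mul x (mul y z)) (mul (mul x y) z).
Hypothesis mulC : forall x y, R (mul x y) (mul y x).
Hypothesis mul1 : forall x, R (mul one x) x.
Hypothesis mulD : forall x y z, R (mul (add x y) z) (add (mul x z) (mul y z)).
Hypothesis one0 : ~ R one zero.
Hypothesis invP : forall x, ~ R x zero -> R (mul (inv x) x) one.

Let r (x y : {classic T}) := `[< R x y >].

Let r_equiv : equiv_class_of r.
Proof.
split=> [x|x y|y x z]; rewrite /r.
- by apply/asboolP.
- by apply: asbool_equiv_eq; split; apply: Rsym.
- by move=> /asboolP xy /asboolP yz; apply/asboolP; apply: Rtrans yz.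
Qed.

Let e : equiv_rel {classic T} := EquivRelPack r_equiv.

Definition setoid_quot := {eq_quot e}.
HB.instance Definition _ := Choice.on setoid_quot.

Let pi (x : T) : setoid_quot := \pi_({eq_quot e}) (x : {classic T}).
Let rep (q : setoid_quot) : T := repr (q : {eq_quot e}).

Let piP x y : pi x = pi y <-> R x y.
Proof.
split=> [/eqP|xy]; first by rewrite /pi eqmodE => /asboolP.
by apply/eqP; rewrite /pi eqmodE; apply/asboolP.
Qed.

Let repK x : R (rep (pi x)) x. Proof. by apply/piP; rewrite /pi /rep reprK. Qed.
Let piK q : pi (rep q) = q. Proof. by rewrite /pi /rep reprK. Qed.

Let qadd x y := pi (add (rep x) (rep y)).
Let qmul x y := pi (mul (rep x) (rep y)).
Let qopp x := pi (opp (rep x)).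
Let qinv x := if x == pi zero then pi zero else pi (inv (rep x)).

Let pi_add x y : pi (add x y) = qadd (pi x) (pi y).
Proof. by apply/piP/addR; apply/Rsym/repK. Qed.
Let pi_mul x y : pi (mul x y) = qmul (pi x) (pi y).
Proof. by apply/piP/mulR; apply/Rsym/repK. Qed.
Let pi_opp x : pi (opp x) = qopp (pi x).
Proof. by apply/piP/oppR; apply/Rsym/repK. Qed.

Let qaddA : associative qadd.
Proof.
by move=> x y z; rewrite -[x]piK -[y]piK -[z]piK -!pi_add; apply/piP.
Qed.
Let qaddC : commutative qadd.
Proof. by move=> x y; rewrite -[x]piK -[y]piK -!pi_add; apply/piP. Qed.
Let qadd0 : left_id (pi zero) qadd.
Proof. by move=> x; rewrite -[x]piK -!pi_add; apply/piP. Qed.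
Let qaddN : left_inverse (pi zero) qopp qadd.
Proof. by move=> x; rewrite -[x]piK -pi_opp -!pi_add; apply/piP. Qed.
Let qmulA : associative qmul.
Proof.
by move=> x y z; rewrite -[x]piK -[y]piK -[z]piK -!pi_mul; apply/piP.
Qed.
Let qmulC : commutative qmul.
Proof. by move=> x y; rewrite -[x]piK -[y]piK -!pi_mul; apply/piP. Qed.
Let qmul1 : left_id (pi one) qmul.
Proof. by move=> x; rewrite -[x]piK -!pi_mul; apply/piP. Qed.
Let qmulD : left_distributive qmul qadd.
Proof.
move=> x y z; rewrite -[x]piK -[y]piK -[z]piK -pi_add -!pi_mul -pi_add.
exact/piP.
Qed.
Let q10 : pi one != pi zero. Proof. by apply/eqP => /piP. Qed.

HB.instance Definition _ := GRing.isZmodule.Build setoid_quot qaddA qaddC qadd0 qaddN.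
HB.instance Definition _ :=
  GRing.Zmodule_isComNzRing.Build setoid_quot qmulA qmulC qmul1 qmulD q10.

Let qmulV (x : setoid_quot) : x != 0 -> qinv x * x = 1.
Proof.
move=> x0; rewrite /qinv ifN // -[x in _ * x]piK -[LHS]pi_mul; apply/piP/invP.
by apply: contra_not (negP x0) => /piP; rewrite piK => ->.
Qed.
Let qinv0 : qinv 0 = 0. Proof. by rewrite /qinv eqxx. Qed.

HB.instance Definition _ := GRing.ComNzRing_isField.Build setoid_quot qmulV qinv0.

Lemma field_of_setoid : exists (K : fieldType) (f : T -> K),
  [/\ forall q, exists x, f x = q,
      forall x y, f x = f y <-> R x y,
      f zero = 0, f one = 1 &
      [/\ {morph f : x y / add x y >-> x + y}, {morph f : x y / mul x y >-> x * y} &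
      {morph f : x / opp x >-> - x}]].
Proof.
exists setoid_quot, pi; split=> //; by move=> q; exists (rep q).
Qed.

End FieldOfSetoid.
Local Open Scope ring_scope.

(** * Specialization of finitely generated domains *)

Lemma ex_min_measure T (P : T -> Prop) (f : T -> nat) :
  (exists x, P x) -> exists2 x, P x & forall y, P y -> (f x <= f y)%N.
Proof.
move=> [x0 Px0]; have exn : exists n, `[< exists2 x, P x & f x = n >].
  by exists (f x0); apply/asboolP; exists x0.
case: (ex_minnP exn) => n /asboolP[x Px fx] Hn; exists x => // y Py.
by rewrite fx; apply: Hn; apply/asboolP; exists y.
Qed.

Lemma closed_field_nonroot (F : closedFieldType) (q : {poly F}) :
  q != 0 -> exists x, q.[x] != 0.
Proof.
move=> q0; case: (leqP (size q) 1) => [s1|s2].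
  exists 0; rewrite (size1_polyC s1) hornerC; apply: contra q0 => /eqP E.
  by rewrite (size1_polyC s1) E.
have [|x] := closed_rootP (q - 1) _.
  by rewrite size_polyDl ?size_polyN ?size_poly1 // neq_ltn s2 orbT.
by rewrite rootE !hornerE subr_eq0 => /eqP qx; exists x; rewrite qx oner_eq0.
Qed.

Lemma coef_rmap (R S : nzRingType) (f : {rmorphism R -> S}) (q : {poly R}) i :
  (map_poly f q)`_i = f q`_i.
Proof. exact: coef_map. Qed.

Section Specialization.
Variables (R : idomainType) (K : fieldType) (F : closedFieldType).
Variables (eps : {rmorphism R -> K}) (x : K).
Implicit Types p q u : {poly R}.

Let trim q :
  exists2 q', map_poly eps q' = map_poly eps q & size q' = size (map_poly eps q).
Proof.
set n := size _; exists (\poly_(i < n) q`_i).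
  apply/polyP => i; rewrite !coef_rmap coef_poly; case: ltnP => //= le.
  by rewrite rmorph0 -coef_rmap nth_default.
apply/eqP; rewrite eqn_leq size_poly leqNgt; apply/negP => lt.
case: (posnP n) => [n0|n0]; first by rewrite n0 in lt.
have le : (size (\poly_(i < n) q`_i)%R <= n.-1)%N by rewrite -ltnS prednK.
have := @nth_default _ (0 : R) _ _ le; rewrite coef_poly prednK // leqnn => E.
have: lead_coef (map_poly eps q) = 0 by rewrite lead_coefE -/n coef_rmap E rmorph0.
by move/eqP; rewrite lead_coef_eq0 -size_poly_eq0 -/n => /eqP n0'; rewrite n0' in n0.
Qed.

Let pdiv p q : size q = size (map_poly eps q) -> q != 0 ->
  exists k a r, [/\ eps (lead_coef q ^+ k) != 0,
    lead_coef q ^+ k *: p = a * q + r & (size r < size q)%N].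
Proof.
move=> sq q0; exists (scalp p q), (p %/ q), (p %% q).
split; [|exact: Pdiv.Idomain.divp_eq|by rewrite ltn_modp].
rewrite rmorphXn expf_neq0 // lead_coefE sq -coef_rmap -lead_coefE lead_coef_eq0.
by rewrite -size_poly_eq0 -sq size_poly_eq0.
Qed.

Lemma specialization_step u : (map_poly eps u).[x] != 0 ->
  exists2 w : R, eps w != 0 & forall phi : {rmorphism R -> F},
    (forall r, eps r = 0 -> phi r = 0) -> phi w != 0 ->
    exists x' : F, (map_poly phi u).[x'] != 0 /\
      forall q, (map_poly eps q).[x] = 0 -> (map_poly phi q).[x'] = 0.
Proof.
move=> ux.
have mapK (phi : {rmorphism R -> F}) p q : (forall r, eps r = 0 -> phi r = 0) ->
    map_poly eps p = map_poly eps q -> map_poly phi p = map_poly phi q.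
  move=> ker /polyP E; apply/polyP => i; rewrite !coef_rmap; apply/eqP.
  rewrite -subr_eq0 -rmorphB ker //; apply/eqP.
  by rewrite rmorphB subr_eq0 -!coef_rmap E.
have [alg|trans] := pselect (exists q, (map_poly eps q).[x] = 0 /\ map_poly eps q != 0); last first.
  have [i ui] : exists i, eps u`_i != 0.
    apply: contrapT => H; move/eqP: ux; apply; suff -> : map_poly eps u = 0 by rewrite horner0.
    apply/polyP => i; rewrite coef_rmap coef0; apply/eqP; apply: contrapT => /negP ui.
    by apply: H; exists i.
  exists u`_i => // phi ker wi; have [x' x'P] : exists x', (map_poly phi u).[x'] != 0.
    by apply: closed_field_nonroot; apply: contraNneq wi => /polyP/(_ i); rewrite coef_rmap coef0 => ->.
  exists x'; split=> // q qx; suff -> : map_poly phi q = map_poly phi 0.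
    by rewrite rmorph0 horner0.
  apply: mapK => //; rewrite rmorph0; apply/eqP; apply: contrapT => /negP q0.
  by apply: trans; exists q.
have [m0 [m0x m00] m0min] := ex_min_measure (fun q => size (map_poly eps q)) alg.
have [m mE sm] := trim m0.
have [mx mn0] : (map_poly eps m).[x] = 0 /\ map_poly eps m != 0 by rewrite mE.
have {m0min} mmin q : (map_poly eps q).[x] = 0 -> (size q < size m)%N ->
    map_poly eps q = 0.
  move=> qx lt; apply/eqP; apply: contrapT => /negP q0.
  have := m0min q (conj qx q0); rewrite -sm leqNgt => /negP[].
  exact: leq_ltn_trans (size_poly _ _) lt.
have {}sm : size m = size (map_poly eps m) by rewrite mE.
have m_n0 : m != 0 by rewrite -size_poly_eq0 sm size_poly_eq0.
have lm : eps (lead_coef m) != 0.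
  by rewrite lead_coefE sm -coef_rmap -lead_coefE lead_coef_eq0.
pose comb s := (exists a b, map_poly eps s = map_poly eps (a * m + b * u)) /\
  (map_poly eps s).[x] != 0.
have [s0 [[a0 [b0 s0E]] s0x] s0min] :=
  @ex_min_measure _ comb (fun q => size (map_poly eps q))
  (ex_intro _ u (conj (ex_intro _ 0 (ex_intro _ 1 (congr1 _ (esym
    (etrans (congr1 (+%R^~ _) (mul0r m)) (etrans (add0r _) (mul1r u))))))) ux)).
have [s sE ss] := trim s0.
have [sC sx] : map_poly eps s = map_poly eps (a0 * m + b0 * u) /\ (map_poly eps s).[x] != 0.
  by rewrite sE.
have {s0min} smin q : comb q -> (size s <= size q)%N.
  move=> /s0min le; rewrite ss; exact: leq_trans le (size_poly _ _).
have {}ss : size s = size (map_poly eps s) by rewrite sE.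
have sn0 : s != 0 by apply: contraNneq sx => ->; rewrite rmorph0 horner0.
have hM p q y : (map_poly eps (p * q)).[y] = (map_poly eps p).[y] * (map_poly eps q).[y].
  by rewrite rmorphM hornerM.
have sltm : (size s < size m)%N.
  have [k [a [r []]]] := pdiv u sm m_n0; set c := _ ^+ k => c0 E lt.
  apply: leq_ltn_trans lt; apply: smin; split.
    by exists (- a), c%:P; rewrite mul_polyC E mulNr addKr.
  have /(congr1 (fun p => (map_poly eps p).[x])) := E.
  rewrite -mul_polyC hM rmorphD hornerD hM mx mulr0 add0r /= map_polyC hornerC => <-.
  by rewrite mulf_neq0.
have s1 : (size s <= 1)%N.
  rewrite leqNgt; apply/negP => sgt1.
  have [k [a [r []]]] := pdiv m ss sn0; set c := _ ^+ k => c0 E lt.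
  have Ex := congr1 (fun p => (map_poly eps p).[x]) E.
  rewrite /= -mul_polyC hM mx mulr0 rmorphD hornerD hM in Ex.
  have [rx|/eqP rx] := eqVneq (map_poly eps r).[x] 0; last first.
    have := smin r; rewrite leqNgt lt => H; have : false = true; last by [].
    apply: H; split; last by apply/eqP.
    exists (c%:P - a * a0), (- (a * b0)).
    have -> : r = c *: m - a * s by rewrite E addrC addKr.
    rewrite -mul_polyC !(rmorphB, rmorphD, rmorphM, rmorphN) /= sC.
    by rewrite !(rmorphB, rmorphD, rmorphM, rmorphN) /=; ring.
  have r0 := mmin r rx (ltn_trans lt sltm).
  rewrite rx addr0 in Ex; have ax : (map_poly eps a).[x] = 0.
    by apply/eqP; move/esym/eqP: Ex; rewrite mulf_eq0 (negPf sx) orbF.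
  have Em : map_poly eps (c *: m) = map_poly eps a * map_poly eps s.
    by rewrite E rmorphD rmorphM /= r0 addr0.
  have an0 : map_poly eps a != 0.
    apply/eqP => a0'; move: Em; rewrite a0' mul0r -mul_polyC rmorphM /= map_polyC mul_polyC.
    by move/eqP; rewrite scaler_eq0 (negPf c0) (negPf mn0).
  have [a' a'E sa'] := trim a.
  have : map_poly eps a' = 0.
    apply: mmin; first by rewrite a'E.
    rewrite sa' sm; have := congr1 (fun P : {poly K} => size P) Em.
    rewrite -mul_polyC rmorphM /= map_polyC mul_polyC size_scale // size_mul //.
      move=> ->; rewrite -ss; case: (size s) sgt1 => [|[|l]] // _.
      by rewrite !addnS /= ltnS leq_addr.
    by rewrite -size_poly_eq0 -ss size_poly_eq0.
  by rewrite a'E; apply/eqP.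
have sCc : s = (s`_0)%:P by apply: size1_polyC.
exists (lead_coef m * s`_0).
  rewrite rmorphM mulf_neq0 //.
  by move: sx; rewrite sCc map_polyC hornerC coefC eqxx.
move=> phi ker; rewrite rmorphM mulf_eq0 negb_or => /andP[pm ps].
have size_mF : size (map_poly phi m) = size m by rewrite size_map_poly_id0.
have mgt1 : size (map_poly phi m) != 1%N.
  rewrite size_mF; apply/eqP => m1; move: mx; rewrite (size1_polyC (_ : size m <= 1)%N) ?m1 //.
  rewrite map_polyC hornerC => /eqP E; move: lm; rewrite lead_coefE m1 /=.
  by rewrite E.
have [x' /rootP x'P] := closed_rootP _ mgt1.
have hMF p q y : (map_poly phi (p * q)).[y] = (map_poly phi p).[y] * (map_poly phi q).[y].
  by rewrite rmorphM hornerM.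
exists x'; split.
  have /(congr1 (fun P : {poly F} => P.[x'])) := mapK phi s (a0 * m + b0 * u) ker sC.
  rewrite rmorphD hornerD !hMF x'P mulr0 add0r sCc map_polyC hornerC => E.
  by apply: contraNneq ps => u0; rewrite E u0 mulr0.
move=> q qx; have [k [a [r []]]] := pdiv q sm m_n0; set c := _ ^+ k => c0 E lt.
have rx : (map_poly eps r).[x] = 0.
  have /(congr1 (fun p => (map_poly eps p).[x])) := E.
  by rewrite -mul_polyC hM qx mulr0 rmorphD hornerD hM mx mulr0 add0r.
have r0 : map_poly phi r = 0.
  by rewrite -(rmorph0 (map_poly phi)); apply: mapK => //; rewrite rmorph0; apply: mmin.
have /(congr1 (fun p => (map_poly phi p).[x'])) := E.
rewrite -mul_polyC hMF map_polyC hornerC rmorphD hornerD hMF x'P mulr0 add0r /= r0 horner0.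
by move/eqP; rewrite mulf_eq0 rmorphXn expf_eq0 (negPf pm) andbF => /eqP.
Qed.

End Specialization.

Lemma ex_prim_root (F : closedFieldType) m :
  m%:R != 0 :> F -> {z : F | m.-primitive_root z}.
Proof.
move=> m0; have mgt0 : (0 < m)%N by case: m m0 => //; rewrite eqxx.
pose q := 'X^m - 1 : {poly F}.
have [r Dq] := closed_field_poly_normal q.
have lq : lead_coef q = 1 by apply/monicP; rewrite monicXnsubC.
rewrite lq scale1r in Dq.
have sz_r : (size r).+1 = m.+1 by rewrite -(size_prod_XsubC r id) -Dq size_XnsubC.
have : separable_poly q by apply: separable_Xn_sub_1.
rewrite Dq separable_prod_XsubC => uniq_r.
apply/sigW; have /hasP[z _ zP] : has m.-primitive_root r; last by exists z.
apply: has_prim_root => //; last by case: sz_r => ->.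
by apply/allP => z; rewrite -root_prod_XsubC -Dq.
Qed.

Fixpoint ring_eval (R : pzRingType) (e : nat -> R) (t : ring_term) : R :=
  match t with
  | TVar i => e i
  | TZero => 0
  | TOne => 1
  | TAdd t u => ring_eval e t + ring_eval e u
  | TSub t u => ring_eval e t - ring_eval e u
  | TMul t u => ring_eval e t * ring_eval e u
  end.

Lemma term_evalE (K : fieldType) (e : nat -> K) t : term_eval e t = ring_eval e t.
Proof. by elim: t => //= t -> u ->. Qed.

Lemma ring_eval_map (R S : pzRingType) (f : {rmorphism R -> S}) e t :
  f (ring_eval e t) = ring_eval (f \o e) t.
Proof.
elim: t => //= [||t <- u <-|t <- u <-|t <- u <-].
- exact: rmorph0.
- exact: rmorph1.
- exact: rmorphD.
- exact: rmorphB.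
- exact: rmorphM.
Qed.

Definition vars_below n t := all (gtn n) (term_vars t).

Lemma eq_ring_eval (R : pzRingType) (e e' : nat -> R) n t :
  (forall i, (i < n)%N -> e i = e' i) -> vars_below n t -> ring_eval e t = ring_eval e' t.
Proof.
rewrite /vars_below => ee'; elim: t => //= [i|t IHt u IHu|t IHt u IHu|t IHt u IHu].
- by rewrite andbT => /ee'.
- by rewrite all_cat => /andP[/IHt -> /IHu ->].
- by rewrite all_cat => /andP[/IHt -> /IHu ->].
- by rewrite all_cat => /andP[/IHt -> /IHu ->].
Qed.

Section Prime.
Variables (p : nat) (p_prime : prime p).

Lemma specialization (K : fieldType) (F : closedFieldType) (e : nat -> K) n :
  p \in [pchar K] -> p \in [pchar F] ->
  exists (R : idomainType) (eps : {rmorphism R -> K}) (X : nat -> R),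
    (forall i, (i < n)%N -> eps (X i) = e i) /\
    forall u, eps u != 0 -> exists phi : {rmorphism R -> F},
      (forall r, eps r = 0 -> phi r = 0) /\ phi u != 0.
Proof.
move=> pK pF; elim: n => [|n [R [eps [X [XP phiP]]]]].
  exists int, (intr : {rmorphism int -> K}), (fun=> 0); split=> // u.
  exists (intr : {rmorphism int -> F}); rewrite /= -(dvdz_pcharf pF) (dvdz_pcharf pK).
  split=> // r /eqP; rewrite -(dvdz_pcharf pK) (dvdz_pcharf pF) => /eqP //.
exists {poly R}, (horner_eval (e n) \o map_poly eps : {rmorphism _ -> _}).
exists (fun i => if (i < n)%N then (X i)%:P else 'X); split=> [i|u].
  rewrite ltnS leq_eqVlt /= /horner_eval; case: ltngtP => // [lt|->] _.
    by rewrite map_polyC hornerC /= XP.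
  by rewrite map_polyX hornerX.
move=> /(specialization_step F)[w /phiP[phi [ker phiw]] wP].
have [x' [ux' x'P]] := wP phi ker phiw.
by exists (horner_eval x' \o map_poly phi : {rmorphism _ -> _}).
Qed.

Lemma algebraic_pth_root (K : fieldType) (q : {poly int}) (z : K) :
  p \in [pchar K] -> map_poly intr q != 0 :> {poly K} ->
  root (map_poly intr q) z -> exists2 m, (0 < m)%N & z ^+ (p ^ m) = z.
Proof.
move=> pK q0 qz; pose f := pFrobenius_aut pK.
have fE i : iter i f z = z ^+ (p ^ i).
  elim: i => [|i IH] /=; first by rewrite expr1.
  by rewrite IH /f pFrobenius_autE -exprM -expnSr.
have rt i : root (map_poly intr q) (iter i f z).
  elim: i => //= i /rootP IH; apply/rootP.
  have <- : map_poly f (map_poly intr q) = map_poly intr q.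
    by apply/polyP => j; rewrite !coef_rmap rmorph_int.
  by rewrite horner_map IH rmorph0.
pose s := [seq iter i f z | i <- iota 0 (size (map_poly (intr : int -> K) q))].
have : ~~ uniq s.
  apply/negP => us; have /(max_poly_roots q0)/(_ us) : all (root (map_poly intr q)) s.
    by apply/allP => _ /mapP[i _ ->].
  by rewrite size_map size_iota ltnn.
case/(uniqPn 0) => i [j [ltij]]; rewrite size_map size_iota => ltj.
rewrite !(nth_map 0%N) ?size_iota ?(ltn_trans ltij) // !nth_iota ?(ltn_trans ltij) //.
have Ej : j = (i + (j - i))%N by rewrite subnKC // ltnW.
rewrite !add0n [X in _ = X -> _](congr1 (fun l => iter l f z) Ej) iterD => E.
exists (j - i)%N; first by rewrite subn_gt0.
rewrite -fE; move: (j - i)%N E => d; elim: i {ltij ltj Ej} => [/= <- //|i IH /= E].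
by apply: IH; apply: (fmorph_inj f).
Qed.

Lemma pth_root_mul (R : pzRingType) (z : R) m k :
  z ^+ (p ^ m) = z -> z ^+ (p ^ (k * m)) = z.
Proof. by move=> zm; elim: k => [|k IH]; rewrite ?expr1 // mulSn expnD exprM zm. Qed.

Lemma ex_alg_closure : exists F : closedFieldType, p \in [pchar F] /\
  forall z : F, exists2 m, (0 < m)%N & z ^+ (p ^ m) = z.
Proof.
have [F [FtoF alg]] := countable_algebraic_closure 'F_p.
have pF : p \in [pchar F] by rewrite (fmorph_pchar FtoF) pchar_Fp.
exists F; split=> // z; have [q qmon qz] := alg z.
pose q' := map_poly (fun c : 'F_p => (c : nat)%:Z) q.
have q'E : map_poly intr q' = map_poly FtoF q.
  apply/polyP => i; rewrite coef_rmap coef_map_id0 // coef_rmap.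
  by rewrite -[RHS](congr1 FtoF (natr_Zp _)) rmorph_nat.
apply: (@algebraic_pth_root _ q'); rewrite ?q'E //.
by rewrite map_poly_eq0 monic_neq0.
Qed.

Lemma inv_modp (c : int) : ~~ (p %| c)%Z -> exists d : int, (p %| d * c - 1)%Z.
Proof.
move=> pc; have := Bezoutz c p; case=> u [v] E.
have g1 : gcdz c p = 1.
  by apply/eqP; rewrite -/(coprimez _ _) coprimezE absz_nat coprime_sym prime_coprime.
by exists u; rewrite g1 in E; rewrite -E opprD addNKr rpredN dvdz_mull.
Qed.

Lemma minimal_int_poly (F : fieldType) (z : F) (h0 : {poly int}) :
  p \in [pchar F] -> h0 \is monic -> (map_poly intr h0).[z] = 0 ->
  exists h : {poly int}, [/\ h \is monic, (1 < size h)%N &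
    forall a : {poly int}, (map_poly intr a).[z] = 0 -> exists b c, a = b * h + c * p%:R].
Proof.
move=> pF h0mon h0z.
pose P h := h \is monic /\ (map_poly intr h).[z] = 0 :> F.
have [h [hmon hz] hmin] := @ex_min_measure _ P (fun h => size h) (ex_intro _ h0 (conj h0mon h0z)).
have hn0 := monic_neq0 hmon.
exists h; split=> // [|a az].
  rewrite ltnNge; apply/negP => s1; have hC := size1_polyC s1.
  have h1 : h`_0 = 1.
    by have /monicP := hmon; rewrite lead_coefE; case: (size h) s1 => [|[]].
  by move: hz; rewrite hC h1 map_polyC hornerC => /eqP; rewrite /= rmorph1 oner_eq0.
have E := Pdiv.RingMonic.rdivp_eq hmon a; set b := Pdiv.CommonRing.rdivp a h in E.
set r := Pdiv.CommonRing.rmodp a h in E.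
have ltr : (size r < size h)%N by apply: Pdiv.Ring.ltn_rmodpN0.
have rz : (map_poly intr r).[z] = 0 :> F.
  by move: az; rewrite E rmorphD rmorphM hornerD hornerM /= hz mulr0 add0r.
suff pr i : (p %| r`_i)%Z.
  exists b, (\poly_(i < size r) (r`_i %/ p)%Z); rewrite {1}E; congr (_ + _).
  apply/polyP => i; rewrite mulr_natr coefMn coef_poly; case: ltnP => [_|le].
    by rewrite -mulr_natr -{1}(divzK (pr i)) -natz.
  by rewrite mul0rn nth_default.
apply: contrapT => /negP pri.
have exj : exists j, ~~ (p %| r`_j)%Z by exists i.
have bnd j : ~~ (p %| r`_j)%Z -> (j <= size r)%N.
  by move=> H; rewrite leqNgt; apply: contra H => /ltnW/(nth_default 0) ->; rewrite dvdz0.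
case: (ex_maxnP exj bnd) => j prj jmax {exj bnd}.
have [d /dvdzP[d' dE]] := inv_modp prj.
pose h' := 'X^j + \poly_(i < j) (d * r`_i).
have ltjr : (j < size r)%N.
  by rewrite ltnNge; apply: contra prj => /(nth_default 0) ->; rewrite dvdz0.
have sh' : (size (\poly_(i < j) (d * r`_i)%R : {poly int}) < size ('X^j : {poly int}))%N.
  by rewrite size_polyXn ltnS size_poly.
have := hmin h'; rewrite /P leqNgt size_polyDl // size_polyXn.
rewrite (leq_ltn_trans ltjr ltr) /= => H.
suff /H : P h' by []; split; first by rewrite monicE lead_coefDl // lead_coefXn.
have -> : map_poly intr h' = d%:~R *: map_poly intr r :> {poly F}.
  apply/polyP => k; rewrite coefZ !coef_rmap coefD coefXn coef_poly.
  case: ltngtP => [ltk|ltk|->] /=; rewrite ?add0r ?addr0.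
  - by rewrite intrM.
  - suff /eqP -> : (r`_k)%:~R == 0 :> F by rewrite mulr0.
    rewrite -(dvdz_pcharf pF); apply: contrapT => /negP/jmax.
    by rewrite leqNgt ltk.
  - rewrite -intrM -[d * _](subrK 1) dE intrD intrM -pmulrn (pcharf0 pF).
    by rewrite mulr0 add0r.
by rewrite hornerZ rz mulr0.
Qed.

(* Any point of an affine scheme over the prime field, in any field, can be
   specialized to a point over a finite field; [h] and [eta] describe it as a
   point whose coordinates are [0] or powers of a root of [h]. *)
Lemma finite_field_point (K : fieldType) (e : nat -> K) n u :
  p \in [pchar K] -> vars_below n u -> ring_eval e u != 0 ->
  exists (h : {poly int}) (k : seq nat),
    let eta i := if nth 0%N k i is j.+1 then 'X^j else 0 : {poly int} in
    [/\ h \is monic, (1 < size h)%N,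
      forall t, vars_below n t -> ring_eval e t = 0 ->
        exists a b, ring_eval eta t = a * h + b * p%:R &
      exists y a b, ring_eval eta u * y = 1 + a * h + b * p%:R].
Proof.
move=> pK un u0; have [F [pF Falg]] := ex_alg_closure.
have [R [eps [X [XP phiP]]]] := specialization e n pK pF.
have epsE t : vars_below n t -> eps (ring_eval X t) = ring_eval e t.
  by move=> tn; rewrite ring_eval_map; apply: (eq_ring_eval (n := n)).
have [|phi [ker phiu]] := phiP (ring_eval X u); first by rewrite epsE.
rewrite ring_eval_map in phiu.
have {ker} ker t : vars_below n t -> ring_eval e t = 0 -> ring_eval (phi \o X) t = 0.
  by move=> tn t0; rewrite -ring_eval_map ker // epsE.
set e' := phi \o X in phiu ker.
have [N N0 NP] : exists2 N, (0 < N)%N & forall i, (i < n)%N -> e' i ^+ (p ^ N) = e' i.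
  elim: (n) => [|m [N N0 IH]]; first by exists 1%N.
  have [M M0 MP] := Falg (e' m); exists (M * N)%N; first by rewrite muln_gt0 M0.
  move=> i; rewrite ltnS leq_eqVlt => /predU1P[->|/IH lt]; last exact: pth_root_mul.
  by rewrite mulnC; apply: pth_root_mul.
have pN1 : (1 < p ^ N)%N by rewrite -(exp1n N) ltn_exp2r // prime_gt1.
have [th thP] : {z : F | (p ^ N).-1.-primitive_root z}.
  apply: ex_prim_root; rewrite -subn1 natrB ?(ltnW pN1) //.
  by rewrite natrX (pcharf0 pF) expr0n gtn_eqF // sub0r oppr_eq0 oner_eq0.
have [k szk kP] : exists2 k : seq nat, size k = n & forall i, (i < n)%N ->
    e' i = if nth 0%N k i is j.+1 then th ^+ j else 0.
  elim: (n) NP => [|m IH] NP; first by exists [::].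
  have [i lti|k szk kP] := IH; first by apply: NP; apply: ltnW.
  have [j jP] : exists j, e' m = if j is j'.+1 then th ^+ j' else 0.
    have [->|em0] := eqVneq (e' m) 0; first by exists 0%N.
    have [|j jP] := prim_rootP thP (x := e' m); last by exists j.+1.
    by apply: (mulfI em0); rewrite mulr1 -exprS prednK ?NP // ltnW.
  exists (rcons k j); first by rewrite size_rcons szk.
  move=> i; rewrite ltnS leq_eqVlt nth_rcons szk => /predU1P[->|lt].
    by rewrite ltnn eqxx.
  by rewrite lt kP.
have [||h [hmon h1 hP]] := @minimal_int_poly F th ('X^((p ^ N).-1) - 1) pF.
- by rewrite monicXnsubC // -ltnS prednK // ltnW.
- rewrite rmorphB rmorphXn /= map_polyX rmorph1 hornerD hornerN hornerC hornerXn.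
  by rewrite prim_expr_order // subrr.
exists h, k; set eta := fun i => _.
have evE t : vars_below n t -> (map_poly intr (ring_eval eta t)).[th] = ring_eval e' t.
  move=> tn; pose f := horner_eval th \o map_poly intr : {rmorphism {poly int} -> F}.
  apply: etrans (ring_eval_map f eta t) _; apply: (eq_ring_eval (n := n)) => // i lti.
  rewrite kP //= /eta /horner_eval; case: nth => [|j]; rewrite ?rmorph0 ?horner0 //.
  by rewrite rmorphXn /= map_polyX hornerXn.
split=> // [t tn t0|]; first by apply: hP; rewrite evE // ker.
have [M M0 MP] := Falg (ring_eval e' u).
have pM1 : (1 < p ^ M)%N by rewrite -(exp1n M) ltn_exp2r // prime_gt1.
have [|b [c E]] := hP (ring_eval eta u ^+ (p ^ M).-1 - 1).
  rewrite rmorphB rmorphXn rmorph1 /= hornerD hornerN hornerC horner_exp evE //.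
  apply/eqP; rewrite subr_eq0; apply/eqP; apply: (mulfI phiu).
  by rewrite -exprS prednK ?MP ?mulr1 // ltnW.
exists (ring_eval eta u ^+ (p ^ M).-2), b, c.
by rewrite -exprS prednK -?addrA -?E ?subrKC // -ltnS prednK // ltnW.
Qed.

End Prime.

(** * Theories of fields and truth of formulas *)

Section Expressions.
Definition plit (e : expr) := (true, e).
Definition nlit (e : expr) := (false, e).
Definition etag1 k e := EPair (ECst k) e.
Definition etag2 k e f := EPair (ECst k) (EPair e f).
Definition econs e f := ESucc (EPair e f).
Definition eEq := etag2 0.
Definition eZero := ECst (pair_code 1 0).
Definition eOne := ECst (pair_code 2 0).
Definition eAdd := etag2 3.
Definition eSub := etag2 4.
Definition eMul := etag2 5.
Definition eInv := etag1 6.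
Definition eNum := etag1 7.

Let x := EVar 0.
Let y := EVar 1.
Let z := EVar 2.
Let u := EVar 3.

(* The Herbrand universe is [nat]: the number [pair_code k m] is the term with
   head symbol [k], and the tags 0 to 5 agree with [term_code]. Likewise the
   propositional variables are numbers, those with tags 0 to 5 being the truth
   values of the formulas they code. *)
Definition field_th : seq clause :=
  [:: [:: plit (eEq x x)];
   [:: nlit (eEq x y); plit (eEq y x)];
   [:: nlit (eEq x y); nlit (eEq y z); plit (eEq x z)];
   [:: nlit (eEq x y); nlit (eEq z u); plit (eEq (eAdd x z) (eAdd y u))];
   [:: nlit (eEq x y); nlit (eEq z u); plit (eEq (eSub x z) (eSub y u))];
   [:: nlit (eEq x y); nlit (eEq z u); plit (eEq (eMul x z) (eMul y u))];
   [:: nlit (eEq x y); plit (eEq (eInv x) (eInv y))];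
   [:: plit (eEq (eAdd x (eAdd y z)) (eAdd (eAdd x y) z))];
   [:: plit (eEq (eAdd x y) (eAdd y x))];
   [:: plit (eEq (eAdd eZero x) x)];
   [:: plit (eEq (eAdd (eSub x y) y) x)];
   [:: plit (eEq (eMul x (eMul y z)) (eMul (eMul x y) z))];
   [:: plit (eEq (eMul x y) (eMul y x))];
   [:: plit (eEq (eMul eOne x) x)];
   [:: plit (eEq (eMul (eAdd x y) z) (eAdd (eMul x z) (eMul y z)))];
   [:: nlit (eEq eOne eZero)];
   [:: plit (eEq x eZero); plit (eEq (eMul (eInv x) x) eOne)];
   [:: plit (eEq (eInv eZero) eZero)]].

Definition num_th : seq clause :=
  [:: [:: plit (eEq (eNum (ECst 0)) eZero)];
   [:: plit (eEq (eNum (ESucc x)) (eAdd (eNum x) eOne))]].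

Definition formula_th : seq clause :=
  [:: [:: nlit (etag1 1 x); nlit x]; [:: plit (etag1 1 x); plit x];
   [:: nlit (etag2 2 x y); plit x]; [:: nlit (etag2 2 x y); plit y];
   [:: nlit x; nlit y; plit (etag2 2 x y)];
   [:: nlit (etag2 3 x y); plit x; plit y];
   [:: nlit x; plit (etag2 3 x y)]; [:: nlit y; plit (etag2 3 x y)];
   [:: nlit (etag2 4 x y); plit y]; [:: nlit y; plit (etag2 4 x y)]].

End Expressions.

Definition interprets (L : fieldType) (val : nat -> L) :=
  [/\ val (pair_code 1 0) = 0, val (pair_code 2 0) = 1 &
   [/\ forall i j, val (pair_code 3 (pair_code i j)) = val i + val j,
       forall i j, val (pair_code 4 (pair_code i j)) = val i - val j,
       forall i j, val (pair_code 5 (pair_code i j)) = val i * val j &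
       forall i, val (pair_code 6 i) = (val i)^-1]].

Definition eq_interp (L : fieldType) (val : nat -> L) (S : nat -> Prop) :=
  forall t u, S (pair_code 0 (pair_code t u)) = (val t = val u).

Lemma field_th_sound a w (L : fieldType) (val : nat -> L) S :
  interprets val -> eq_interp val S -> holds a w S field_th.
Proof.
move=> [v0 v1 [vD vB vM vV]] SE /=; rewrite /eZero /eOne.
do ![split] => //= env; rewrite ?SE ?(vD, vB, vM, vV, v0, v1).
- by [].
- by [].
- by move=> ->.
- by move=> -> ->.
- by move=> -> ->.
- by move=> -> ->.
- by move=> ->.
- exact: addrA.
- exact: addrC.
- exact: add0r.
- exact: subrK.
- exact: mulrA.
- exact: mulrC.
- exact: mul1r.
- exact: mulrDl.
- by move/eqP; rewrite oner_eq0.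
- have [->|x0] := eqVneq (val (env 0%N)) 0; [by left|by right; rewrite mulVf].
- exact: invr0.
Qed.

Lemma field_th_model a w S : holds a w S field_th ->
  exists (L : fieldType) (val : nat -> L),
    [/\ interprets val, eq_interp val S & forall x, exists t, val t = x].
Proof.
move=> H; pose R t u := S (pair_code 0 (pair_code t u)).
pose op k i j := pair_code k (pair_code i j).
pose zero := pair_code 1 0; pose one := pair_code 2 0.
have rule i env : (i < 18)%N -> clause_holds a w S env (nth [::] field_th i).
  by move=> lti; apply: holds_nth H lti.
have Rrefl x : R x x := rule 0%N (nth 0%N [:: x]) isT.
have Rsym x y : R x y -> R y x := rule 1%N (nth 0%N [:: x; y]) isT.
have Rtrans x y z : R x y -> R y z -> R x z := rule 2 (nth 0%N [:: x; y; z]) isT.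
have RD x x' y y' : R x x' -> R y y' -> R (op 3 x y) (op 3 x' y')
  := rule 3 (nth 0%N [:: x; x'; y; y']) isT.
have RB x x' y y' : R x x' -> R y y' -> R (op 4 x y) (op 4 x' y')
  := rule 4 (nth 0%N [:: x; x'; y; y']) isT.
have RM x x' y y' : R x x' -> R y y' -> R (op 5 x y) (op 5 x' y')
  := rule 5 (nth 0%N [:: x; x'; y; y']) isT.
have RV x x' : R x x' -> R (pair_code 6 x) (pair_code 6 x')
  := rule 6 (nth 0%N [:: x; x']) isT.
have DA x y z : R (op 3 x (op 3 y z)) (op 3 (op 3 x y) z)
  := rule 7 (nth 0%N [:: x; y; z]) isT.
have DC x y : R (op 3 x y) (op 3 y x) := rule 8 (nth 0%N [:: x; y]) isT.
have D0 x : R (op 3 zero x) x := rule 9 (nth 0%N [:: x]) isT.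
have DB x y : R (op 3 (op 4 x y) y) x := rule 10 (nth 0%N [:: x; y]) isT.
have MA x y z : R (op 5 x (op 5 y z)) (op 5 (op 5 x y) z)
  := rule 11 (nth 0%N [:: x; y; z]) isT.
have MC x y : R (op 5 x y) (op 5 y x) := rule 12 (nth 0%N [:: x; y]) isT.
have M1 x : R (op 5 one x) x := rule 13 (nth 0%N [:: x]) isT.
have MD x y z : R (op 5 (op 3 x y) z) (op 3 (op 5 x z) (op 5 y z))
  := rule 14 (nth 0%N [:: x; y; z]) isT.
have one0 : ~ R one zero := rule 15 (nth 0%N [::]) isT.
have MV x : ~ R x zero -> R (op 5 (pair_code 6 x) x) one.
  by case: (rule 16 (nth 0%N [:: x]) isT).
have V0 : R (pair_code 6 zero) zero := rule 17 (nth 0%N [::]) isT.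
have RN x x' : R x x' -> R (op 4 zero x) (op 4 zero x') by apply: RB.
have DN x : R (op 3 (op 4 zero x) x) zero by apply: DB.
have [L [val [surj valE val0 val1 [valD valM valN]]]] := field_of_setoid Rrefl Rsym
  Rtrans RD RM RN DA DC D0 DN MA MC M1 MD one0 MV.
exists L, val; split=> //; last by move=> t u; apply: propext; symmetry; apply: valE.
split=> //; split=> // [i j|i].
  by have /valE <- := DB i j; rewrite valD addrK.
have [/valE E|/[dup]/MV/valE E] := pselect (R i zero).
  by rewrite E val0 invr0 -val0; apply/valE/(Rtrans _ _ _ _ V0)/RV/valE.
move=> ni; have vi : val i != 0 by rewrite -val0; apply/eqP => /valE.
by apply: (mulIf vi); rewrite mulVf // -valM E.
Qed.

Lemma ring_eval_interp (L : fieldType) (val : nat -> L) t :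
  interprets val -> val (term_code t) = ring_eval (fun i => val (pair_code 0 i)) t.
Proof.
by move=> [v0 v1 [vD vB vM vV]]; elim: t => //= t IHt u IHu; rewrite ?(vD, vB, vM) IHt IHu.
Qed.

Lemma num_interp a w (L : fieldType) (val : nat -> L) S :
  interprets val -> eq_interp val S -> holds a w S num_th ->
  forall n, val (pair_code 7 n) = n%:R.
Proof.
move=> [v0 v1 [vD _ _ _]] SE H; elim=> [|n IH].
  by have := holds_nth (i := 0) (nth 0%N [::]) H isT; rewrite /= SE v0.
have := holds_nth (i := 1) (nth 0%N [:: n]) H isT.
by rewrite /= SE vD v1 IH -natr1.
Qed.

Lemma num_th_sound a w (L : fieldType) (val : nat -> L) S :
  interprets val -> eq_interp val S -> (forall n, val (pair_code 7 n) = n%:R) ->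
  holds a w S num_th.
Proof.
move=> [v0 v1 [vD _ _ _]] SE vN; split=> [env|]; first by rewrite /= SE vN.
by split=> // env; rewrite /= SE vD !vN v1 -natr1.
Qed.

Fixpoint matrix_of (phi : ring_formula) : ring_formula :=
  if phi is FExists _ f then matrix_of f else phi.

Lemma formula_interp a w (L : fieldType) (val : nat -> L) S phi :
  interprets val -> eq_interp val S -> holds a w S formula_th -> existential phi ->
  S (formula_code phi) <-> satisfies (fun i => val (pair_code 0 i)) (matrix_of phi).
Proof.
move=> vI SE H; set e := fun i => _.
have rule i x y : (i < 10)%N ->
    clause_holds a w S (nth 0%N [:: x; y]) (nth [::] formula_th i).
  by move=> lti; apply: holds_nth H lti.
have qf f : quantifier_free f -> S (formula_code f) <-> satisfies e f.
  elim: f => [t u|f IH|f IHf g IHg|f IHf g IHg|i f IH|i f IH] //=.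
  - by move=> _; rewrite SE !ring_eval_interp // !term_evalE.
  - move=> /IH <-; have := rule 0%N (formula_code f) 0%N isT.
    have := rule 1%N (formula_code f) 0%N isT.
    by rewrite /=; tauto.
  - move=> /andP[/IHf <- /IHg <-].
    have := rule 2 (formula_code f) (formula_code g) isT.
    have := rule 3 (formula_code f) (formula_code g) isT.
    have := rule 4 (formula_code f) (formula_code g) isT.
    by rewrite /=; tauto.
  - move=> /andP[/IHf <- /IHg <-].
    have := rule 5 (formula_code f) (formula_code g) isT.
    have := rule 6 (formula_code f) (formula_code g) isT.
    have := rule 7 (formula_code f) (formula_code g) isT.
    by rewrite /=; tauto.
elim: phi => [t u|f _|f _ g _|f _ g _|i f IH|i f _] //.
- by move=> _; apply: qf.
- exact: (qf (FNot f)).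
- exact: (qf (FAnd f g)).
- exact: (qf (FOr f g)).
- move=> /IH <-; have := rule 8 i (formula_code f) isT.
  have := rule 9 i (formula_code f) isT.
  by rewrite /=; tauto.
Qed.

Lemma eq_satisfies (K : fieldType) (e e' : nat -> K) f :
  quantifier_free f -> {in free_vars f, e =1 e'} -> satisfies e f <-> satisfies e' f.
Proof.
have eqt t : {in term_vars t, e =1 e'} -> term_eval e t = term_eval e' t.
  elim: t => //= [i ->|t IHt u IHu H|t IHt u IHu H|t IHt u IHu H]; rewrite ?mem_head //;
    by rewrite IHt ?IHu // => i it; apply: H; rewrite mem_cat it ?orbT.
elim: f => //= [t u _ H|f IH /IH H /H ->|f IHf g IHg|f IHf g IHg] //.
- by rewrite !eqt // => i it; apply: H; rewrite mem_cat it ?orbT.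
- move=> /andP[qf qg] H; rewrite IHf ?IHg // => i it; apply: H; rewrite mem_cat it ?orbT //.
- move=> /andP[qf qg] H; rewrite IHf ?IHg // => i it; apply: H; rewrite mem_cat it ?orbT //.
Qed.

Lemma satisfies_matrix (K : fieldType) (e : nat -> K) phi : existential phi ->
  satisfies e phi <->
  exists2 e', {in free_vars phi, e =1 e'} & satisfies e' (matrix_of phi).
Proof.
have qf (e1 : nat -> K) f : quantifier_free f -> satisfies e1 f <->
    exists2 e', {in free_vars f, e1 =1 e'} & satisfies e' f.
  by move=> qf; split=> [H|[e' ee' /(eq_satisfies qf ee')] //]; exists e1.
elim: phi e => [t u|f _|f _ g _|f _ g _|i f IH|i f _] e //.
- by move=> _; exact: (qf e (FEq t u) isT).
- exact: (qf e (FNot f)).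
- exact: (qf e (FAnd f g)).
- exact: (qf e (FOr f g)).
- move=> /= ef; have {}IH e1 := IH e1 ef.
  split=> [[x /IH[e' ee' H]]|[e' ee' H]].
    exists e' => // j; rewrite mem_filter => /andP[ji jf].
    by rewrite -ee' // /update (negPf ji).
  exists (e' i); apply/IH => //; exists e' => // j jf; rewrite /update.
  by case: eqVneq => [-> //|ji]; apply: ee'; rewrite mem_filter ji.
Qed.

Lemma holds_in_matrix (K : fieldType) phi : sentence phi -> existential phi ->
  holds_in K phi <-> exists e : nat -> K, satisfies e (matrix_of phi).
Proof.
move=> /eqP sphi ephi; split=> [/(_ (fun=> 0))/(satisfies_matrix _ ephi)[e' _ H]|[e' H] e].
  by exists e'.
by apply/(satisfies_matrix _ ephi); exists e' => // i; rewrite sphi.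
Qed.

(** * Syntax of formulas *)

Section SyntaxTheory.
Let x := EVar 0.
Let y := EVar 1.
Let z := EVar 2.
Let d := EVar 3.
Let eTM := etag1 8.
Let eQF := etag1 9.
Let eEX := etag1 10.
Let eVT := etag2 11.
Let eVF := etag2 12.
Let eNS := etag2 13.

Let iff1 (c : clause) P Q : seq clause := [:: c ++ [:: nlit P; plit Q]; c ++ [:: nlit Q; plit P]].
Let iff_and P Q R : seq clause :=
  [:: [:: nlit P; plit Q]; [:: nlit P; plit R]; [:: nlit Q; nlit R; plit P]].
Let iff_or (c : clause) P Q R : seq clause :=
  [:: c ++ [:: nlit P; plit Q; plit R]; c ++ [:: nlit Q; plit P]; c ++ [:: nlit R; plit P]].
Let above k := EAdd (ECst k) x.

Definition term_syntax_th : seq clause :=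
  [:: [:: plit (eTM (etag1 0 x))];
      [:: plit (eTM (etag1 1 (ECst 0)))]; [:: nlit (eTM (etag1 1 (ESucc x)))];
      [:: plit (eTM (etag1 2 (ECst 0)))]; [:: nlit (eTM (etag1 2 (ESucc x)))];
      [:: nlit (eTM (EPair (above 6) y))]]
  ++ iff_and (eTM (etag2 3 x y)) (eTM x) (eTM y)
  ++ iff_and (eTM (etag2 4 x y)) (eTM x) (eTM y)
  ++ iff_and (eTM (etag2 5 x y)) (eTM x) (eTM y).

Definition formula_syntax_th : seq clause :=
  iff_and (eQF (etag2 0 x y)) (eTM x) (eTM y)
  ++ iff1 [::] (eQF (etag1 1 x)) (eQF x)
  ++ iff_and (eQF (etag2 2 x y)) (eQF x) (eQF y)
  ++ iff_and (eQF (etag2 3 x y)) (eQF x) (eQF y)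
  ++ [:: [:: nlit (eQF (EPair (above 4) y))]]
  ++ iff1 [::] (eEX (etag1 0 x)) (eQF (etag1 0 x))
  ++ iff1 [::] (eEX (etag1 1 x)) (eQF (etag1 1 x))
  ++ iff1 [::] (eEX (etag1 2 x)) (eQF (etag1 2 x))
  ++ iff1 [::] (eEX (etag1 3 x)) (eQF (etag1 3 x))
  ++ iff1 [::] (eEX (etag2 4 x y)) (eEX y)
  ++ [:: [:: nlit (eEX (EPair (above 5) y))]].

Definition term_vars_th : seq clause :=
  [:: [:: plit (eVT x (etag1 0 x))];
      [:: nlit (eVT x (etag1 0 (ESucc (EAdd x y))))];
      [:: nlit (eVT (ESucc (EAdd x y)) (etag1 0 x))];
      [:: nlit (eVT x (etag1 1 (ECst 0)))]; [:: nlit (eVT x (etag1 2 (ECst 0)))]]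
  ++ iff_or [:: nlit (eTM y); nlit (eTM z)] (eVT x (etag2 3 y z)) (eVT x y) (eVT x z)
  ++ iff_or [:: nlit (eTM y); nlit (eTM z)] (eVT x (etag2 4 y z)) (eVT x y) (eVT x z)
  ++ iff_or [:: nlit (eTM y); nlit (eTM z)] (eVT x (etag2 5 y z)) (eVT x y) (eVT x z).

Definition free_vars_th : seq clause :=
  iff_or [:: nlit (eTM y); nlit (eTM z)] (eVF x (etag2 0 y z)) (eVT x y) (eVT x z)
  ++ iff1 [:: nlit (eQF y)] (eVF x (etag1 1 y)) (eVF x y)
  ++ iff_or [:: nlit (eQF y); nlit (eQF z)] (eVF x (etag2 2 y z)) (eVF x y) (eVF x z)
  ++ iff_or [:: nlit (eQF y); nlit (eQF z)] (eVF x (etag2 3 y z)) (eVF x y) (eVF x z)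
  ++ [:: [:: nlit (eVF x (etag2 4 x y))]]
  ++ iff1 [:: nlit (eEX z)] (eVF x (etag2 4 (ESucc (EAdd x y)) z)) (eVF x z)
  ++ iff1 [:: nlit (eEX z)] (eVF (ESucc (EAdd x y)) (etag2 4 x z)) (eVF (ESucc (EAdd x y)) z)
  ++ [:: [:: nlit (eNS (ECst 0) x)]]
  ++ iff_or [::] (eNS (ESucc x) y) (eNS x y) (eVF x y).

End SyntaxTheory.

Definition syntax_th := term_syntax_th ++ formula_syntax_th ++ term_vars_th ++ free_vars_th.

Lemma term_code_inj : injective term_code.
Proof.
by elim=> [i|||t IHt u IHu|t IHt u IHu|t IHt u IHu] [j|||t' u'|t' u'|t' u'] //=;
  move/pair_code_inj=> [] // _; rewrite ?(pair_codeK) => E; first [by rewrite E |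
    by move/pair_code_inj: E => [/IHt -> /IHu ->]].
Qed.

Lemma formula_code_inj : injective formula_code.
Proof.
by elim=> [t u|f IH|f IHf g IHg|f IHf g IHg|i f IH|i f IH]
  [t' u'|f'|f' g'|f' g'|i' f'|i' f'] //= /pair_code_inj[] // _; first
  [by move/pair_code_inj=> [/term_code_inj -> /term_code_inj ->] | by move/IH=> -> |
   by move/pair_code_inj=> [/IHf -> /IHg ->] | by move/pair_code_inj=> [-> /IH ->]].
Qed.

Definition is_term n := exists t, term_code t = n.
Definition is_qf n := exists2 f, quantifier_free f & formula_code f = n.
Definition is_ex n := exists2 f, existential f & formula_code f = n.
Definition in_term_vars i n := exists2 t, term_code t = n & i \in term_vars t.
Definition in_free_vars i n :=
  exists f, [/\ existential f, formula_code f = n & i \in free_vars f].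

Ltac code_inv := repeat match goal with
  | H : pair_code _ _ = pair_code _ _ |- _ => destruct (pair_code_inj H); clear H
  | H : _ /\ _ |- _ => destruct H
  end; subst; try discriminate; try done.

Lemma is_term_var m : is_term (pair_code 0 m). Proof. by exists (TVar m). Qed.

Lemma is_term_zero m : is_term (pair_code 1 m) <-> m = 0%N.
Proof. by split=> [[[]] /= *|->]; [code_inv..|exists TZero]. Qed.

Lemma is_term_one m : is_term (pair_code 2 m) <-> m = 0%N.
Proof. by split=> [[[]] /= *|->]; [code_inv..|exists TOne]. Qed.

Lemma is_term_op k i j : (3 <= k <= 5)%N ->
  is_term (pair_code k (pair_code i j)) <-> is_term i /\ is_term j.
Proof.
move=> k35; split=> [|[[t <-] [u <-]]]; last first.
  by case: k k35 => [|[|[|[|[|[|k]]]]]] // _;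
    [exists (TAdd t u)|exists (TSub t u)|exists (TMul t u)].
by move=> [[]] /= *; code_inv; split; eexists.
Qed.

Lemma is_term_above k m : ~ is_term (pair_code (6 + k) m).
Proof. by move=> [[]] /= *; code_inv. Qed.

Lemma is_qf_eq i j : is_qf (pair_code 0 (pair_code i j)) <-> is_term i /\ is_term j.
Proof.
split=> [|[[t <-] [u <-]]]; last by exists (FEq t u).
by move=> [[]] /= *; code_inv; split; eexists.
Qed.

Lemma is_qf_not n : is_qf (pair_code 1 n) <-> is_qf n.
Proof.
by split=> [[[]] /= *|[f qf <-]]; [code_inv; eexists; eauto..|exists (FNot f)].
Qed.

Lemma is_qf_op k i j : (2 <= k <= 3)%N ->
  is_qf (pair_code k (pair_code i j)) <-> is_qf i /\ is_qf j.
Proof.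
move=> k23; split=> [|[[f qf <-] [g qg <-]]]; last first.
  by case: k k23 => [|[|[|[|k]]]] // _;
    [exists (FAnd f g)|exists (FOr f g)] => //=; rewrite qf.
by move=> [[]] //= > qfg *; code_inv; case/andP: qfg => *; split;
  match goal with |- is_qf (formula_code ?f) => by exists f end.
Qed.

Lemma is_qf_above k m : ~ is_qf (pair_code (4 + k) m).
Proof. by move=> [[]] /= *; code_inv. Qed.

Lemma is_ex_qf k m : (k < 4)%N -> is_ex (pair_code k m) <-> is_qf (pair_code k m).
Proof.
move=> k4; split=> [[f qf E]|[f qf E]]; exists f => //; case: f qf E => //= i f _ E.
by case/pair_code_inj: E k4 => <-.
Qed.

Lemma is_ex_exists i n : is_ex (pair_code 4 (pair_code i n)) <-> is_ex n.
Proof.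
by split=> [[[]] /= *|[f qf <-]]; [code_inv; eexists; eauto..|exists (FExists i f)].
Qed.

Lemma is_ex_above k m : ~ is_ex (pair_code (5 + k) m).
Proof. by move=> [[]] /= *; code_inv. Qed.

Lemma in_term_varsE i t : in_term_vars i (term_code t) <-> i \in term_vars t.
Proof. by split=> [[u /term_code_inj <-]|]; last exists t. Qed.

Lemma in_free_varsE i f : existential f ->
  in_free_vars i (formula_code f) <-> i \in free_vars f.
Proof. by move=> ef; split=> [[g [_ /formula_code_inj <-]]|]; last exists f. Qed.

Lemma qf_existential f : quantifier_free f -> existential f.
Proof. by case: f. Qed.

Definition syntax_interp (S : nat -> Prop) :=
  [/\ forall n, S (pair_code 8 n) <-> is_term n,
      forall n, S (pair_code 9 n) <-> is_qf n,
      forall n, S (pair_code 10 n) <-> is_ex n,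
      forall t i, S (pair_code 11 (pair_code i (term_code t))) <-> i \in term_vars t &
      (forall f i, existential f ->
        S (pair_code 12 (pair_code i (formula_code f))) <-> i \in free_vars f) /\
      forall m n, S (pair_code 13 (pair_code m n)) <->
        exists2 i, (i < m)%N & S (pair_code 12 (pair_code i n))].

Lemma code_ind (P : nat -> Prop) :
  (forall k m, (forall i, (i < pair_code k m)%N -> P i) -> P (pair_code k m)) ->
  forall n, P n.
Proof. by move=> H n; elim/ltn_ind: n => n; rewrite -(unpairK n); apply: H. Qed.

Lemma ltn_code1 k i j : (0 < k)%N -> (i < pair_code k (pair_code i j))%N.
Proof. by move=> k0; apply: leq_ltn_trans (leq_pair1 i j) (ltn_pair2 _ k0). Qed.

Lemma ltn_code2 k i j : (0 < k)%N -> (j < pair_code k (pair_code i j))%N.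
Proof. by move=> k0; apply: leq_ltn_trans (leq_pair2 i j) (ltn_pair2 _ k0). Qed.

Lemma syntax_th_model a w S : holds a w S syntax_th -> syntax_interp S.
Proof.
move=> /holds_cat[Hterm /holds_cat[Hform /holds_cat[Hvars Hfree]]].
have rt i x y : (i < 15)%N ->
    clause_holds a w S (nth 0%N [:: x; y]) (nth [::] term_syntax_th i).
  by move=> lti; apply: holds_nth Hterm lti.
have rf i x y : (i < 23)%N ->
    clause_holds a w S (nth 0%N [:: x; y]) (nth [::] formula_syntax_th i).
  by move=> lti; apply: holds_nth Hform lti.
have rv i x y z : (i < 14)%N ->
    clause_holds a w S (nth 0%N [:: x; y; z]) (nth [::] term_vars_th i).
  by move=> lti; apply: holds_nth Hvars lti.
have rfv i x y z : (i < 20)%N ->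
    clause_holds a w S (nth 0%N [:: x; y; z]) (nth [::] free_vars_th i).
  by move=> lti; apply: holds_nth Hfree lti.
have termP n : S (pair_code 8 n) <-> is_term n.
  elim/code_ind: n => k m IH.
  have IHop : (0 < k)%N ->
      (S (pair_code 8 (fst_code m)) <-> is_term (fst_code m)) /\
      (S (pair_code 8 (snd_code m)) <-> is_term (snd_code m)).
    move=> k0; split; apply: IH; rewrite -[m in pair_code k m]unpairK.
      exact: ltn_code1.
    exact: ltn_code2.
  have op l : (l < 3)%N -> S (pair_code 8 (pair_code (3 + l) m)) <->
      S (pair_code 8 (fst_code m)) /\ S (pair_code 8 (snd_code m)).
    have := rt (6 + 3 * l)%N (fst_code m) (snd_code m).
    have := rt (6 + 3 * l).+1 (fst_code m) (snd_code m).
    have := rt (6 + 3 * l).+2 (fst_code m) (snd_code m).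
    case: l => [|[|[|l]]] //; rewrite /= unpairK => /(_ isT) ? /(_ isT) ? /(_ isT) ? _; tauto.
  have opE l : (l < 3)%N -> is_term (pair_code (3 + l) m) <->
      is_term (fst_code m) /\ is_term (snd_code m).
    by move=> l3; rewrite -(@is_term_op (3 + l)) ?unpairK //; lia.
  case: k IH IHop => [|[|[|[|[|[|k]]]]]] IH IHop.
  - by split=> // _; [exact: is_term_var|exact: (rt 0%N m 0%N)].
  - rewrite is_term_zero; split=> [|->]; last exact: (rt 1%N 0%N 0%N isT).
    by case: m {IH IHop op opE} => // m /(rt 2 m 0%N isT).
  - rewrite is_term_one; split=> [|->]; last exact: (rt 3 0%N 0%N isT).
    by case: m {IH IHop op opE} => // m /(rt 4 m 0%N isT).
  - by rewrite (op 0%N) // (opE 0%N) //; have [//|-> ->] := IHop.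
  - by rewrite (op 1%N) // (opE 1%N) //; have [//|-> ->] := IHop.
  - by rewrite (op 2%N) // (opE 2%N) //; have [//|-> ->] := IHop.
  - by split=> [/(rt 5 k m isT) | /(is_term_above (m := m))].
have qfP n : S (pair_code 9 n) <-> is_qf n.
  elim/code_ind: n => k m IH.
  have IHop : (0 < k)%N ->
      (S (pair_code 9 (fst_code m)) <-> is_qf (fst_code m)) /\
      (S (pair_code 9 (snd_code m)) <-> is_qf (snd_code m)).
    move=> k0; split; apply: IH; rewrite -[m in pair_code k m]unpairK.
      exact: ltn_code1.
    exact: ltn_code2.
  case: k IH IHop => [|[|[|[|k]]]] IH IHop.
  - rewrite -[m]unpairK is_qf_eq -!termP.
    have := rf 0%N (fst_code m) (snd_code m) isT.
    have := rf 1%N (fst_code m) (snd_code m) isT.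
    by have := rf 2 (fst_code m) (snd_code m) isT; rewrite /=; tauto.
  - rewrite is_qf_not -IH; last exact: ltn_pair2.
    have := rf 3 m 0%N isT; have := rf 4 m 0%N isT; by rewrite /=; tauto.
  - have [//|E1 E2] := IHop; rewrite -[m]unpairK is_qf_op // -E1 -E2.
    have := rf 5 (fst_code m) (snd_code m) isT.
    have := rf 6 (fst_code m) (snd_code m) isT.
    by have := rf 7 (fst_code m) (snd_code m) isT; rewrite /=; tauto.
  - have [//|E1 E2] := IHop; rewrite -[m]unpairK is_qf_op // -E1 -E2.
    have := rf 8 (fst_code m) (snd_code m) isT.
    have := rf 9 (fst_code m) (snd_code m) isT.
    by have := rf 10 (fst_code m) (snd_code m) isT; rewrite /=; tauto.
  - by split=> [/(rf 11 k m isT) | /(is_qf_above (m := m))].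
have exP n : S (pair_code 10 n) <-> is_ex n.
  elim/code_ind: n => k m IH; case: k IH => [|[|[|[|[|k]]]]] IH.
  - rewrite is_ex_qf // -qfP.
    by have := rf 12 m 0%N isT; have := rf 13 m 0%N isT; rewrite /=; tauto.
  - rewrite is_ex_qf // -qfP.
    by have := rf 14 m 0%N isT; have := rf 15 m 0%N isT; rewrite /=; tauto.
  - rewrite is_ex_qf // -qfP.
    by have := rf 16 m 0%N isT; have := rf 17 m 0%N isT; rewrite /=; tauto.
  - rewrite is_ex_qf // -qfP.
    by have := rf 18 m 0%N isT; have := rf 19 m 0%N isT; rewrite /=; tauto.
  - rewrite -[m]unpairK is_ex_exists -IH; last by rewrite -{2}[m]unpairK ltn_code2.
    have := rf 20 (fst_code m) (snd_code m) isT.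
    by have := rf 21 (fst_code m) (snd_code m) isT; rewrite /=; tauto.
  - by split=> [/(rf 22 k m isT) | /(is_ex_above (m := m))].
have term_ok t : S (pair_code 8 (term_code t)) by apply/termP; exists t.
have qf_ok f : quantifier_free f -> S (pair_code 9 (formula_code f)).
  by move=> qf; apply/qfP; exists f.
have varsP t i : S (pair_code 11 (pair_code i (term_code t))) <-> i \in term_vars t.
  elim: t => [j|||t IHt u IHu|t IHt u IHu|t IHt u IHu] /=.
  - rewrite inE; case: (ltngtP i j) => [lt|lt|->].
    + have E : j = (i + (j - i).-1).+1 by lia.
      by split=> //; rewrite {1}E => /(rv 1%N i (j - i).-1 0%N isT).
    + have E : i = (j + (i - j).-1).+1 by lia.
      by split=> //; rewrite {1}E => /(rv 2 j (i - j).-1 0%N isT).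
    + by split=> // _; exact: (rv 0%N j 0%N 0%N isT).
  - by split=> // /(rv 3 i 0%N 0%N isT).
  - by split=> // /(rv 4 i 0%N 0%N isT).
  - rewrite mem_cat; split=> [|/orP[/IHt|/IHu]].
    + by move/(rv 5 i (term_code t) (term_code u) isT (term_ok _) (term_ok _)) => [/IHt ->|/IHu ->]
        //; rewrite orbT.
    + exact: (rv 6 i (term_code t) (term_code u) isT (term_ok _) (term_ok _)).
    + exact: (rv 7 i (term_code t) (term_code u) isT (term_ok _) (term_ok _)).
  - rewrite mem_cat; split=> [|/orP[/IHt|/IHu]].
    + by move/(rv 8 i (term_code t) (term_code u) isT (term_ok _) (term_ok _)) => [/IHt ->|/IHu ->]
        //; rewrite orbT.
    + exact: (rv 9 i (term_code t) (term_code u) isT (term_ok _) (term_ok _)).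
    + exact: (rv 10 i (term_code t) (term_code u) isT (term_ok _) (term_ok _)).
  - rewrite mem_cat; split=> [|/orP[/IHt|/IHu]].
    + by move/(rv 11 i (term_code t) (term_code u) isT (term_ok _) (term_ok _)) => [/IHt ->|/IHu
        ->] //; rewrite orbT.
    + exact: (rv 12 i (term_code t) (term_code u) isT (term_ok _) (term_ok _)).
    + exact: (rv 13 i (term_code t) (term_code u) isT (term_ok _) (term_ok _)).
split=> //; split=> [f i|m n].
  elim: f => [t u|f IH|f IHf g IHg|f IHf g IHg|j f IH|j f IH] //=.
  - move=> _; rewrite mem_cat; split=> [|/orP[/varsP|/varsP]].
    + by move/(rfv 0%N i (term_code t) (term_code u) isT (term_ok _) (term_ok _)) => [/varsP
        ->|/varsP ->] //; rewrite orbT.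
    + exact: (rfv 1%N i (term_code t) (term_code u) isT (term_ok _) (term_ok _)).
    + exact: (rfv 2 i (term_code t) (term_code u) isT (term_ok _) (term_ok _)).
  - move=> qf; rewrite -(IH (qf_existential qf)).
    have := rfv 3 i (formula_code f) 0%N isT (qf_ok _ qf).
    by have := rfv 4 i (formula_code f) 0%N isT (qf_ok _ qf); rewrite /=; tauto.
  - move=> /andP[qf qg]; have {}IHf := IHf (qf_existential qf).
    have {}IHg := IHg (qf_existential qg); rewrite mem_cat; split=> [|/orP[/IHf|/IHg]].
    + by move/(rfv 5 i (formula_code f) (formula_code g) isT (qf_ok _ qf) (qf_ok _ qg)) => [/IHf
        ->|/IHg ->] //; rewrite orbT.
    + exact: (rfv 6 i (formula_code f) (formula_code g) isT (qf_ok _ qf) (qf_ok _ qg)).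
    + exact: (rfv 7 i (formula_code f) (formula_code g) isT (qf_ok _ qf) (qf_ok _ qg)).
  - move=> /andP[qf qg]; have {}IHf := IHf (qf_existential qf).
    have {}IHg := IHg (qf_existential qg); rewrite mem_cat; split=> [|/orP[/IHf|/IHg]].
    + by move/(rfv 8 i (formula_code f) (formula_code g) isT (qf_ok _ qf) (qf_ok _ qg)) => [/IHf
        ->|/IHg ->] //; rewrite orbT.
    + exact: (rfv 9 i (formula_code f) (formula_code g) isT (qf_ok _ qf) (qf_ok _ qg)).
    + exact: (rfv 10 i (formula_code f) (formula_code g) isT (qf_ok _ qf) (qf_ok _ qg)).
  - move=> ef; have okf : S (pair_code 10 (formula_code f)) by apply/exP; exists f.
    rewrite mem_filter -(rwP andP) -(IH ef); case: (ltngtP i j) => [lt|lt|<-].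
    + have E : j = (i + (j - i).-1).+1 by lia.
      have := rfv 12 i (j - i).-1 (formula_code f) isT okf.
      have := rfv 13 i (j - i).-1 (formula_code f) isT okf.
      by have := isT; rewrite /= -E; tauto.
    + have E : i = (j + (i - j).-1).+1 by lia.
      have := rfv 14 j (i - j).-1 (formula_code f) isT okf.
      have := rfv 15 j (i - j).-1 (formula_code f) isT okf.
      by have := isT; rewrite /= -E; tauto.
    + by have := rfv 11 i (formula_code f) 0%N isT; rewrite /=; split=> [|[]].
elim: m => [|m IH]; first by split=> [/(rfv 16 n 0%N 0%N isT)|[]].
have := rfv 17 m n 0%N isT; have := rfv 18 m n 0%N isT; have := rfv 19 m n 0%N isT.
rewrite /= => H1 H2 H3; split=> [/H3[/IH[i lti Hi]|Hm]|[i]].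
- by exists i => //; apply: ltnW.
- by exists m.
- by rewrite ltnS leq_eqVlt => /predU1P[->|lti Hi] //; apply: H2; apply/IH; exists i.
Qed.

Definition syntax_truth k n : Prop :=
  match k with
  | 8 => is_term n
  | 9 => is_qf n
  | 10 => is_ex n
  | 11 => in_term_vars (fst_code n) (snd_code n)
  | 12 => in_free_vars (fst_code n) (snd_code n)
  | 13 => exists2 i, (i < fst_code n)%N & in_free_vars i (snd_code n)
  | _ => False
  end.

Lemma in_term_vars_op k x y z : (3 <= k <= 5)%N -> is_term y -> is_term z ->
  in_term_vars x (pair_code k (pair_code y z)) <-> in_term_vars x y \/ in_term_vars x z.
Proof.
move=> k35 [t <-] [u <-]; case: k k35 => [|[|[|[|[|[|k]]]]]] // _.
- by rewrite (in_term_varsE x (TAdd t u)) !in_term_varsE mem_cat -(rwP orP).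
- by rewrite (in_term_varsE x (TSub t u)) !in_term_varsE mem_cat -(rwP orP).
- by rewrite (in_term_varsE x (TMul t u)) !in_term_varsE mem_cat -(rwP orP).
Qed.

Lemma in_free_vars_eq x y z : is_term y -> is_term z ->
  in_free_vars x (pair_code 0 (pair_code y z)) <-> in_term_vars x y \/ in_term_vars x z.
Proof.
move=> [t <-] [u <-].
by rewrite (@in_free_varsE x (FEq t u)) // !in_term_varsE mem_cat -(rwP orP).
Qed.

Lemma in_free_vars_not x y : is_qf y ->
  in_free_vars x (pair_code 1 y) <-> in_free_vars x y.
Proof.
move=> [f qf <-]; rewrite (@in_free_varsE x (FNot f)) // in_free_varsE //.
exact: qf_existential.
Qed.

Lemma in_free_vars_op k x y z : (2 <= k <= 3)%N -> is_qf y -> is_qf z ->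
  in_free_vars x (pair_code k (pair_code y z)) <-> in_free_vars x y \/ in_free_vars x z.
Proof.
move=> k23 [f qf <-] [g qg <-]; rewrite !in_free_varsE; try exact: qf_existential.
case: k k23 => [|[|[|[|k]]]] // _.
- by rewrite (@in_free_varsE x (FAnd f g)) ?mem_cat -?(rwP orP) //= qf.
- by rewrite (@in_free_varsE x (FOr f g)) ?mem_cat -?(rwP orP) //= qf.
Qed.

Lemma in_free_vars_exists x y z : is_ex z ->
  in_free_vars x (pair_code 4 (pair_code y z)) <-> x <> y /\ in_free_vars x z.
Proof.
move=> [f ef <-]; rewrite (@in_free_varsE x (FExists y f)) // in_free_varsE //=.
by rewrite mem_filter; split=> [/andP[/eqP]|[/eqP ? ?]] //; apply/andP.
Qed.

Lemma in_free_vars_bound x y : ~ in_free_vars x (pair_code 4 (pair_code x y)).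
Proof.
by move=> [[]] //= > [ef E]; code_inv; rewrite mem_filter eqxx.
Qed.

Lemma in_term_vars_var x y : in_term_vars x (pair_code 0 y) <-> x = y.
Proof. by rewrite (in_term_varsE x (TVar y)) inE; split=> [/eqP|->]. Qed.

Lemma in_term_vars_const k x : (1 <= k <= 2)%N -> ~ in_term_vars x (pair_code k 0).
Proof.
case: k => [|[|[|k]]] // _; first by move/(in_term_varsE x TZero).
by move/(in_term_varsE x TOne).
Qed.

Lemma syntax_th_sound a w (S : nat -> Prop) :
  (forall k n, (8 <= k <= 13)%N -> S (pair_code k n) = syntax_truth k n) ->
  holds a w S syntax_th.
Proof.
move=> SE; do ![split] => //= env; rewrite ?SE //= ?pairK1 ?pairK2;
  move: (env 0%N) (env 1%N) (env 2%N) => {env} x y z.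
all: pose proof (@is_term_op 3 x y isT); pose proof (@is_term_op 4 x y isT);
  pose proof (@is_term_op 5 x y isT).
all: pose proof (is_qf_eq x y); pose proof (is_qf_not x);
  pose proof (@is_qf_op 2 x y isT); pose proof (@is_qf_op 3 x y isT).
all: pose proof (is_ex_exists x y); pose proof (@is_ex_qf 0 x isT);
  pose proof (@is_ex_qf 1 x isT); pose proof (@is_ex_qf 2 x isT); pose proof (@is_ex_qf 3 x isT).
all: pose proof (@in_term_vars_op 3 x y z isT); pose proof (@in_term_vars_op 4 x y z isT);
  pose proof (@in_term_vars_op 5 x y z isT); pose proof (@in_free_vars_eq x y z);
  pose proof (@in_free_vars_not x y); pose proof (@in_free_vars_op 2 x y z isT);
  pose proof (@in_free_vars_op 3 x y z isT).
all: try tauto.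
all: clear.
- exact: is_term_var.
- exact/is_term_zero.
- by move/is_term_zero.
- exact/is_term_one.
- by move/is_term_one.
- exact: is_term_above.
- exact: is_qf_above.
- exact: is_ex_above.
- exact/in_term_vars_var.
- by move/in_term_vars_var; lia.
- by move/in_term_vars_var; lia.
- exact: in_term_vars_const.
- exact: in_term_vars_const.
- exact: in_free_vars_bound.
- by move=> /in_free_vars_exists->[].
- by move=> /in_free_vars_exists-> H; split=> //; lia.
- by move=> /in_free_vars_exists->[].
- by move=> /in_free_vars_exists-> H; split=> //; lia.
- by case.
- move=> [i]; rewrite ltnS leq_eqVlt => /predU1P[->|lti Hi]; first by right.
  by left; exists i.
- by move=> [i lti Hi]; exists i => //; apply: ltnW.
- by exists x.
Qed.

(** * Decidability of existential theories in positive characteristic *)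

Lemma code_rec T (d : T) (step : nat -> nat -> (nat -> T) -> T) :
  exists f, forall k m, f (pair_code k m) =
    step k m (fun j => if (j < pair_code k m)%N then f j else d).
Proof.
pose F := fix F fuel n := if fuel is fuel'.+1 then
  step (fst_code n) (snd_code n) (fun j => if (j < n)%N then F fuel' j else d) else d.
have FE a b n : (n < a)%N -> (n < b)%N -> F a n = F b n.
  elim/ltn_ind: n a b => n IH [|a] [|b] //= na nb; congr step; apply: funext => j.
  by case: ltnP => // jn; apply: IH => //; [move: na|move: nb]; rewrite ltnS; apply: leq_trans.
exists (fun n => F n.+1 n) => k m; rewrite [LHS]/= pairK1 pairK2; congr step.
by apply: funext => j; case: ltnP => // jn; apply: FE.
Qed.

Lemma ex_interpretation (K : fieldType) (e : nat -> K) (G : nat -> nat -> (nat -> K) -> K) :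
  exists val : nat -> K,
    [/\ interprets val, forall i, val (pair_code 0 i) = e i,
      forall n, val (pair_code 7 n) = n%:R &
      forall k m, val (pair_code (8 + k) m) =
        G k m (fun j => if (j < pair_code (8 + k) m)%N then val j else 0)].
Proof.
have [val valE] := code_rec 0 (fun k m f => match k with
  | 0%N => e m | 1%N => 0 | 2 => 1 | 3 => f (fst_code m) + f (snd_code m)
  | 4 => f (fst_code m) - f (snd_code m) | 5 => f (fst_code m) * f (snd_code m)
  | 6 => (f m)^-1 | 7 => m%:R | k => G (k - 8)%N m f end).
exists val; split=> [|i|n|k m]; last by rewrite valE /= addKn.
- by split; rewrite ?valE //; split=> *; rewrite valE ?pairK1 ?pairK2
    ?ltn_code1 ?ltn_code2 ?ltn_pair2.
- by rewrite valE.
- by rewrite valE.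
Qed.

Lemma ex_truth a w (K : fieldType) (val : nat -> K) (Q : nat -> nat -> Prop) :
  exists S : nat -> Prop, [/\ eq_interp val S, holds a w S formula_th &
    forall k m, (6 <= k)%N -> S (pair_code k m) = Q k m].
Proof.
have [S SE] := code_rec False (fun k m f => match k with
  | 0%N => val (fst_code m) = val (snd_code m) | 1%N => ~ f m
  | 2 => f (fst_code m) /\ f (snd_code m) | 3 => f (fst_code m) \/ f (snd_code m)
  | 4 => f (snd_code m) | k => Q k m end).
exists S; split=> [t u||[|[|[|[|[|k]]]]] m] //; try by rewrite SE ?pairK1 ?pairK2.
have S1 m : S (pair_code 1 m) = ~ S m by rewrite SE ltn_pair2.
have S2 i j : S (pair_code 2 (pair_code i j)) = (S i /\ S j).
  by rewrite SE pairK1 pairK2 ltn_code1 ?ltn_code2.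
have S3 i j : S (pair_code 3 (pair_code i j)) = (S i \/ S j).
  by rewrite SE pairK1 pairK2 ltn_code1 ?ltn_code2.
have S4 i j : S (pair_code 4 (pair_code i j)) = S j.
  by rewrite SE pairK2 ltn_code2.
do ![split] => //= env; rewrite ?S1 ?S2 ?S3 ?S4; try tauto.
by have [H|H] := EM (S (env 0%N)); [right|left].
Qed.

Fixpoint unseq_rec fuel n : seq nat :=
  match fuel, n with
  | fuel.+1, m.+1 => fst_code m :: unseq_rec fuel (snd_code m)
  | _, _ => [::]
  end.

Definition unseq n := unseq_rec n n.

Lemma unseqK : cancel seq_code unseq.
Proof.
move=> s; rewrite /unseq; have : (seq_code s <= seq_code s)%N by [].
move: {2 3}(seq_code s) => fuel; elim: s fuel => [|x s IH] [|fuel] //= le.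
by rewrite pairK1 pairK2 IH //; apply: leq_trans (leq_pair2 x _) le.
Qed.

Lemma seq_code_surj n : exists s, n = seq_code s.
Proof.
elim/ltn_ind: n => -[|n] IH; first by exists [::].
have [|s sE] := IH (snd_code n); first by rewrite ltnS -{2}[n]unpairK leq_pair2.
by exists (fst_code n :: s); rewrite /= -sE unpairK.
Qed.

Lemma unseq_cons x n : unseq (pair_code x n).+1 = x :: unseq n.
Proof. by have [s ->] := seq_code_surj n; rewrite unseqK -(unseqK (x :: s)). Qed.

Definition monic_poly (s : seq nat) : {poly int} :=
  foldr (fun c q => q * 'X + (c%:Z)%:P) 1 s.

Lemma coef_monic_poly s i :
  (monic_poly s)`_i = if (i < size s)%N then (nth 0%N s i)%:Z else (i == size s)%:Z.
Proof.
elim: s i => [|c s IH] [|i] /=; rewrite ?coef1 ?coefD ?coefMX ?coefC //=.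
by rewrite addr0 IH ltnS eqSS.
Qed.

Lemma monic_monic_poly s : monic_poly s \is monic /\ size (monic_poly s) = (size s).+1.
Proof.
have sz : size (monic_poly s) = (size s).+1.
  apply/eqP; rewrite eqn_leq; apply/andP; split.
    by apply/leq_sizeP => i lei; rewrite coef_monic_poly ltnNge (ltnW lei) /= gtn_eqF.
  rewrite ltnNge; apply/negP => /leq_sizeP/(_ _ (leqnn _)).
  by rewrite coef_monic_poly ltnn eqxx.
by split=> //; rewrite monicE lead_coefE sz coef_monic_poly ltnn eqxx.
Qed.

Lemma monic_poly_modp p (h : {poly int}) : (0 < p)%N -> h \is monic -> (1 < size h)%N ->
  exists s b, (0 < size s)%N /\ h = monic_poly s + b * p%:R.
Proof.
move=> p0 hmon h1; pose s := [seq `|(h`_i %% p)%Z|%N | i <- iota 0 (size h).-1].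
have ssz : size s = (size h).-1 by rewrite size_map size_iota.
have pn0 : p%:Z != 0 by rewrite eqz_nat -lt0n.
exists s, (\poly_(i < (size h).-1) (h`_i %/ p)%Z); split; first by rewrite ssz -subn1 subn_gt0.
apply/polyP => i; rewrite coefD coef_monic_poly mulr_natr coefMn coef_poly ssz.
case: ltngtP => [lti|gti|->].
- rewrite (nth_map 0%N) ?size_iota // nth_iota // add0n gez0_abs ?modz_ge0 //.
  by rewrite {1}(divz_eq h`_i p) addrC -mulr_natr natz.
- by rewrite mul0rn addr0 nth_default // -(prednK (ltnW h1)).
- by rewrite mul0rn addr0; have /monicP := hmon; rewrite lead_coefE.
Qed.

Fixpoint atoms (f : ring_formula) : seq (ring_term * ring_term) :=
  match f with
  | FEq t u => [:: (t, u)]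
  | FNot f => atoms f
  | FAnd f g | FOr f g => atoms f ++ atoms g
  | FExists _ _ | FForall _ _ => [::]
  end.

Lemma atoms_satisfies (K L : fieldType) (e : nat -> K) (e' : nat -> L) f :
  quantifier_free f ->
  (forall t u, (exists2 v, v = (t, u) & List.In v (atoms f)) ->
    ring_eval e t = ring_eval e u <-> ring_eval e' t = ring_eval e' u) ->
  satisfies e f <-> satisfies e' f.
Proof.
elim: f => //= [t u _ H|f IH qf H|f IHf g IHg|f IHf g IHg].
- by rewrite !term_evalE; apply: H; exists (t, u) => //; left.
- by rewrite IH.
- move=> /andP[qf qg] H; rewrite IHf ?IHg // => t u [v vE vin]; apply: H; exists v => //;
    apply: List.in_or_app; tauto.
- move=> /andP[qf qg] H; rewrite IHf ?IHg // => t u [v vE vin]; apply: H; exists v => //;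
    apply: List.in_or_app; tauto.
Qed.

Lemma atoms_below f : exists n, forall t u, List.In (t, u) (atoms f) ->
  vars_below n t /\ vars_below n u.
Proof.
have below t n m : (n <= m)%N -> vars_below n t -> vars_below m t.
  by move=> nm /allP H; apply/allP => i /H /= lt; apply: leq_trans nm.
have ex t : exists n, vars_below n t.
  exists (\max_(i <- term_vars t) i).+1; apply/allP => i it /=; rewrite ltnS.
  exact: (leq_bigmax_seq (F := id)).
elim: (atoms f) => [|[t u] l [n IH]]; first by exists 0%N.
have [[m mt] [m' mu]] := (ex t, ex u); exists (maxn n (maxn m m')) => t' u' [[<- <-]|/IH[tn un]].
- by split; [apply: below mt|apply: below mu]; rewrite !leq_max leqnn ?orbT.
- by split; apply: below (leq_maxl _ _) _.
Qed.

Lemma ex_separating_term (K : fieldType) (e : nat -> K) n l :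
  (forall t u, List.In (t, u) l -> vars_below n t /\ vars_below n u) ->
  exists s, [/\ vars_below n s, ring_eval e s != 0 &
    forall t u, List.In (t, u) l -> ring_eval e t != ring_eval e u ->
      forall (L : comPzRingType) (e' : nat -> L), exists z,
        ring_eval e' s = (ring_eval e' t - ring_eval e' u) * z].
Proof.
elim: l => [|[t u] l IH] H; first by exists TOne; split=> //=; rewrite oner_neq0.
have [|s [sn s0 sP]] := IH; first by move=> t' u' tu'; apply: H; right.
have [tn un] := H t u (or_introl erefl).
have [E|NE] := eqVneq (ring_eval e t) (ring_eval e u).
  exists s; split=> // t' u' [[<- <-]|/sP//]; by rewrite E eqxx.
exists (TMul (TSub t u) s); split=> /=.
- by rewrite /vars_below /= !all_cat; apply/andP; split=> //; apply/andP.
- by rewrite mulf_neq0 // subr_eq0.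
move=> t' u' [[<- <-]|H'] NE' L e'; first by exists (ring_eval e' s).
have [z ->] := sP t' u' H' NE' L e'; exists ((ring_eval e' t - ring_eval e' u) * z).
by rewrite mulrCA.
Qed.

Lemma int_poly_eval (L : fieldType) (th : L) :
  exists ev : {rmorphism {poly int} -> L}, forall q, ev q = (map_poly intr q).[th].
Proof. by exists (horner_eval th \o map_poly intr : {rmorphism {poly int} -> L}). Qed.

Lemma rmorph_modulo (R : pzRingType) (f : {rmorphism {poly int} -> R}) h p :
  f h = 0 -> p%:R = 0 :> R ->
  (forall b c, f (b * h + c * p%:R) = 0) /\ (forall b c, f (1 + b * h + c * p%:R) = 1).
Proof.
move=> fh p0; have E b c : f (b * h + c * p%:R) = 0.
  by rewrite rmorphD !rmorphM /= rmorph_nat fh p0 !mulr0 addr0.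
by split=> // b c; rewrite -addrA rmorphD rmorph1 E addr0.
Qed.

Section PosChar.
Variables (p : nat) (p_prime : prime p).

Section Theories.
Let x := EVar 0.
Let y := EVar 1.
Let z := EVar 2.
Let eEX := etag1 10.
Let eNS := etag2 13.
Let ePW := etag1 8.
Let eHV := etag1 9.
Let eGE := etag2 10.

Definition char_field_th : seq clause :=
  field_th ++ num_th ++ [:: [:: plit (eEq (eNum (ECst p)) eZero)]] ++
  formula_th ++ syntax_th.

Definition satisfiable_th : seq clause :=
  char_field_th ++ [:: [:: plit (eEX EIn)]; [:: nlit (eNS (ESucc EIn) EIn)]; [:: plit EIn]].

(* The witness codes a monic polynomial and a list of exponents: the variables
   are interpreted by [0] or by powers of a root of that polynomial. *)
Definition finite_point_th : seq clause :=
  [:: [:: plit (eEq (ePW (ECst 0)) eOne)];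
      [:: plit (eEq (ePW (ESucc x)) (eMul (ePW x) (ePW (ECst 1))))];
      [:: plit (eEq (eHV (ECst 0)) eOne)];
      [:: plit (eEq (eHV (econs x y)) (eAdd (eMul (eHV y) (ePW (ECst 1))) (eNum x)))];
      [:: plit (eEq (eHV (ESucc (EFst EWit))) eZero)];
      [:: plit (eEq (eGE (ECst 0) x) eZero)];
      [:: plit (eEq (eGE (econs (ECst 0) y) (ECst 0)) eZero)];
      [:: plit (eEq (eGE (econs (ESucc x) y) (ECst 0)) (ePW x))];
      [:: plit (eEq (eGE (econs x y) (ESucc z)) (eGE y z))];
      [:: plit (eEq (etag1 0 x) (eGE (ESnd EWit) x))]].

Definition refutable_th : seq clause :=
  char_field_th ++ finite_point_th ++
  [:: [:: nlit (eEX EIn); plit (eNS (ESucc EIn) EIn); nlit EIn]].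

End Theories.

Lemma char_field_th_model a w S : holds a w S char_field_th ->
  exists (L : fieldType) (val : nat -> L), [/\ interprets val, eq_interp val S,
    p \in [pchar L], forall n, val (pair_code 7 n) = n%:R &
    holds a w S formula_th /\ syntax_interp S].
Proof.
move=> /holds_cat[Hf /holds_cat[Hn /holds_cat[[Hp _] /holds_cat[HF /syntax_th_model Hs]]]].
have [L [val [vI SE _]]] := field_th_model Hf; exists L, val.
have valN := num_interp vI SE Hn; split=> //.
have := Hp (fun=> 0%N); rewrite /= SE valN; case: (vI) => -> _ _ p0.
by rewrite inE p_prime p0 eqxx.
Qed.

Variables (kappa : fieldType) (pkappa : p \in [pchar kappa]).
Hypothesis kappa_root : forall h : {poly int}, h \is monic -> (1 < size h)%N ->
  exists z : kappa, (map_poly intr h).[z] = 0.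

Lemma char_field_th_sound a w (e : nat -> kappa) (G : nat -> nat -> kappa) :
  exists (val : nat -> kappa) (S : nat -> Prop),
  [/\ interprets val, eq_interp val S, holds a w S char_field_th,
      forall i, val (pair_code 0 i) = e i &
      (forall n, val (pair_code 7 n) = n%:R) /\
      forall k m, val (pair_code (8 + k) m) = G k m].
Proof.
have [val [vI v0 v7 v8]] := ex_interpretation e (fun k m _ => G k m).
have [S [SE HF SQ]] := ex_truth a w val syntax_truth; exists val, S; split=> //.
rewrite /char_field_th; apply/holds_cat; split; first exact: field_th_sound vI SE.
apply/holds_cat; split; first exact: num_th_sound vI SE v7.
apply/holds_cat; split.
  by split=> // env /=; rewrite SE v7 (pcharf0 pkappa); case: vI => ->.
apply/holds_cat; split=> //; apply: syntax_th_sound => k n /andP[k8 _].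
by apply: SQ; apply: leq_trans k8.
Qed.

Let D n := exists2 phi, existential_theory kappa phi & formula_code phi = n.

Lemma matrix_qf phi : existential phi -> quantifier_free (matrix_of phi).
Proof. by elim: phi. Qed.

Lemma free_vars_code phi i : existential phi -> i \in free_vars phi ->
  (i <= formula_code phi)%N.
Proof.
have tcode t : i \in term_vars t -> (i <= term_code t)%N.
  have lt k a b : (0 < k)%N -> (i <= a)%N || (i <= b)%N ->
      (i <= pair_code k (pair_code a b))%N.
    by move=> k0 /orP[] le; apply: leq_trans le _; rewrite ltnW ?ltn_code1 ?ltn_code2.
  elim: t => //= [j|t IHt u IHu|t IHt u IHu|t IHt u IHu]; rewrite ?mem_cat ?inE.
  - by move=> /eqP ->; apply: leq_pair2.
  - by move=> H; apply: lt => //; case/orP: H => [/IHt|/IHu] ->; rewrite ?orbT.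
  - by move=> H; apply: lt => //; case/orP: H => [/IHt|/IHu] ->; rewrite ?orbT.
  - by move=> H; apply: lt => //; case/orP: H => [/IHt|/IHu] ->; rewrite ?orbT.
have lt k a b : (i <= a)%N || (i <= b)%N -> (i <= pair_code k (pair_code a b))%N.
  move=> H; apply: leq_trans (leq_pair2 _ _).
  by case/orP: H => le; apply: leq_trans le _; rewrite ?leq_pair1 ?leq_pair2.
elim: phi => //= [t u|f IH|f IHf g IHg|f IHf g IHg|j f IH].
- by move=> _; rewrite mem_cat => H; apply: lt; case/orP: H => /tcode ->; rewrite ?orbT.
- by move=> /qf_existential/IH H /H le; apply: leq_trans le (leq_pair2 _ _).
- move=> /andP[/qf_existential/IHf Hf /qf_existential/IHg Hg]; rewrite mem_cat => H.
  by apply: lt; case/orP: H => [/Hf|/Hg] ->; rewrite ?orbT.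
- move=> /andP[/qf_existential/IHf Hf /qf_existential/IHg Hg]; rewrite mem_cat => H.
  by apply: lt; case/orP: H => [/Hf|/Hg] ->; rewrite ?orbT.
- by rewrite mem_filter => /IH H /andP[_ /H le]; apply: lt; rewrite le orbT.
Qed.

Lemma syntax_interpP S phi : syntax_interp S -> existential phi ->
  S (pair_code 13 (pair_code (formula_code phi).+1 (formula_code phi))) <-> ~~ sentence phi.
Proof.
move=> [_ _ _ _ [VF NS]] ephi; rewrite NS /sentence; split=> [[i _ /(VF _ _ ephi)]|].
  by case: (free_vars phi).
case E: (free_vars phi) => [//|i s] _.
have ifv : i \in free_vars phi by rewrite E mem_head.
by exists i; [rewrite ltnS free_vars_code|apply/VF].
Qed.

Lemma satisfiable_unsat a : ~ D a <-> exists w, unsat a w satisfiable_th.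
Proof.
split=> [nD|[w /unsatP un] [phi [sphi ephi /(holds_in_matrix _ sphi ephi)[e Hphi]] phia]].
  exists 0%N; apply/unsatP => S /holds_cat[/char_field_th_model[L [val]]].
  case=> vI SE pL _ [HF HS] [/(_ (fun=> 0%N)) /= aEX [/(_ (fun=> 0%N)) /= aNS [/(_ (fun=> 0%N)) /=
      Sa _]]].
  have [_ _ /(_ a) exE _ _] := HS; have [phi ephi phia] := exE.1 aEX; apply: nD.
  have sphi : sentence phi.
    by apply: contrapT => /negP /(syntax_interpP HS ephi); rewrite phia.
  exists phi => //; split=> //; apply/holds_in_matrix => //.
  move: Sa; rewrite -phia; move/(formula_interp vI SE HF ephi).
  set e := fun i => _; set f := matrix_of phi => Hf.
  have qf : quantifier_free f := matrix_qf ephi.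
  have [n natoms] := atoms_below f.
  have [s [sn s0 sP]] := ex_separating_term e natoms.
  have [h [k]] := finite_field_point p_prime pL sn s0.
  set eta := fun i => _ => -[hmon h1 hP [y [b [c hs]]]].
  have [th hth] := kappa_root hmon h1.
  have [ev evE] := int_poly_eval th; rewrite -evE in hth.
  have [ev0 ev1] := rmorph_modulo (f := ev) hth (pcharf0 pkappa).
  exists (ev \o eta); apply/(atoms_satisfies (e := e) qf) => // t u [_ -> tu].
  have [tn un] := natoms t u tu; split=> [E|E].
    have [//||b' [c' E']] := hP (TSub t u).
    - by rewrite /vars_below /= all_cat; apply/andP.
    - by rewrite /= E subrr.
    apply/eqP; rewrite -subr_eq0; have := congr1 ev E'.
    by rewrite ring_eval_map ev0 => /= ->.
  apply/eqP; apply: contrapT => /negP NE; have [z] := sP t u tu NE _ (ev \o eta).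
  rewrite E subrr mul0r => /(congr1 ( *%R^~ (ev y))); rewrite mul0r -ring_eval_map -rmorphM hs ev1.
  by move/eqP; rewrite oner_eq0.
have [val [S [vI SE HC v0 _]]] := char_field_th_sound a w e (fun _ _ => 0).
apply: (un S); apply/holds_cat; split=> //.
have [_ [_ [_ _ _ _ [HF HS]]]] := char_field_th_model HC.
have Sa : S a.
  rewrite -phia; apply/(formula_interp vI SE HF ephi).
  by rewrite (_ : (fun i => _) = e) //; apply: funext => i; rewrite v0.
have [_ _ /(_ a) exE _ _] := HS; split=> [_ /=|]; first by apply/exE; exists phi.
split=> [_ /=|]; last by [].
by rewrite -phia => /(syntax_interpP HS ephi); rewrite sphi.
Qed.

Lemma refutable_unsat a : D a <-> exists w, unsat a w refutable_th.
Proof.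
split=> [[phi [sphi ephi /(holds_in_matrix _ sphi ephi)[e]]]|[w /unsatP un]].
  set f := matrix_of phi => Hf phia; have qf : quantifier_free f := matrix_qf ephi.
  have [n natoms] := atoms_below f.
  have [s [sn s0 sP]] := ex_separating_term e natoms.
  have [h [k]] := finite_field_point p_prime pkappa sn s0.
  set eta := fun i => _ => -[hmon h1 hP [y [b [c hs]]]].
  have [cs [d [cs0 hE]]] := monic_poly_modp (prime_gt0 p_prime) hmon h1.
  exists (pair_code (seq_code cs).-1 (seq_code k)); set w := pair_code _ _.
  apply/unsatP => S.
  move=> /holds_cat[HC /holds_cat[HP [Hgoal _]]].
  have [L [val [vI SE pL vN [HF HS]]]] := char_field_th_model HC.
  have [v_0 v_1 [vD _ vM _]] := vI.
  have rule i x y' z : (i < 10)%N ->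
      clause_holds a w S (nth 0%N [:: x; y'; z]) (nth [::] finite_point_th i).
    by move=> lti; apply: holds_nth HP lti.
  set th := val (pair_code 8 1).
  have PW m : val (pair_code 8 m) = th ^+ m.
    elim: m => [|m IH]; first by have := rule 0%N 0%N 0%N 0%N isT; rewrite /= SE v_1.
    by have := rule 1%N m 0%N 0%N isT; rewrite /= SE vM IH -exprSr.
  have [ev evE] := int_poly_eval th.
  have evX : ev 'X = th by rewrite evE map_polyX hornerX.
  have evC m : ev (m%:Z)%:P = m%:R by rewrite evE map_polyC hornerC.
  have HV l : val (pair_code 9 (seq_code l)) = ev (monic_poly l).
    elim: l => [|m l IH] /=; first by have := rule 2 0%N 0%N 0%N isT; rewrite /= SE v_1 rmorph1.
    have := rule 3 m (seq_code l) 0%N isT; rewrite /= SE vD vM IH vN => ->.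
    by rewrite rmorphD rmorphM evX evC.
  have [|ev0 ev1] := rmorph_modulo (f := ev) (h := h) _ (pcharf0 pL).
    rewrite hE rmorphD rmorphM rmorph_nat (pcharf0 pL) mulr0 addr0 -HV; have := rule 4 0%N 0%N 0%N isT.
    rewrite /= SE v_0 /w pairK1 prednK //.
    by case: (cs) cs0.
  have GE l i : val (pair_code 10 (pair_code (seq_code l) i)) =
      if nth 0%N l i is j.+1 then th ^+ j else 0.
    elim: l i => [|m l IH] i.
      by rewrite nth_nil; have := rule 5 i 0%N 0%N isT; rewrite /= SE v_0.
    case: i => [|i] /=; last by rewrite -IH; have := rule 8 m (seq_code l) i isT; rewrite /= SE.
    case: m => [|m]; first by have := rule 6 0%N (seq_code l) 0%N isT; rewrite /= SE v_0.
    by rewrite -PW; have := rule 7 m (seq_code l) 0%N isT; rewrite /= SE.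
  have etaE : (fun i => val (pair_code 0 i)) = ev \o eta.
    apply: funext => i; have := rule 9 i 0%N 0%N isT; rewrite /= SE /w pairK2 GE => ->.
    by rewrite /eta; case: nth => [|j] /=; rewrite ?rmorph0 ?rmorphXn ?evX.
  have [_ _ /(_ a) exE _ _] := HS.
  have [|aNS|nSa] := Hgoal (fun=> 0%N); first by apply/exE; exists phi.
    by move: aNS; rewrite /= -phia => /(syntax_interpP HS ephi); rewrite sphi.
  apply: nSa; rewrite /= -phia; apply/(formula_interp vI SE HF ephi); rewrite etaE.
  apply/(atoms_satisfies (e := e) qf) => // t u [_ -> tu].
  have [tn un] := natoms t u tu; split=> [E|E].
    have [//||b' [c' E']] := hP (TSub t u).
    - by rewrite /vars_below /= all_cat; apply/andP.
    - by rewrite /= E subrr.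
    apply/eqP; rewrite -subr_eq0; have := congr1 ev E'.
    by rewrite ring_eval_map ev0 => /= ->.
  apply/eqP; apply: contrapT => /negP NE; have [z] := sP t u tu NE _ (ev \o eta).
  rewrite E subrr mul0r => /(congr1 ( *%R^~ (ev y))); rewrite mul0r -ring_eval_map -rmorphM hs ev1.
  by move/eqP; rewrite oner_eq0.
apply: contrapT => nD.
pose cs := unseq (fst_code w).+1; have [hmon hsz] := monic_monic_poly cs.
have csE : (fst_code w).+1 = seq_code cs.
  by have [l lE] := seq_code_surj (fst_code w).+1; rewrite /cs lE unseqK.
have [|th hth] := kappa_root hmon; first by rewrite hsz; case: (cs) csE.
have [ev evE] := int_poly_eval th; rewrite -evE in hth.
have evX : ev 'X = th by rewrite evE map_polyX hornerX.
have evC m : ev (m%:Z)%:P = m%:R by rewrite evE map_polyC hornerC.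
pose elt j := if j is i.+1 then th ^+ i else 0.
pose ge m i := elt (nth 0%N (unseq m) i).
pose G k m := match k with
  | 0%N => th ^+ m | 1%N => ev (monic_poly (unseq m)) | _ => ge (fst_code m) (snd_code m) end.
have [val [S [vI SE HC v0 [v7 v8]]]] := char_field_th_sound a w (ge (snd_code w)) G.
have [_ [_ [_ _ _ _ [HF HS]]]] := char_field_th_model HC.
have [v_0 v_1 [vD _ vM _]] := vI.
have PW m : val (pair_code 8 m) = th ^+ m := v8 0%N m.
have HV m : val (pair_code 9 m) = ev (monic_poly (unseq m)) := v8 1%N m.
have GE l i : val (pair_code 10 (pair_code l i)) = ge l i.
  by have := v8 2 (pair_code l i); rewrite /= pairK1 pairK2.
have unseq0 : unseq 0 = [::] by [].
apply: (un S); apply/holds_cat; split=> //; apply/holds_cat; split.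
  do ![split] => //= env; rewrite SE ?vD ?vM ?PW ?HV ?GE ?v0 ?v7 ?v_0 ?v_1 /ge ?unseq0 ?unseq_cons //=.
  - by rewrite expr1 -exprSr.
  - by rewrite rmorph1.
  - by rewrite rmorphD rmorphM evX evC expr1.
  - by rewrite nth_nil.
split=> [env /= aEX|//].
have [_ _ /(_ a) /proj1/(_ aEX) [phi ephi phia] _ _] := HS.
have [sphi|nsphi] := boolP (sentence phi); last first.
  by left; rewrite -phia; apply/syntax_interpP.
right; rewrite -phia => /(formula_interp vI SE HF ephi) Hf; apply: nD.
by exists phi => //; split=> //; apply/holds_in_matrix => //; exists (fun i => val (pair_code 0 i)).
Qed.

Theorem decidable_existential_theory : decidable_formulas (existential_theory kappa).
Proof. exact: decidable_by_refutation refutable_unsat satisfiable_unsat. Qed.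

End PosChar.

(** * Valuation rings and Newton approximation *)

Section Newton.
Variables (L : fieldType) (O : subringClosed L) (w : L).
Hypothesis wO : w \in O.
Hypothesis fixpoint : forall g, g \is a polyOver O ->
  exists2 x, x \in O & x = w * g.[x].

Lemma newton (f : {poly L}) a b : f \is a polyOver O -> a \in O -> b \in O ->
  f.[a] = f^`().[a] ^+ 2 * w * b -> exists2 x, x \in O & f.[x] = 0.
Proof.
move=> fO aO bO fa; set u := f^`().[a] in fa.
have uO : u \in O by rewrite rpred_horner // polyOver_deriv.
pose c i := (f^`N(i.+2)).[a] * (u * w) ^+ i.
pose k := \poly_(i < size f) c i.
have kO : k \is a polyOver O.
  apply/polyOverP => i; rewrite coef_poly; case: ifP => _; last exact: rpred0.
  rewrite rpredM ?rpredX ?rpredM // rpred_horner //; exact: polyOver_nderivn.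
have cO : ('X - b%:P : {poly L}) \is a polyOver O.
  by rewrite rpredB ?polyOverX ?polyOverC.
have [z zO zE] : exists2 x, x \in O & x = w * (- ('X ^+ 2 * k) \Po ('X - b%:P)).[x].
  apply: fixpoint; apply: polyOver_comp => //.
  by rewrite rpredN; apply: rpredM => //; apply/rpredX/polyOverX.
have {}zE : z = - (w * (z - b) ^+ 2 * k.[z - b]).
  rewrite {1}zE horner_comp hornerN hornerM hornerXn !(hornerXsubC, hornerD, hornerX, hornerC, hornerN).
  by rewrite mulrN mulrA.
exists (a + u * w * (z - b)); first by rewrite rpredD ?rpredM ?rpredB.
have := @nderiv_taylor_wide _ (size f).+2 f a (u * w * (z - b)) (mulrC _ _).
rewrite -addn2 leq_addr => -> //; rewrite addn2 !big_ord_recl /=.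
rewrite nderivn0 nderivn1 expr0 mulr1 expr1 fa -/u.
have -> : \sum_(i < size f) (f^`N(bump 0 (bump 0 i))).[a] * (u * w * (z - b)) ^+ bump 0 (bump 0 i)
    = (u * w) ^+ 2 * (z - b) ^+ 2 * k.[z - b].
  rewrite horner_poly mulr_sumr; apply: eq_bigr => i _.
  rewrite /bump /= !add1n /c; set A := _.[a]; rewrite !(exprSr (u * w * (z - b))).
  by rewrite !exprMn; ring.
move: zE; set k' := k.[_] => zE.
have E : z + w * (z - b) ^+ 2 * k' = 0 by rewrite {1}zE addNr.
by transitivity (u ^+ 2 * w * (z + w * (z - b) ^+ 2 * k')); [ring|rewrite E mulr0].
Qed.

End Newton.

Section Divisibility.
Variables (p : nat) (p_prime : prime p) (L : fieldType) (O : subringClosed L).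
Hypothesis pn0 : p%:R != 0 :> L.

Definition pdvd k x := x / p%:R ^+ k \in O.

Lemma pdvd0 k : pdvd k 0. Proof. by rewrite /pdvd mul0r rpred0. Qed.

Lemma pdvdO x : pdvd 0 x = (x \in O). Proof. by rewrite /pdvd expr0 divr1. Qed.

Lemma pdvdD k x y : pdvd k x -> pdvd k y -> pdvd k (x + y).
Proof. by rewrite /pdvd mulrDl; apply: rpredD. Qed.

Lemma pdvdN k x : pdvd k (- x) = pdvd k x.
Proof. by rewrite /pdvd mulNr rpredN. Qed.

Lemma pdvdB k x y : pdvd k x -> pdvd k y -> pdvd k (x - y).
Proof. by move=> kx ky; rewrite pdvdD ?pdvdN. Qed.

Lemma pdvdM k l x y : pdvd k x -> pdvd l y -> pdvd (k + l) (x * y).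
Proof. by rewrite /pdvd exprD invfM mulrACA; apply: rpredM. Qed.

Lemma pdvdMl k x y : x \in O -> pdvd k y -> pdvd k (x * y).
Proof. by rewrite -pdvdO; apply: pdvdM. Qed.

Lemma pdvdMr k x y : y \in O -> pdvd k x -> pdvd k (x * y).
Proof. by rewrite mulrC; apply: pdvdMl. Qed.

Lemma pdvd_expM k x : pdvd k (p%:R ^+ k * x) = (x \in O).
Proof. by rewrite /pdvd mulrAC divff ?mul1r // expf_neq0. Qed.

Lemma pdvdP k x : pdvd k x -> exists2 y, y \in O & x = p%:R ^+ k * y.
Proof. by exists (x / p%:R ^+ k); rewrite // mulrC divfK // expf_neq0. Qed.

Lemma pdvdW k l x : (l <= k)%N -> pdvd k x -> pdvd l x.
Proof.
move=> /subnK <- /pdvdP[y yO ->]; rewrite exprD -mulrA mulrCA pdvd_expM.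
by rewrite rpredM ?rpredX ?rpred_nat.
Qed.

Lemma pdvdX k x n : pdvd k x -> pdvd (k * n) (x ^+ n).
Proof.
move=> kx; elim: n => [|n IH]; first by rewrite muln0 pdvdO rpred1.
by rewrite mulnS exprS pdvdM.
Qed.

Lemma pdvd_sum k I (r : seq I) (P : pred I) (F : I -> L) :
  (forall i, P i -> pdvd k (F i)) -> pdvd k (\sum_(i <- r | P i) F i).
Proof.
by move=> H; apply: (big_ind (pdvd k)) => //; [apply: pdvd0 | move=> x y; apply: pdvdD].
Qed.

Lemma pdvd_trans k x y z : pdvd k (x - y) -> pdvd k (y - z) -> pdvd k (x - z).
Proof. by move=> xy yz; rewrite -(subrK y x) -addrA pdvdD. Qed.

Lemma pdvd_sym k x y : pdvd k (x - y) -> pdvd k (y - x).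
Proof. by rewrite -pdvdN opprB. Qed.

Lemma pdvd_subX k x y n : x \in O -> y \in O -> pdvd k (x - y) ->
  pdvd k (x ^+ n - y ^+ n).
Proof.
move=> xO yO xy; rewrite subrXX pdvdMr //; apply: rpred_sum => i _.
by rewrite rpredM ?rpredX.
Qed.

Lemma pdvd_subXp k x y : x \in O -> y \in O -> pdvd k.+1 (x - y) ->
  pdvd k.+2 (x ^+ p - y ^+ p).
Proof.
move=> xO yO xy; rewrite subrXX -[k.+2]addn1; apply: pdvdM => //.
have -> : \sum_(i < p) x ^+ (p.-1 - i) * y ^+ i =
    p%:R * y ^+ p.-1 + \sum_(i < p) (x ^+ (p.-1 - i) - y ^+ (p.-1 - i)) * y ^+ i.
  have -> : p%:R * y ^+ p.-1 = \sum_(i < p) y ^+ (p.-1 - i) * y ^+ i.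
    rewrite mulr_natl -[p in _ *+ p]card_ord -sumr_const; apply: eq_bigr => i _.
    by rewrite -exprD subnK // -ltnS prednK ?prime_gt0.
  by rewrite -big_split; apply: eq_bigr => i _ /=; rewrite mulrBl addrC subrK.
rewrite pdvdD //; first by rewrite -[p%:R]expr1 pdvd_expM rpredX.
apply: pdvd_sum => i _; rewrite pdvdMr ?rpredX // pdvd_subX //.
exact: pdvdW xy.
Qed.

Lemma pdvd_subXpn j x y : x \in O -> y \in O -> pdvd 1 (x - y) ->
  pdvd j.+1 (x ^+ (p ^ j) - y ^+ (p ^ j)).
Proof.
move=> xO yO xy; elim: j => // j IH; rewrite expnSr !exprM.
by apply: pdvd_subXp; rewrite ?rpredX.
Qed.

Lemma pdvd_frob k m j x : x \in O -> pdvd k (x ^+ (p ^ m) - x) ->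
  pdvd k (x ^+ (p ^ (j * m)) - x).
Proof.
move=> xO H; elim: j => [|j IH]; first by rewrite expr1 subrr pdvd0.
rewrite mulSn expnD exprM; apply: pdvd_trans IH.
exact: pdvd_subX (rpredX _ xO) xO H.
Qed.

Lemma pdvd_teichmuller k m x : x \in O -> pdvd 1 (x ^+ (p ^ m) - x) -> (0 < m)%N ->
  pdvd 1 (x ^+ (p ^ (k * m)) - x) /\
  pdvd k ((x ^+ (p ^ (k * m))) ^+ (p ^ m) - x ^+ (p ^ (k * m))).
Proof.
move=> xO H m0; split; first exact: pdvd_frob.
rewrite -exprM mulnC exprM.
have := @pdvd_subXpn (k * m) _ _ (rpredX (p ^ m) xO) xO H.
by apply: pdvdW; apply: leqW; rewrite leq_pmulr.
Qed.

End Divisibility.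

Section ValuationRing.
Variables (p : nat) (p_prime : prime p) (L : fieldType) (O : subringClosed L).
Hypothesis valO : forall x, (x \in O) || (x^-1 \in O).
Hypothesis npO : p%:R^-1 \notin O.

Lemma val_pn0 : p%:R != 0 :> L.
Proof. by apply: contraNneq npO => ->; rewrite invr0 rpred0. Qed.

Lemma val_unit1p c : c \in O -> 1 + p%:R * c != 0 /\ (1 + p%:R * c)^-1 \in O.
Proof.
move=> cO; have pn0 := val_pn0; set u := 1 + _.
have E : p%:R^-1 = u / p%:R - c by rewrite mulrDl mul1r mulrAC divff // mul1r addrK.
have un0 : u != 0 by apply: contraNneq npO => u0; rewrite E u0 mul0r sub0r rpredN.
split=> //; case/orP: (valO (u / p%:R)) => H.
  by case/negP: npO; rewrite E rpredB.
rewrite invfM invrK in H; suff -> : u^-1 = 1 - c * (u^-1 * p%:R).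
  by apply: rpredB; [exact: rpred1|exact: rpredM].
have E1 : 1 = u - c * p%:R by rewrite /u; ring.
by rewrite -{1}[u^-1]mulr1 {1}E1 mulrBr mulVf // mulrCA.
Qed.

Lemma val_int_unit (m : int) : ~~ (p %| m)%Z -> m%:~R != 0 :> L /\ m%:~R^-1 \in O.
Proof.
move=> /(inv_modp p_prime)[d /dvdzP[c dc]].
have E : d%:~R * m%:~R = 1 + p%:R * c%:~R :> L.
  by rewrite -intrM -(subrK 1 (d * m)) dc intrD intrM addrC mulrC.
have [u0 uO] := val_unit1p (rpred_int O c).
have m0 : m%:~R != 0 :> L by apply: contraNneq u0 => m0; rewrite -E m0 mulr0.
split=> //; suff -> : m%:~R^-1 = d%:~R * (1 + p%:R * c%:~R)^-1 :> L.
  by rewrite rpredM ?rpred_int.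
by rewrite -E invfM mulVKf //; apply: contraNneq u0 => d0; rewrite -E d0 mul0r.
Qed.

Lemma val_int_neq0 (m : int) : m != 0 -> m%:~R != 0 :> L.
Proof.
rewrite -absz_gt0 => /(pfactor_coprime p_prime)[n pn E].
rewrite [m]intEsign E PoszM !intrM !mulf_neq0 //.
- by rewrite rmorphXn rmorphN1 signr_eq0.
- have [|//] := @val_int_unit n.
  by rewrite dvdzE -prime_coprime.
- by rewrite -pmulrn natrX expf_neq0 // val_pn0.
Qed.

Lemma val_pchar0 : [pchar L] =i pred0.
Proof.
by apply/pcharf0P => n; have [->|n0] := eqVneq n 0%N; rewrite ?eqxx //;
  apply/negbTE/(@val_int_neq0 n).
Qed.

End ValuationRing.

(** * Residue fields *)

Section Subring.
Variables (L : fieldType) (O : subringClosed L).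

Record subring_elt := SubringElt { subring_val : L; _ : subring_val \in O }.

HB.instance Definition _ := [isSub for subring_val].
HB.instance Definition _ := [Choice of subring_elt by <:].
HB.instance Definition _ := [SubChoice_isSubComNzRing of subring_elt by <:].

Lemma subring_valP (x : subring_elt) : val x \in O. Proof. exact: valP. Qed.

Lemma ex_subring_elt x : x \in O -> exists y : subring_elt, val y = x.
Proof. by move=> xO; exists (SubringElt xO). Qed.

Hypothesis valO : forall x, (x \in O) || (x^-1 \in O).

Definition val_nonunit (x : L) := (x == 0) || (x^-1 \notin O).

Lemma val_nonunitM x y : x \in O -> val_nonunit y -> val_nonunit (x * y).
Proof.
rewrite /val_nonunit; have [->|y0] := eqVneq y 0; first by rewrite mulr0 eqxx.
have [->|x0] := eqVneq x 0; first by rewrite mul0r eqxx.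
rewrite mulf_eq0 (negPf x0) (negPf y0) /= => xO; apply: contra => H.
by rewrite -(mulKf x0 y) invfM invrK rpredM.
Qed.

Lemma val_nonunitB x y : val_nonunit x -> val_nonunit y -> val_nonunit (x - y).
Proof.
have aux a b : b != 0 -> b^-1 \notin O -> a / b \in O -> val_nonunit (a - b).
  move=> b0 bO abO; rewrite /val_nonunit; case: eqVneq => //= ab0; apply: contra bO => H.
  have -> : b^-1 = (a / b - 1) * (a - b)^-1.
    by rewrite -(divff b0) -mulrBl mulrAC divff // mul1r.
  by rewrite rpredM // rpredB ?rpred1.
rewrite {1 2}/val_nonunit; have [->|x0] := eqVneq x 0.
  by move=> _; rewrite sub0r /val_nonunit oppr_eq0 invrN rpredN.
have [->|y0] := eqVneq y 0; first by rewrite subr0 /val_nonunit (negPf x0).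
move=> /= xO yO; case/orP: (valO (x / y)) => H; first exact: aux.
rewrite invfM invrK mulrC in H; have := aux y x x0 xO H.
by rewrite /val_nonunit -opprB oppr_eq0 invrN rpredN.
Qed.

Lemma ex_residue_field : exists (kappa : fieldType) (res : {rmorphism subring_elt -> kappa}),
  (forall x, (res x == 0) = val_nonunit (val x)) /\ forall z, exists x, res x = z.
Proof.
pose R (x y : subring_elt) : Prop := val_nonunit (val (x - y)).
pose inv (x : subring_elt) : subring_elt := insubd x (val x)^-1.
have nu0 : val_nonunit 0 by rewrite /val_nonunit eqxx.
have Rrefl x : R x x by rewrite /R subrr.
have RB x x' y y' : R x x' -> R y y' -> R (x - y) (x' - y').
  move=> Hx Hy; rewrite /R (_ : x - y - (x' - y') = (x - x') - (y - y')); last by ring.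
  exact: val_nonunitB.
have Rsym x y : R x y -> R y x.
  by move=> H; have := RB _ _ _ _ (Rrefl y) H; rewrite /R; congr (is_true (val_nonunit (val _))); ring.
have RN x x' : R x x' -> R (- x) (- x').
  by move=> H; have := RB _ _ _ _ (Rrefl 0) H; rewrite !sub0r.
have RD x x' y y' : R x x' -> R y y' -> R (x + y) (x' + y').
  by move=> Hx /RN Hy; have := RB _ _ _ _ Hx Hy; rewrite !opprK.
have Rtrans x y z : R x y -> R y z -> R x z.
  by move=> Hx Hy; have := RD _ _ _ _ Hx Hy; rewrite /R; congr (is_true (val_nonunit (val _))); ring.
have RM x x' y y' : R x x' -> R y y' -> R (x * y) (x' * y').
  move=> Hx Hy; apply: (Rtrans _ (x * y')); rewrite /R.
    by rewrite -mulrBr; apply: val_nonunitM => //; apply: subring_valP.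
  by rewrite -mulrBl mulrC; apply: val_nonunitM => //; apply: subring_valP.
have eqR x y : x = y -> R x y by move=> ->.
have one0 : ~ R 1 0 by rewrite /R subr0 /val_nonunit rmorph1 oner_eq0 invr1 rpred1.
have invP x : ~ R x 0 -> R (inv x * x) 1.
  rewrite /R subr0 /val_nonunit => /negP; rewrite negb_or negbK => /andP[x0 xO].
  by apply: eqR; apply: val_inj; rewrite rmorphM rmorph1 /= val_insubd xO mulVf.
have [kappa [res [surj resE res0 res1 [resD resM resN]]]] := field_of_setoid Rrefl Rsym
  Rtrans RD RM RN (fun x y z => eqR _ _ (addrA x y z)) (fun x y => eqR _ _ (addrC x y))
  (fun x => eqR _ _ (add0r x)) (fun x => eqR _ _ (addNr x))
  (fun x y z => eqR _ _ (mulrA x y z)) (fun x y => eqR _ _ (mulrC x y))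
  (fun x => eqR _ _ (mul1r x)) (fun x y z => eqR _ _ (mulrDl x y z)) one0 invP.
have res_add : zmod_morphism res by move=> x y; rewrite resD resN.
have res_mul : monoid_morphism res by split=> // x y; rewrite resM.
pose A := GRing.isZmodMorphism.Build _ _ res res_add.
pose M := GRing.isMonoidMorphism.Build _ _ res res_mul.
pose f : {rmorphism subring_elt -> kappa} := HB.pack res A M.
exists kappa, f; split=> // x; rewrite -res0; apply/eqP/idP => [/resE|H].
  by rewrite /R subr0.
by apply/resE; rewrite /R subr0.
Qed.

End Subring.

(** * Transport of congruences modulo powers of p *)

Section Terms.

Fixpoint term_pow t n := if n is m.+1 then TMul t (term_pow t m) else TOne.
Fixpoint term_nat n := if n is m.+1 then TAdd TOne (term_nat m) else TZero.
Fixpoint term_subst (s : nat -> ring_term) t :=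
  match t with
  | TVar i => s i
  | TZero => TZero
  | TOne => TOne
  | TAdd t u => TAdd (term_subst s t) (term_subst s u)
  | TSub t u => TSub (term_subst s t) (term_subst s u)
  | TMul t u => TMul (term_subst s t) (term_subst s u)
  end.
Fixpoint term_sum (F : nat -> ring_term) n :=
  if n is m.+1 then TAdd (term_sum F m) (F m) else TZero.

Variables (R : comNzRingType) (e : nat -> R).

Lemma ring_eval_pow t n : ring_eval e (term_pow t n) = ring_eval e t ^+ n.
Proof. by elim: n => //= n ->; rewrite exprS. Qed.

Lemma ring_eval_nat n : ring_eval e (term_nat n) = n%:R.
Proof. by elim: n => //= n ->; rewrite -natr1 addrC. Qed.

Lemma ring_eval_subst s t :
  ring_eval e (term_subst s t) = ring_eval (fun i => ring_eval e (s i)) t.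
Proof. by elim: t => //= t -> u ->. Qed.

Lemma ring_eval_sum F n :
  ring_eval e (term_sum F n) = \sum_(i < n) ring_eval e (F i).
Proof. by elim: n => [|n IH] /=; rewrite ?big_ord0 // big_ord_recr /= IH. Qed.

End Terms.

Lemma term_of_int (c : int) : exists t, forall (R : comNzRingType) (e : nat -> R),
  ring_eval e t = c%:~R.
Proof.
case: c => n; first by exists (term_nat n) => R e; rewrite ring_eval_nat.
by exists (TSub TZero (term_nat n.+1)) => R e; rewrite /= ring_eval_nat NegzE mulrNz sub0r -pmulrn
    -natr1 addrC.
Qed.

Lemma term_of_int_poly (P : {poly int}) s : exists t,
  forall (R : comNzRingType) (e : nat -> R),
  ring_eval e t = (map_poly intr P).[ring_eval e s].
Proof.
elim/poly_ind: P => [|P c [t tE]]; first by exists TZero => R e; rewrite rmorph0 horner0.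
have [u uE] := term_of_int c; exists (TAdd (TMul t s) u) => R e /=.
by rewrite tE uE rmorphD rmorphM /= map_polyX map_polyC !hornerE.
Qed.

Section Frobenius.
Variables (p : nat) (p_prime : prime p).

Lemma term_addX t u : exists c, forall (R : comNzRingType) (e : nat -> R),
  (ring_eval e t + ring_eval e u) ^+ p =
  ring_eval e t ^+ p + ring_eval e u ^+ p + p%:R * ring_eval e c.
Proof.
pose F i := TMul (term_nat ('C(p, i.+1) %/ p))
  (TMul (term_pow t (p - i.+1)) (term_pow u i.+1)).
exists (term_sum F p.-1) => R e; rewrite ring_eval_sum exprDn.
have := prime_gt0 p_prime; case: p p_prime @F => // q q_prime F _.
rewrite big_ord_recl big_ord_recr /= subn0 subnn bin0 binn !mulr1n expr0 mulr1 mul1r.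
rewrite -addrA; congr (_ + _); rewrite addrC; congr (_ + _).
rewrite mulr_sumr; apply: eq_bigr => i _; rewrite /F /= !ring_eval_pow ring_eval_nat.
rewrite mulrA -natrM mulnC divnK; first by rewrite -mulr_natl /bump /= add1n exprS.
by apply: prime_dvd_bin => //=; rewrite ltnS.
Qed.

Lemma term_frobenius t : exists r, forall (R : comNzRingType) (e : nat -> R),
  ring_eval (fun i => e i ^+ p) t = ring_eval e t ^+ p + p%:R * ring_eval e r.
Proof.
have p0 := prime_gt0 p_prime.
elim: t => [i|||t [r rE] u [s sE]|t [r rE] u [s sE]|t [r rE] u [s sE]] /=.
- by exists TZero => R e; rewrite mulr0 addr0.
- by exists TZero => R e; rewrite mulr0 addr0 expr0n gtn_eqF.
- by exists TZero => R e; rewrite mulr0 addr0 expr1n.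
- have [c cE] := term_addX t u; exists (TSub (TAdd r s) c) => R e /=.
  by rewrite rE sE cE; ring.
- have [c cE] := term_addX (TSub t u) u; exists (TAdd (TSub r s) c) => R e /=.
  rewrite rE sE; have := cE R e; rewrite /= subrK => ->; ring.
- exists (TAdd (TAdd (TMul (term_pow t p) s) (TMul r (term_pow u p)))
    (TMul (term_nat p) (TMul r s))) => R e /=.
  by rewrite rE sE !ring_eval_pow ring_eval_nat exprMn; ring.
Qed.

Lemma term_frobeniusX m t : exists r, forall (R : comNzRingType) (e : nat -> R),
  ring_eval (fun i => e i ^+ (p ^ m)) t =
  ring_eval e t ^+ (p ^ m) + p%:R * ring_eval e r.
Proof.
elim: m t => [|m IH] t.
  by exists TZero => R e /=; rewrite mulr0 addr0 expr1.
have [r rE] := term_frobenius t; have [s sE] := IH t.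
have [c cE] := term_addX (term_pow t (p ^ m)) (TMul (term_nat p) s).
exists (TAdd (TAdd c (TMul (term_pow (term_nat p) p.-1) (term_pow s p)))
  (term_subst (fun i => term_pow (TVar i) (p ^ m)) r)) => R e.
have := rE R (fun i => e i ^+ (p ^ m)); rewrite sE.
have := cE R e; rewrite /= !ring_eval_pow ring_eval_nat => ->.
rewrite ring_eval_subst.
have -> : (fun i => ring_eval e (term_pow (TVar i) (p ^ m))) = (fun i => e i ^+ (p ^ m)).
  by apply: funext => i; rewrite ring_eval_pow.
have -> : (fun i => (e i ^+ (p ^ m)) ^+ p) = (fun i => e i ^+ (p ^ m.+1)).
  by apply: funext => i; rewrite -exprM -expnSr.
move=> ->; rewrite -exprM -expnSr exprMn.
have -> : p%:R ^+ p = p%:R * p%:R ^+ p.-1 :> R by rewrite -exprS prednK ?prime_gt0.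
by ring.
Qed.

End Frobenius.

Section Transport.
Variables (p : nat) (p_prime : prime p).

Lemma ring_eval_in (L : fieldType) (O : subringClosed L) (e : nat -> L) t :
  (forall i, e i \in O) -> ring_eval e t \in O.
Proof.
move=> eO; elim: t => //= [||t IHt u IHu|t IHt u IHu|t IHt u IHu].
- exact: rpred0.
- exact: rpred1.
- exact: rpredD.
- exact: rpredB.
- exact: rpredM.
Qed.

Lemma pdvd_ring_eval (L : fieldType) (O : subringClosed L) k (e e' : nat -> L) t :
  p%:R != 0 :> L -> (forall i, e i \in O) -> (forall i, e' i \in O) ->
  (forall i, pdvd p O k (e i - e' i)) -> pdvd p O k (ring_eval e t - ring_eval e' t).
Proof.
move=> pn0 eO e'O ee'; elim: t => //= [||t IHt u IHu|t IHt u IHu|t IHt u IHu].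
- by rewrite subrr pdvd0.
- by rewrite subrr pdvd0.
- by rewrite opprD addrACA; apply: pdvdD.
- rewrite (_ : _ - _ = ring_eval e t - ring_eval e' t
    - (ring_eval e u - ring_eval e' u)); last by ring.
  exact: pdvdB.
- rewrite (_ : _ - _ = ring_eval e t * (ring_eval e u - ring_eval e' u)
    + (ring_eval e t - ring_eval e' t) * ring_eval e' u); last by ring.
  by apply: pdvdD => //; [apply: pdvdMl|apply: pdvdMr]; rewrite ?ring_eval_in.
Qed.

Variables (L1 L2 : fieldType) (O1 : subringClosed L1) (O2 : subringClosed L2).
Hypothesis p1 : p%:R != 0 :> L1.
Hypothesis p2 : p%:R != 0 :> L2.
Variables (N m : nat) (a1 : nat -> L1) (a2 : nat -> L2).
Hypothesis m0 : (0 < m)%N.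
Hypothesis a1O : forall i, a1 i \in O1.
Hypothesis a2O : forall i, a2 i \in O2.
Hypothesis a1m : forall i, pdvd p O1 N (a1 i ^+ (p ^ m) - a1 i).
Hypothesis a2m : forall i, pdvd p O2 N (a2 i ^+ (p ^ m) - a2 i).
Hypothesis a12 : forall t, pdvd p O1 1 (ring_eval a1 t) -> pdvd p O2 1 (ring_eval a2 t).

(* For Teichmueller representatives [a], [t (a) = t (a ^ q) = t (a) ^ q + p r (a)]
   for some integral [r]: the congruence of [t (a)] to 0 modulo a power of p
   reduces to that of [r (a)] modulo a smaller power. *)
Lemma transport k t : (k <= N)%N ->
  pdvd p O1 k (ring_eval a1 t) -> pdvd p O2 k (ring_eval a2 t).
Proof.
elim: k t => [|k IH] t kN H; first by rewrite pdvdO ring_eval_in.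
have [k0|k0] := posnP k; first by move: H; rewrite k0 => /a12.
have [r rE] := term_frobeniusX p_prime m t.
have q2 : (1 < p ^ m)%N by rewrite -(exp1n m) ltn_exp2r // prime_gt1.
have step (L : fieldType) (O : subringClosed L) (a : nat -> L) : p%:R != 0 :> L ->
    (forall i, a i \in O) -> (forall i, pdvd p O N (a i ^+ (p ^ m) - a i)) ->
    pdvd p O k (ring_eval a t) ->
    pdvd p O k.+1 (ring_eval a t) <-> pdvd p O k (ring_eval a r).
  move=> pn0 aO am tk.
  have H1 : pdvd p O k.+1 (ring_eval (fun i => a i ^+ (p ^ m)) t - ring_eval a t).
    apply: pdvdW (kN) _ => //; apply: pdvd_ring_eval => // i; exact: rpredX.
  have H2 : pdvd p O k.+1 (ring_eval a t ^+ (p ^ m)).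
    apply: (@pdvdW _ _ _ pn0 (k * p ^ m)); last exact: pdvdX.
    by apply: leq_trans (leq_mul (leqnn k) q2); rewrite muln2 -addnn -addn1 leq_add2l.
  have -> : pdvd p O k (ring_eval a r) = pdvd p O k.+1 (p%:R * ring_eval a r).
    rewrite /pdvd exprS invfM mulrACA divff ?mul1r //.
  split=> H0.
    rewrite (_ : p%:R * _ = (ring_eval (fun i => a i ^+ (p ^ m)) t - ring_eval a t)
      + ring_eval a t - ring_eval a t ^+ (p ^ m)); first by apply: pdvdB => //; apply: pdvdD.
    by rewrite rE; ring.
  rewrite (_ : ring_eval a t = ring_eval a t ^+ (p ^ m) + p%:R * ring_eval a r
    - (ring_eval (fun i => a i ^+ (p ^ m)) t - ring_eval a t)); last by rewrite rE; ring.
  by apply: pdvdB => //; apply: pdvdD.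
have kN' := ltnW kN; have H' : pdvd p O1 k (ring_eval a1 t) by apply: pdvdW H.
apply/step => //; first exact: IH.
by apply: IH => //; apply/step.
Qed.

End Transport.

(** * Algebraic elements of characteristic 0 fields *)

Section CharZero.
Variable L : fieldType.
Hypothesis char0 : [pchar L] =i pred0.

Lemma intr_eq0_pchar0 (m : int) : (m%:~R == 0 :> L) = (m == 0).
Proof.
have /pcharf0P H := char0.
case: m => n; first by rewrite -pmulrn H.
by rewrite NegzE mulrNz oppr_eq0 -pmulrn H.
Qed.

Lemma ratr_frac (x : rat) (c d : int) : d != 0 -> x * d%:~R = c%:~R ->
  ratr x = c%:~R / d%:~R :> L.
Proof.
move=> d0 E; have dL : d%:~R != 0 :> L by rewrite intr_eq0_pchar0.
have nL : (denq x)%:~R != 0 :> L by rewrite intr_eq0_pchar0 denq_neq0.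
apply: (canRL (mulfK dL)); rewrite /ratr mulrAC; apply/esym/(canRL (mulfK nL))/esym.
rewrite -!intrM; congr _%:~R; apply: (intr_inj (R := rat)).
by rewrite !intrM -E numqE; ring.
Qed.

Lemma ex_rat_rmorphism : exists f : {rmorphism rat -> L}, f =1 ratr.
Proof.
have frac (x : rat) : x * (denq x)%:~R = (numq x)%:~R by rewrite numqE.
have d0 (x : rat) : (denq x)%:~R != 0 :> L by rewrite intr_eq0_pchar0 denq_neq0.
have fB : zmod_morphism (ratr : rat -> L).
  move=> x y; rewrite (@ratr_frac (x - y) (numq x * denq y - numq y * denq x) (denq x * denq y)).
  - rewrite /ratr intrM rmorphB !rmorphM /=; field; rewrite !d0 //.
  - by rewrite mulf_neq0 ?denq_neq0.
  - by rewrite rmorphB !rmorphM /= -!frac; ring.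
have fM : monoid_morphism (ratr : rat -> L).
  split=> [|x y]; first by rewrite -[1]/(1%:~R) ratr_int.
  rewrite (@ratr_frac (x * y) (numq x * numq y) (denq x * denq y)).
  - rewrite /ratr !rmorphM /=; field; rewrite !d0 //.
  - by rewrite mulf_neq0 ?denq_neq0.
  - by rewrite !rmorphM /= -!frac; ring.
pose A := GRing.isZmodMorphism.Build _ _ _ fB.
pose M := GRing.isMonoidMorphism.Build _ _ _ fM.
by exists (HB.pack (ratr : rat -> L) A M : {rmorphism rat -> L}).
Qed.

Definition int_root (F : {poly int}) (z : L) := root (map_poly intr F) z.

Definition algebraic z := exists2 F, F != 0 & int_root F z.

Lemma algebraicE (f : {rmorphism rat -> L}) z :
  algebraic z <-> algebraicOver f z.
Proof.
split=> [[F F0 Fz]|[g g0 gz]].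
  exists (map_poly intr F).
    by rewrite -size_poly_eq0 size_map_poly_id0 ?size_poly_eq0 // intr_eq0 lead_coef_eq0.
  rewrite (_ : map_poly f _ = map_poly intr F) //.
  by apply/polyP => i; rewrite !coef_rmap rmorph_int.
have [F [a a0 E]] := rat_poly_scale g; exists F.
  by apply: contraNneq g0 => F0; rewrite E F0 rmorph0 scaler0.
move: gz; rewrite E map_polyZ rootZ.
  by congr (root _ z); apply/polyP => i; rewrite !coef_rmap rmorph_int.
by rewrite fmorphV invr_eq0 rmorph_int intr_eq0_pchar0.
Qed.

End CharZero.

Lemma ratr_root_int (f : {poly rat}) : f != 0 -> exists2 F : {poly int}, F != 0 &
  forall (K : fieldType) (z : K), [pchar K] =i pred0 ->
  root (map_poly ratr f) z = int_root F z.
Proof.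
move=> f0; have [F [a a0 E]] := rat_poly_scale f; exists F.
  by apply: contraNneq f0 => F0; rewrite E F0 rmorph0 scaler0.
move=> K z K0; rewrite /int_root.
suff -> : map_poly ratr f = (a%:~R)^-1 *: map_poly intr F :> {poly K}.
  by rewrite rootZ // invr_eq0 intr_eq0_pchar0.
have [g gE] := ex_rat_rmorphism K0.
apply/polyP => i; rewrite coefZ coef_map_id0 ?coef_rmap -?gE ?rmorph0 //.
by rewrite E coefZ coef_rmap rmorphM fmorphV !rmorph_int.
Qed.

(** * Minimal integral polynomials *)

Section IntPoly.
Variables (L : fieldType) (char0 : [pchar L] =i pred0).

(* The substitution [Y = N X], with [N] the leading coefficient, makes a root
   of an integral polynomial integral. *)
Lemma int_root_scale (F : {poly int}) : F != 0 -> exists2 G : {poly int}, G != 0 &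
  forall (K : fieldType) (z : K), (lead_coef F)%:~R != 0 :> K ->
  int_root G z = int_root F (z / (lead_coef F)%:~R).
Proof.
move=> F0; set N := lead_coef F; have N0 : N != 0 by rewrite lead_coef_eq0.
have s0 : (0 < size F)%N by rewrite size_poly_gt0.
exists (\poly_(i < size F) (F`_i * N ^+ ((size F).-1 - i))).
  apply/eqP => /(congr1 (fun P : {poly int} => P`_(size F).-1)).
  rewrite coef0 coef_poly prednK // leqnn subnn mulr1 => /eqP.
  by rewrite -lead_coefE (negPf N0).
move=> K z NK; rewrite /int_root /root.
have le (G : {poly int}) : (size (map_poly intr G : {poly K}) <= size G)%N by apply: size_poly.
rewrite (horner_coef_wide _ (leq_trans (le _) (size_poly _ _))) (horner_coef_wide _ (le _)).
set S := \sum_(i < _) (map_poly intr F)`_i * _.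
suff -> : \sum_(i < size F) (map_poly intr (\poly_(i < size F) (F`_i * N ^+ ((size F).-1 - i))))`_i
    * z ^+ i
    = N%:~R ^+ (size F).-1 * S by rewrite mulf_eq0 expf_eq0 (negPf NK) andbF.
rewrite mulr_sumr; apply: eq_bigr => i _; rewrite !coef_rmap coef_poly ltn_ord rmorphM rmorphXn /=.
have le_i : (i <= (size F).-1)%N by rewrite -ltnS prednK.
rewrite -{2}(subnK le_i) exprD expr_div_n; field; rewrite ?expf_neq0 //.
Qed.

Lemma min_int_root (y : L) : algebraic y -> exists2 M : {poly int}, int_root M y &
  (forall F, int_root F y -> forall (K : fieldType) (z : K), [pchar K] =i pred0 ->
    int_root M z -> int_root F z) /\
  exists (a b : {poly int}) D, D != 0 /\ a * M + b * M^`() = D%:P.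
Proof.
have [ev evE] := int_poly_eval y.
have rE F : int_root F y = (ev F == 0) by rewrite evE.
case=> F0 F00 F0y; pose P (M : {poly int}) := M != 0 /\ int_root M y.
have [M [M0 My] Mmin] := @ex_min_measure _ P (fun M => size M) (ex_intro _ F0 (conj F00 F0y)).
have small F : int_root F y -> (size F < size M)%N -> F = 0.
  move=> Fy lt; apply/eqP; apply: contraTT lt => F0'; rewrite -leqNgt.
  by apply: Mmin.
have s1 : (1 < size M)%N.
  rewrite ltnNge; apply/negP => s1; have hC := size1_polyC s1.
  move: My M0; rewrite /int_root hC map_polyC rootC /= intr_eq0_pchar0 // => /eqP ->.
  by rewrite eqxx.
exists M => //; split=> [F Fy K z K0 Mz|].
  have := Pdiv.Idomain.divp_eq F M.
  have [ev' ev'E] := int_poly_eval z.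
  set k := scalp F M; set q := F %/ M; set r := F %% M => E.
  have r0 : r = 0.
    apply: small; last by rewrite ltn_modp.
    rewrite rE -(addKr (q * M) r) -E rmorphD rmorphN -mul_polyC !rmorphM /=.
    by move: Fy My; rewrite !rE => /eqP -> /eqP ->; rewrite !mulr0 oppr0 addr0.
  rewrite r0 addr0 in E; have /eqP := congr1 ev' E.
  rewrite -mul_polyC !rmorphM /= [ev' M]ev'E (rootP Mz) mulr0 mulf_eq0 -[_ || _]orbC.
  rewrite /int_root /root -ev'E => /orP[//|].
  rewrite ev'E map_polyC hornerC /= intr_eq0_pchar0 //.
  by rewrite expf_eq0 lead_coef_eq0 (negPf M0) andbF.
have M'0 : M^`() != 0.
  apply/eqP => /(congr1 (fun P : {poly int} => P`_(size M).-2)).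
  have E : (size M).-1 = (size M).-2.+1 by rewrite prednK // -ltnS prednK // ltnW.
  rewrite coef0 coef_deriv -E -lead_coefE => /eqP.
  by rewrite -mulr_natr mulf_eq0 lead_coef_eq0 (negPf M0) pnatr_eq0 E.
have sM' : (size M^`() < size M)%N by apply: lt_size_deriv.
have sg : (size (gcdp M M^`()) < size M)%N.
  by apply: leq_ltn_trans sM'; apply: dvdp_leq => //; apply: dvdp_gcdr.
have g0 : gcdp M M^`() != 0 by rewrite gcdp_eq0 negb_and M0.
have g1 : size (gcdp M M^`()) = 1%N.
  have /Pdiv.Idomain.dvdpP[[c q] /= c0 E] := dvdp_gcdl M M^`().
  have qg0 : q * gcdp M M^`() != 0.
    by rewrite -E -mul_polyC mulf_neq0 ?polyC_eq0.
  have q0 : q != 0 by apply: contraNneq qg0 => ->; rewrite mul0r.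
  have sE : size M = (size q + size (gcdp M M^`())).-1.
    by rewrite -size_mul // -E -mul_polyC size_Cmul.
  have : ev q * ev (gcdp M M^`()) == 0.
    by rewrite -rmorphM -E -mul_polyC rmorphM mulf_eq0 -[ev M == 0]rE My orbT.
  rewrite mulf_eq0 -!rE => /orP[qy|gy]; last by rewrite (small _ gy sg) eqxx in g0.
  have := Mmin q (conj q0 qy); rewrite sE; rewrite -size_poly_gt0 in g0.
  case: (size _) g0 => [|[|n]] // _.
  by rewrite addnS /= addnS -ltn_subRL subnn ltn0.
have [[a b] /=] := Pdiv.Idomain.Bezoutp M M^`().
rewrite (size1_polyC (eq_leq g1)); set c := _`_0 => /Pdiv.Idomain.eqpP[[c1 c2] /andP[/= c10 c20] E].
exists (c1%:P * a), (c1%:P * b), (c2 * c); split.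
  rewrite mulf_neq0 //; apply: contraNneq g0 => c0.
  by rewrite (size1_polyC (eq_leq g1)) -/c c0.
by rewrite -!mulrA -mulrDr mul_polyC E -mul_polyC -polyCM.
Qed.

End IntPoly.

(** * Comparison of algebraic elements of unramified valued fields *)

Lemma rmorph_int_poly (R S : comNzRingType) (f : {rmorphism R -> S}) (F : {poly int}) x :
  f (map_poly intr F).[x] = (map_poly intr F).[f x].
Proof.
rewrite -horner_map; congr (_.[_]); apply/polyP => i.
by rewrite !coef_rmap rmorph_int.
Qed.

Section Digits.
Variables (p : nat) (p_prime : prime p) (L : fieldType) (O : subringClosed L).
Hypothesis valO : forall x, (x \in O) || (x^-1 \in O).
Hypothesis npO : p%:R^-1 \notin O.
Let pn0 : p%:R != 0 :> L := val_pn0 npO.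

Lemma residue_pchar (kappa : fieldType) (res : {rmorphism subring_elt O -> kappa}) :
  (forall x, (res x == 0) = val_nonunit O (val x)) -> p \in [pchar kappa].
Proof.
move=> res0; by rewrite inE p_prime -(rmorph_nat res) res0 rmorph_nat /val_nonunit npO orbT.
Qed.

Lemma algebraic_residue z : z \in O -> algebraic z ->
  exists2 m, (0 < m)%N & val_nonunit O (z ^+ (p ^ m) - z).
Proof.
move=> zO [F F0 Fz]; have [kappa [res [res0 _]]] := ex_residue_field valO.
have pk := residue_pchar res0; have [x xE] := ex_subring_elt zO.
have [||m m0 mE] := @algebraic_pth_root p kappa (zprimitive F) (res x) pk.
- apply/eqP => E; have : (p %| zcontents (zprimitive F))%Z.
    rewrite dvdz_contents; apply/polyOverP => i.
    by change (p %| (zprimitive F)`_i)%Z; rewrite (dvdz_pcharf pk) -coef_rmap E coef0.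
  by rewrite zcontents_primitive F0 dvdzE /= dvdn1 gtn_eqF ?prime_gt1.
- have E : (map_poly intr (zprimitive F)).[x] = 0.
    apply: val_inj; rewrite rmorph0 rmorph_int_poly /= xE.
    apply/eqP; move: Fz; rewrite /int_root {1}(zpolyEprim F) -mul_polyC rmorphM /= map_polyC.
    rewrite rootE hornerM hornerC mulf_eq0.
    by rewrite (intr_eq0_pchar0 (val_pchar0 p_prime valO npO)) zcontents_eq0 (negPf F0).
  by rewrite /root -rmorph_int_poly E rmorph0.
exists m => //.
by rewrite -xE -rmorphXn -rmorphB -res0 rmorphB rmorphXn /= mE subrr.
Qed.

Hypothesis unram : forall x, x \in O -> x^-1 \in O \/ x / p%:R \in O.

Lemma unram_nonunit x : x \in O -> val_nonunit O x = pdvd p O 1 x.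
Proof.
move=> xO; rewrite /val_nonunit /pdvd expr1.
have [->|x0] := eqVneq x 0; first by rewrite mul0r rpred0.
apply/idP/idP => /= H; first by case: (unram xO) => // xO'; rewrite xO' in H.
apply: contra npO => xO'.
by have := rpredM xO' H; rewrite mulKf.
Qed.

Lemma algebraic_teichmuller z : z \in O -> algebraic z ->
  exists2 m, (0 < m)%N & pdvd p O 1 (z ^+ (p ^ m) - z).
Proof.
move=> zO /(algebraic_residue zO)[m m0 zm]; exists m => //.
by rewrite -unram_nonunit // rpredB ?rpredX.
Qed.

Lemma digit_expansion N z : z \in O -> algebraic z -> forall K,
  exists (tau : nat -> L) m, [/\ (0 < m)%N, forall i, tau i \in O,
    forall i, pdvd p O N (tau i ^+ (p ^ m) - tau i) &
    pdvd p O K (z - \sum_(i < K) p%:R ^+ i * tau i)].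
Proof.
have [f fE] := ex_rat_rmorphism (val_pchar0 p_prime valO npO).
move=> zO algz K; elim: K z zO algz => [|K IH] z zO algz.
  exists (fun=> 0), 1%N; split=> //; first by rewrite rpred0.
    by move=> i; rewrite expr0n gtn_eqF ?expn_gt0 ?prime_gt0 // subr0 pdvd0.
  by rewrite big_ord0 subr0 pdvdO.
have [m m0 mz] := algebraic_teichmuller zO algz.
have [z1 zN] := pdvd_teichmuller p_prime pn0 N zO mz m0.
set t := z ^+ _ in z1 zN; have tO : t \in O by apply: rpredX.
have [y yO yE] := pdvdP pn0 (pdvd_sym z1).
have algy : algebraic y.
  apply/(algebraicE (val_pchar0 p_prime valO npO) f).
  have -> : y = (z - t) / f p%:R by rewrite yE rmorph_nat expr1 mulrAC divff // mul1r.
  have algz' := proj1 (algebraicE (val_pchar0 p_prime valO npO) f z) algz.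
  apply: algebraic_div (algebraic_sub algz' _) (algebraic_id _ _).
  rewrite /t; elim: (p ^ _)%N => [|n IHn]; last by rewrite exprS; apply: algebraic_mul.
  by rewrite expr0 -(rmorph1 f); apply: algebraic_id.
have [tau [l [l0 tauO tauN tauE]]] := IH y yO algy.
exists (fun i => if i is j.+1 then tau j else t), (l * m)%N.
split=> [||[|i]|]; rewrite ?muln_gt0 ?l0 ?m0 //; first by case.
- exact: pdvd_frob.
- by rewrite mulnC; apply: pdvd_frob.
rewrite big_ord_recl expr0 mul1r opprD addrA yE expr1.
rewrite (eq_bigr (fun i : 'I_K => p%:R * (p%:R ^+ i * tau i))); last first.
  by move=> i _; rewrite lift0 exprS mulrA.
by rewrite -mulr_sumr -mulrBr -add1n; apply: pdvdM => //; rewrite /pdvd expr1 divff ?rpred1.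
Qed.

End Digits.

Section Transfer.
Variables (p : nat) (p_prime : prime p).
Variables (L1 L2 : fieldType) (O1 : subringClosed L1) (O2 : subringClosed L2).
Hypothesis valO1 : forall x, (x \in O1) || (x^-1 \in O1).
Hypothesis npO1 : p%:R^-1 \notin O1.
Hypothesis unram : forall x, x \in O1 -> x^-1 \in O1 \/ x / p%:R \in O1.
Hypothesis valO2 : forall x, (x \in O2) || (x^-1 \in O2).
Hypothesis npO2 : p%:R^-1 \notin O2.
Hypothesis mod_roots : forall h : {poly int}, h \is monic -> (1 < size h)%N ->
  exists2 r, r \in O2 & pdvd p O2 1 (map_poly intr h).[r].
Hypothesis fixpoints : forall g, g \is a polyOver O2 ->
  exists2 x, x \in O2 & x = p%:R * g.[x].

Let p1 : p%:R != 0 :> L1 := val_pn0 npO1.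
Let p2 : p%:R != 0 :> L2 := val_pn0 npO2.

Lemma transport_point N m (a1 : nat -> L1) : (0 < N)%N -> (0 < m)%N ->
  (forall i, a1 i \in O1) -> (forall i, (N <= i)%N -> a1 i = 0) ->
  (forall i, pdvd p O1 N (a1 i ^+ (p ^ m) - a1 i)) ->
  exists2 a2 : nat -> L2, (forall i, a2 i \in O2) & forall k t, (k <= N)%N ->
    pdvd p O1 k (ring_eval a1 t) -> pdvd p O2 k (ring_eval a2 t).
Proof.
move=> N0 m0 a1O a1N a1m; have [kappa [res [res0 _]]] := ex_residue_field valO1.
have pk := residue_pchar p_prime npO1 res0.
pose x i : subring_elt O1 := SubringElt (a1O i).
have xE t : val (ring_eval x t) = ring_eval a1 t by rewrite ring_eval_map.
have [||h [k]] := @finite_field_point p p_prime kappa (res \o x) N TOne pk; first by [].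
  by rewrite /= oner_neq0.
set eta := fun i => _ => -[hmon h1 etaP _].
have [r rO hr] := mod_roots hmon h1.
have [ev evE] := int_poly_eval r; rewrite -evE in hr.
have evO g : ev g \in O2.
  by rewrite evE rpred_horner //; apply/polyOverP => i; rewrite coef_rmap rpred_int.
pose b i := if (i < N)%N then ev (eta i) else 0.
have bO i : b i \in O2 by rewrite /b; case: ifP => _; [exact: evO|exact: rpred0].
pose zero_out := term_subst (fun i => if (i < N)%N then TVar i else TZero).
have below t : vars_below N (zero_out t).
  rewrite /vars_below /zero_out; elim: t => //= [i|? IH ? IH'|? IH ? IH'|? IH ? IH'].
  - by case: ifP => // lti; rewrite /= andbT.
  - by rewrite all_cat IH.
  - by rewrite all_cat IH.
  - by rewrite all_cat IH.
have zero_outE (R : comNzRingType) (a : nat -> R) t :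
    (forall i, (N <= i)%N -> a i = 0) -> ring_eval a (zero_out t) = ring_eval a t.
  move=> aN; rewrite ring_eval_subst; congr (ring_eval _ t); apply: funext => i.
  by case: ltnP => // /aN.
have bP t : pdvd p O1 1 (ring_eval a1 t) -> pdvd p O2 1 (ring_eval b t).
  move=> H; have [||u [v E]] := etaP (zero_out t) => //.
    rewrite -ring_eval_map; apply/eqP; rewrite res0 xE zero_outE //.
    by rewrite (unram_nonunit npO1 unram) // ring_eval_in.
  have <- : ev (ring_eval eta (zero_out t)) = ring_eval b t.
    rewrite -(zero_outE _ b) => [|i leNi]; last by rewrite /b ltnNge leNi.
    by rewrite ring_eval_map; apply: (eq_ring_eval (n := N)) => // i lti; rewrite /b lti.
  rewrite E rmorphD !rmorphM rmorph_nat /=; apply: pdvdD.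
    exact: pdvdMl.
  by rewrite mulrC -[p%:R]expr1 pdvd_expM.
have bm i : pdvd p O2 1 (b i ^+ (p ^ m) - b i).
  have := bP (TSub (term_pow (TVar i) (p ^ m)) (TVar i)).
  by rewrite /= !ring_eval_pow /=; apply; apply: pdvdW (a1m i).
have bt i := pdvd_teichmuller p_prime p2 N (bO i) (bm i) m0.
exists (fun i => b i ^+ (p ^ (N * m))) => [i|l t lN]; first exact: rpredX.
apply: (transport p_prime p1 p2 m0 a1O _ a1m) => // [i|i|u /bP H].
- exact: rpredX.
- by have [] := bt i.
have [s sE] := term_frobeniusX p_prime (N * m) u.
rewrite sE; apply: pdvdD.
  by apply: pdvdW (pdvdX (p ^ (N * m)) H) => //; rewrite mul1n expn_gt0 prime_gt0.
by rewrite -[p%:R]expr1 pdvd_expM // ring_eval_in.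
Qed.

Lemma root_transfer (f : {poly rat}) :
  (exists x : L1, root (map_poly ratr f) x) -> exists x : L2, root (map_poly ratr f) x.
Proof.
have [f0 _|f0 [x fx]] := eqVneq f 0.
  by exists 0; rewrite f0 (_ : map_poly _ _ = 0) ?root0 //; apply/polyP => i; rewrite coef_poly
      size_poly0 coef0.
have c1 := val_pchar0 p_prime valO1 npO1; have c2 := val_pchar0 p_prime valO2 npO2.
have [F F0 FE] := ratr_root_int f0; have [G G0 GE] := int_root_scale F0.
set n := lead_coef F in GE; have n0 : n != 0 by rewrite lead_coef_eq0.
have nL1 : n%:~R != 0 :> L1 by rewrite intr_eq0_pchar0.
suff [z Gz] : exists z : L2, int_root G z.
  by exists (z / n%:~R); rewrite FE // -GE // intr_eq0_pchar0.
pose y := x * n%:~R; have Gy : int_root G y by rewrite GE // mulfK // -FE.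
have yO : y \in O1.
  case/orP: (valO1 x) => [xO|xO]; first by rewrite rpredM ?rpred_int.
  have [x0|x0] := eqVneq x 0; first by rewrite /y x0 mul0r rpred0.
  have : (map_poly intr F).[x] = 0 by apply/rootP; rewrite -/(int_root F x) -FE.
  have sF : size (map_poly intr F : {poly L1}) = size F.
    by rewrite size_map_poly_id0 // -/n.
  rewrite horner_coef sF -(@prednK (size F)) ?size_poly_gt0 // big_ord_recr /=.
  rewrite coef_rmap -lead_coefE -/n; set d := (size F).-1 => E.
  have yE : y = - \sum_(i < d) (F`_i)%:~R * x^-1 ^+ (d - i.+1).
    rewrite /y mulrC (_ : n%:~R = n%:~R * x ^+ d * x^-1 ^+ d).
      rewrite (_ : n%:~R * x ^+ d = - \sum_(i < d) (F`_i)%:~R * x ^+ i).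
        rewrite !mulNr !mulr_suml; congr (- _); apply: eq_bigr => i _.
        have -> : x^-1 ^+ d = x^-1 ^+ (d - i.+1) * x^-1 ^+ i.+1.
          by rewrite -exprD subnK.
        by rewrite exprS !exprVn; field; rewrite x0 !expf_neq0.
      apply/eqP; rewrite -subr_eq0 opprK addrC -[X in _ == X]E; apply/eqP; congr (_ + _).
      by apply: eq_bigr => i _; rewrite coef_rmap.
    by rewrite -mulrA -exprMn divff // expr1n mulr1.
  by rewrite yE rpredN rpred_sum // => i _; rewrite rpredM ?rpredX ?rpred_int.
have algy : algebraic y by exists G.
have [M My [MP [a [b [D [D0 abD]]]]]] := min_int_root c1 algy.
suff [z _ Mz] : exists2 z : L2, z \in O2 & (map_poly intr M).[z] = 0.
  by exists z; apply: (MP _ Gy) => //; apply/rootP.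
have [c [d [pd DE]]] : exists c (d : int), ~~ (p %| d)%Z /\ D = p%:Z ^+ c * d.
  have := D0; rewrite -absz_gt0 => /(pfactor_coprime p_prime)[d pd E].
  exists (logn p `|D|), (sgz D * d); split.
    by rewrite dvdzE abszM absz_sg D0 mul1n -prime_coprime.
  by rewrite [D in LHS]intEsg {1}E PoszM -!natz !natrX !natz; ring.
pose N := (2 * c).+1.
have [tau [m [m0 tauO tauN tauE]]] := digit_expansion p_prime valO1 npO1 unram N yO algy N.
pose a1 i := if (i < N)%N then tau i else 0.
have [||||i|a2 a2O tr] := @transport_point N m a1 => //.
- by move=> i; rewrite /a1; case: ifP => // _; apply: rpred0.
- by move=> i; rewrite /a1 ltnNge => ->.
- rewrite /a1; case: ifP => // _.
  by rewrite expr0n gtn_eqF ?expn_gt0 ?prime_gt0 // subrr pdvd0.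
pose s := term_sum (fun i => TMul (term_pow (term_nat p) i) (TVar i)) N.
have a1s : pdvd p O1 N (ring_eval a1 s - y).
  rewrite (_ : ring_eval a1 s = \sum_(i < N) p%:R ^+ i * tau i); first exact: pdvd_sym.
  rewrite ring_eval_sum; apply: eq_bigr => i _.
  by rewrite /= ring_eval_pow ring_eval_nat /a1 ltn_ord.
have a1sO : ring_eval a1 s \in O1.
  by apply: ring_eval_in => i; rewrite /a1; case: ifP => // _; apply: rpred0.
have [tM tME] := term_of_int_poly M s; have [tM' tM'E] := term_of_int_poly M (TVar 0).
have a1M : pdvd p O1 N (ring_eval a1 tM).
  have := @pdvd_ring_eval p L1 O1 N (fun=> ring_eval a1 s) (fun=> y) tM' p1 (fun=> a1sO) (fun=> yO)
      (fun=> a1s).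
  by rewrite !tM'E /= tME (rootP My) subr0.
have := tr N tM (leqnn N) a1M; rewrite tME.
set z := ring_eval a2 s; have zO : z \in O2 by apply: ring_eval_in.
have [ev evE] := int_poly_eval z.
have evO g : ev g \in O2.
  by rewrite evE rpred_horner //; apply/polyOverP => i; rewrite coef_rmap rpred_int.
rewrite -evE => /(pdvdP p2)[r rO rE].
have [d0 dO] := val_int_unit p_prime valO2 npO2 pd.
pose u := 1 + p%:R * (- (p%:R ^+ c * r * ev a * d%:~R^-1)) : L2.
have [|u0 uO] := @val_unit1p p L2 O2 valO2 npO2 (- (p%:R ^+ c * r * ev a * d%:~R^-1)).
  by rewrite rpredN !rpredM ?rpredX ?rpred_nat.
rewrite -/u in u0 uO.
have bE : ev b * ev M^`() = p%:R ^+ c * (d%:~R * u).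
  have := congr1 ev abD; rewrite rmorphD !rmorphM /= rE.
  rewrite [ev D%:P]evE map_polyC hornerC /= DE rmorphM rmorphXn /= -pmulrn => E.
  rewrite -(addKr (ev a * (p%:R ^+ N * r)) (ev b * _)) E /u /N exprS mulnC exprM expr2; field.
  by rewrite d0.
have dev : (map_poly intr M)^`().[z] = ev M^`() by rewrite evE deriv_map.
apply: (@newton _ O2 p%:R (rpred_nat _ _) fixpoints _ z ((ev b * (d%:~R^-1 * u^-1)) ^+ 2 * r)) => //.
- by apply/polyOverP => i; rewrite coef_rmap rpred_int.
- by rewrite rpredM ?rpredX ?rpredM.
rewrite dev -evE rE.
transitivity ((ev b * ev M^`()) ^+ 2 * (d%:~R^-1 * u^-1) ^+ 2 * p%:R * r); last by ring.
by rewrite bE /N exprS mulnC exprM expr2; field; rewrite u0 d0.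
Qed.

End Transfer.

(** * Decidability of the set of polynomials with a zero *)

Lemma ex_subring (L : fieldType) (P : L -> Prop) :
  P 1 -> (forall x y, P x -> P y -> P (x - y)) -> (forall x y, P x -> P y -> P (x * y)) ->
  exists O : subringClosed L, forall x, (x \in O) <-> P x.
Proof.
move=> P1 PB PM; pose O : {pred L} := fun x => `[< P x >].
have closed : subring_closed O.
  split=> [|x y|x y]; rewrite !unfold_in => *; try exact/asboolP.
    by apply/asboolP/PB; apply/asboolP.
  by apply/asboolP/PM; apply/asboolP.
pose B := GRing.isSubringClosed.Build L O closed.
pose O' : subringClosed L := HB.pack O B.
exists O' => x; split=> [/asboolP //|Px]; exact/asboolP.
Qed.

Lemma ex_subfield (L : fieldType) (P : L -> Prop) :
  P 1 -> (forall x y, P x -> P y -> P (x - y)) ->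
  (forall x y, P x -> P y -> y != 0 -> P (x / y)) ->
  exists S : divringClosed L, forall x, (x \in S) <-> P x.
Proof.
move=> P1 PB PD; pose O : {pred L} := fun x => `[< P x >].
have P0 : P 0 by rewrite -(subrr 1); apply: PB.
have closed : divring_closed O.
  split=> [|x y|x y]; rewrite !unfold_in => *; try exact/asboolP.
    by apply/asboolP/PB; apply/asboolP.
  have [->|y0] := eqVneq y 0; first by rewrite invr0 mulr0; apply/asboolP.
  by apply/asboolP/PD => //; apply/asboolP.
pose B := GRing.isDivringClosed.Build L O closed.
pose O' : divringClosed L := HB.pack O B.
exists O' => x; split=> [/asboolP //|Px]; exact/asboolP.
Qed.

Section Subfield.
Variables (L : fieldType) (S : divringClosed L).
Record subfield_elt := SubfieldElt { subfield_val : L; _ : subfield_val \in S }.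
HB.instance Definition _ := [isSub for subfield_val].
HB.instance Definition _ := [Choice of subfield_elt by <:].
HB.instance Definition _ := [SubChoice_isSubComUnitRing of subfield_elt by <:].
HB.instance Definition _ := [SubComUnitRing_isSubIntegralDomain of subfield_elt by <:].
HB.instance Definition _ := [SubIntegralDomain_isSubField of subfield_elt by <:].

Lemma subfield_valP (x : subfield_elt) : val x \in S. Proof. exact: valP. Qed.
End Subfield.

Section RatPolyTheory.
Let x := EVar 0.
Let y := EVar 1.
Let z := EVar 2.
Let u := EVar 3.
Let eO := etag1 6.
Let eCP := etag2 8.
Let eRC := etag1 9.
Let eOK := etag1 10.
Let eZZ := etag1 8.
Let eVQ := etag2 9.
Let eHV := etag2 10.
Let eR := etag1 11.
Let eCl := etag1 12.
Let eVT := etag2 13.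
Let eX := etag1 14.

Definition subring_th : seq clause :=
  [:: [:: nlit (eEq x y); nlit (eO x); plit (eO y)];
      [:: plit (eO eOne)];
      [:: nlit (eO x); nlit (eO y); plit (eO (eSub x y))];
      [:: nlit (eO x); nlit (eO y); plit (eO (eMul x y))]].

Definition valuation_th p : seq clause :=
  [:: [:: plit (eO x); plit (eO (eInv x))];
      [:: nlit (eO (eInv (eNum (ECst p))))]].

Definition rat_poly_th : seq clause :=
  [:: [:: plit (eEq (eZZ (EAdd x x)) (eNum x))];
      [:: plit (eEq (eZZ (ESucc (EAdd x x))) (eSub eZero (eNum (ESucc x))))];
      [:: plit (eEq (eVQ x (ECst 0)) eZero)];
      [:: plit (eEq (eVQ x (econs (EPair y z) u))
            (eAdd (eMul (eVQ x u) x) (eMul (eZZ y) (eInv (eZZ z)))))]].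

(* Coprimality by subtractive Euclid, then reduced fractions, then lists of
   reduced fractions with nonzero last entry. *)
Definition rat_code_th : seq clause :=
  [:: [:: nlit (eCP x y); plit (eCP y x)];
      [:: plit (eCP (ECst 0) (ECst 1))];
      [:: nlit (eCP (ECst 0) (ECst 0))];
      [:: nlit (eCP (ECst 0) (ESucc (ESucc x)))];
      [:: nlit (eCP x (EAdd x y)); plit (eCP x y)];
      [:: nlit (eCP x y); plit (eCP x (EAdd x y))];
      [:: nlit (eRC (EPair (EAdd x x) (EAdd (ESucc y) (ESucc y)))); plit (eCP x (ESucc y))];
      [:: nlit (eCP x (ESucc y)); plit (eRC (EPair (EAdd x x) (EAdd (ESucc y) (ESucc y))))];
      [:: nlit (eRC (EPair (ESucc (EAdd x x)) (EAdd (ESucc y) (ESucc y))));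
          plit (eCP (ESucc x) (ESucc y))];
      [:: nlit (eCP (ESucc x) (ESucc y));
          plit (eRC (EPair (ESucc (EAdd x x)) (EAdd (ESucc y) (ESucc y))))];
      [:: nlit (eRC (EPair x (ECst 0)))];
      [:: nlit (eRC (EPair x (ESucc (EAdd y y))))];
      [:: plit (eOK (ECst 0))];
      [:: nlit (eOK (econs x (ESucc y))); plit (eRC x)];
      [:: nlit (eOK (econs x (ESucc y))); plit (eOK (ESucc y))];
      [:: nlit (eRC x); nlit (eOK (ESucc y)); plit (eOK (econs x (ESucc y)))];
      [:: nlit (eOK (econs (EPair (ESucc x) y) (ECst 0))); plit (eRC (EPair (ESucc x) y))];
      [:: nlit (eRC (EPair (ESucc x) y)); plit (eOK (econs (EPair (ESucc x) y) (ECst 0)))];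
      [:: nlit (eOK (econs (EPair (ECst 0) y) (ECst 0)))]].

Definition valued_field_th p :=
  field_th ++ num_th ++ subring_th ++ valuation_th p ++ rat_poly_th ++ rat_code_th.

Definition zero_th p : seq clause :=
  valued_field_th p ++
  [:: [:: nlit (eO x); plit (eO (eInv x)); plit (eO (eMul x (eInv (eNum (ECst p)))))];
      [:: plit (eOK EIn)];
      [:: plit (eEq (eVQ (etag1 0 (ECst 0)) EIn) eZero)]].

(* [eR] names a root modulo p of the monic polynomial with code [x], and [eX]
   the fixed point of p times the polynomial whose coefficients are listed by
   [x], after replacing those that are not integral by 0. *)
Definition henselian_th p : seq clause :=
  [:: [:: plit (eEq (eHV x (ECst 0)) eOne)];
      [:: plit (eEq (eHV x (econs y z)) (eAdd (eMul (eHV x z) x) (eNum y)))];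
      [:: plit (eO (eR x))];
      [:: plit (eO (eMul (eHV (eR (ESucc x)) (ESucc x)) (eInv (eNum (ECst p)))))];
      [:: nlit (eO x); plit (eEq (eCl x) x)];
      [:: plit (eO (eCl x))];
      [:: plit (eEq (eVT x (ECst 0)) eZero)];
      [:: plit (eEq (eVT x (econs y z)) (eAdd (eMul (eVT x z) x) (eCl y)))];
      [:: plit (eO (eX x))];
      [:: plit (eEq (eX x) (eMul (eNum (ECst p)) (eVT (eX x) x)))]].

Definition no_zero_th p : seq clause :=
  valued_field_th p ++ henselian_th p ++
  [:: [:: nlit (eOK EIn); nlit (eEq (eVQ x EIn) eZero)]].

End RatPolyTheory.

Definition is_rat_code n := exists q, rat_code q = n.
Definition is_poly_code n := exists f, poly_code f = n.

Lemma rat_code_evenP x y : is_rat_code (pair_code (x + x) (y.+1 + y.+1)) <-> coprime x y.+1.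
Proof.
split=> [[q /pair_code_inj[nE dE]]|cxy].
  have := coprime_num_den q; have := denq_gt0 q.
  case: (denq q) dE => //= d dE _; case: (numq q) nE => //= n nE.
    by rewrite (_ : n = x) 1?(_ : d = y.+1) //; lia.
  by exfalso; lia.
exists (x%:Q / y.+1%:Q); rewrite /rat_code.
have c : coprimez x%:Z y.+1%:Z by [].
by rewrite (coprimeq_num c) (coprimeq_den c) /= ?mul1n /= ?addnn.
Qed.

Lemma rat_code_oddP x y :
  is_rat_code (pair_code (x + x).+1 (y.+1 + y.+1)) <-> coprime x.+1 y.+1.
Proof.
split=> [[q /pair_code_inj[nE dE]]|cxy].
  have := coprime_num_den q; have := denq_gt0 q.
  case: (denq q) dE => //= d dE _; case: (numq q) nE => //= n nE.
    by exfalso; lia.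
  by rewrite (_ : n = x) 1?(_ : d = y.+1) //; lia.
exists ((Negz x)%:Q / y.+1%:Q); rewrite /rat_code.
have c : coprimez (Negz x) y.+1%:Z by [].
by rewrite (coprimeq_num c) (coprimeq_den c) (_ : _ * Negz x = Negz x) //= ?addnn // mul1r.
Qed.

Lemma rat_code_den0 x : ~ is_rat_code (pair_code x 0).
Proof.
by move=> [q /pair_code_inj[_]]; have := denq_gt0 q; case: (denq q) => [[|n]|n].
Qed.

Lemma rat_code_odd_den x y : ~ is_rat_code (pair_code x (y + y).+1).
Proof.
move=> [q /pair_code_inj[_]]; have := denq_gt0 q; case: (denq q) => //= n _; lia.
Qed.

Lemma poly_code_cons x y : is_poly_code (pair_code x y.+1).+1 <-> is_rat_code x /\ is_poly_code y.+1.
Proof.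
rewrite /is_poly_code /poly_code; split=> [[f]|[[q qx] [f fy]]].
  case E: (polyseq f) => [//|c s] /= [/pair_code_inj[<- sE]]; split; first by exists c.
  have lastN0 : last 1 s != 0.
    by have := valP f; rewrite /= E /=; case: (s) sE.
  by exists (Polynomial lastN0).
exists (cons_poly q f); rewrite polyseq_cons.
by case: (polyseq f) fy => //= c s <-; rewrite qx.
Qed.

Lemma poly_code_last x y : is_poly_code (pair_code (pair_code x y) 0).+1 <->
  x != 0%N /\ is_rat_code (pair_code x y).
Proof.
rewrite /is_poly_code /poly_code; split=> [[f]|[x0 [q qE]]].
  case E: (polyseq f) => [//|c [|? ?]] /= [/pair_code_inj[cE]] // _; split; last by exists c.
  have := valP f; rewrite /= E /= -numq_eq0; case/pair_code_inj: cE => <- _.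
  by case: (numq c) => [[|]|].
have q0 : q != 0.
  rewrite -numq_eq0; case/pair_code_inj: qE x0 => <- _.
  by apply: contraNneq => ->.
by exists q%:P; rewrite polyseqC q0 /= qE.
Qed.

Definition int_decode n : int := if odd n then Negz n./2 else n./2%:Z.

Lemma int_codeK : cancel int_code int_decode.
Proof. by case=> n; rewrite /int_decode /= odd_double ?uphalf_double ?doubleK. Qed.

Lemma int_decode_double n : int_decode (n + n) = n.
Proof. by rewrite /int_decode addnn odd_double doubleK. Qed.

Lemma int_decode_doubleS n : int_decode (n + n).+1 = Negz n.
Proof. by rewrite /int_decode addnn /= odd_double uphalf_double. Qed.

Definition frac_decode (L : fieldType) n : L :=
  (int_decode (fst_code n))%:~R / (int_decode (snd_code n))%:~R.

Lemma frac_decodeE (L : fieldType) q : frac_decode L (rat_code q) = ratr q.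
Proof. by rewrite /frac_decode pairK1 pairK2 !int_codeK. Qed.

Lemma horner_poly_code (L : fieldType) (f : {poly rat}) (x : L) :
  horner_rec [seq frac_decode L c | c <- unseq (poly_code f)] x = (map_poly ratr f).[x].
Proof.
rewrite unseqK -map_comp map_polyE horner_Poly; congr horner_rec.
by apply: eq_map => q; rewrite /= frac_decodeE.
Qed.

Lemma coprime_th_model (C : nat -> nat -> Prop) :
  (forall x y, C x y -> C y x) -> C 0%N 1%N -> ~ C 0%N 0%N -> (forall y, ~ C 0%N y.+2) ->
  (forall x y, C x (x + y)%N <-> C x y) -> forall x y, C x y <-> coprime x y.
Proof.
move=> Csym C01 C00 C02 CD x y.
have [n] := ubnP (x + y); elim: n x y => // n IH x y lt.
have C0 z : C 0%N z <-> coprime 0 z.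
  by rewrite /coprime gcd0n; case: z => [|[|z]]; split=> // /C02.
case: x lt => [|x] lt; first exact: C0.
case: y lt => [|y] lt; first by rewrite coprime_sym -C0; split; apply: Csym.
have [le|/ltnW le] := leqP x y.
  rewrite -(subnKC le) -addSn CD IH; last by lia.
  by rewrite /coprime gcdnDl.
have -> : C x.+1 y.+1 <-> C y.+1 x.+1 by split; apply: Csym.
rewrite -(subnKC le) -addSn CD IH; last by lia.
by rewrite [X in _ <-> is_true X]coprime_sym /coprime gcdnDl.
Qed.

Section Theories.
Variables (p : nat) (p_prime : prime p).

Lemma valued_field_th_model a w S : holds a w S (valued_field_th p) ->
  exists (L : fieldType) (val : nat -> L) (O : subringClosed L),
  [/\ interprets val, eq_interp val S, forall x, exists t, val t = x,
    forall t, (val t \in O) <-> S (pair_code 6 t) &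
    [/\ forall n, val (pair_code 7 n) = n%:R,
      forall x, (x \in O) || (x^-1 \in O),
      p%:R^-1 \notin O,
      forall t f, val (pair_code 9 (pair_code t (poly_code f))) = (map_poly ratr f).[val t] &
      forall n, S (pair_code 10 n) <-> is_poly_code n]].
Proof.
move=> /holds_cat[Hf /holds_cat[Hn /holds_cat[Hr /holds_cat[Hv /holds_cat[Hp Hc]]]]].
have [L [val [vI SE surj]]] := field_th_model Hf; exists L, val.
have vN := num_interp vI SE Hn; have [v_0 v_1 [vD vB vM vV]] := vI.
have rr i x y : (i < 4)%N -> clause_holds a w S (nth 0%N [:: x; y]) (nth [::] subring_th i).
  by move=> lti; apply: holds_nth Hr lti.
have rv i x : (i < 2)%N -> clause_holds a w S (nth 0%N [:: x]) (nth [::] (valuation_th p) i).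
  by move=> lti; apply: holds_nth Hv lti.
have rp i x y z u : (i < 4)%N ->
    clause_holds a w S (nth 0%N [:: x; y; z; u]) (nth [::] rat_poly_th i).
  by move=> lti; apply: holds_nth Hp lti.
have rc i x y : (i < 19)%N -> clause_holds a w S (nth 0%N [:: x; y]) (nth [::] rat_code_th i).
  by move=> lti; apply: holds_nth Hc lti.
pose P (x : L) := exists2 t, val t = x & S (pair_code 6 t).
have PE t : P (val t) <-> S (pair_code 6 t).
  split=> [[u ut Ou]|Ot]; last by exists t.
  by have := rr 0%N u t isT; rewrite /= SE => /(_ ut Ou).
have [|_ _ [t <- Ot] [u <- Ou]|_ _ [t <- Ot] [u <- Ou]|O OP] := @ex_subring L P.
- by rewrite -v_1; apply/PE; exact: (rr 1%N 0%N 0%N isT).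
- by rewrite -vB; apply/PE; apply: (rr 2 t u isT).
- by rewrite -vM; apply/PE; apply: (rr 3 t u isT).
have OE t : (val t \in O) <-> S (pair_code 6 t) by rewrite OP.
exists O; split=> //; split=> // [x||t f|].
- have [t <-] := surj x; rewrite -vV; apply/orP.
  by case: (rv 0%N t isT) => H; [left|right]; apply/OE.
- by apply/negP; rewrite -vN -vV => /OE; exact: (rv 1%N 0%N isT).
- have ZZ z : val (pair_code 8 z) = (int_decode z)%:~R.
    rewrite -(odd_double_half z); case: (odd z); rewrite ?add1n ?add0n -addnn.
      rewrite int_decode_doubleS; have := rp 1%N z./2 0%N 0%N 0%N isT.
      by rewrite /= SE vB v_0 vN sub0r NegzE mulrNz.
    by rewrite int_decode_double; have := rp 0%N z./2 0%N 0%N 0%N isT; rewrite /= SE vN.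
  rewrite -horner_poly_code; set c := poly_code f; have [s ->] := seq_code_surj c.
  rewrite unseqK; elim: s => [|n s IH] /=.
    by have := rp 2 t 0%N 0%N 0%N isT; rewrite /= SE v_0.
  have := rp 3 t (fst_code n) (snd_code n) (seq_code s) isT.
  by rewrite /= SE unpairK vD !vM vV !ZZ IH.
have CP x y : S (pair_code 8 (pair_code x y)) <-> coprime x y.
  apply: (coprime_th_model (C := fun x y => S (pair_code 8 (pair_code x y)))) => [m n|||n|m n].
  - exact: (rc 0%N m n isT).
  - exact: (rc 1%N 0%N 0%N isT).
  - exact: (rc 2 0%N 0%N isT).
  - exact: (rc 3 n 0%N isT).
  - by have := rc 4 m n isT; have := rc 5 m n isT; rewrite /=; tauto.
have RC n : S (pair_code 9 n) <-> is_rat_code n.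
  rewrite -(unpairK n); move: (fst_code n) (snd_code n) => {}n d.
  rewrite -(odd_double_half d); case: (odd d); rewrite ?add1n ?add0n -addnn.
    by split=> [/(rc 11 n d./2 isT)|/rat_code_odd_den].
  case: d./2 => [|{}d]; first by split=> [/(rc 10 n 0%N isT)|/rat_code_den0].
  rewrite -(odd_double_half n); case: (odd n); rewrite ?add1n ?add0n -addnn; move: n./2 => {}n.
    rewrite rat_code_oddP -CP; have := rc 8 n d isT; have := rc 9 n d isT.
    by rewrite /=; tauto.
  rewrite rat_code_evenP -CP; have := rc 6 n d isT; have := rc 7 n d isT.
  by rewrite /=; tauto.
move=> n; have [s ->] := seq_code_surj n; elim: s => [|c [|c' s] IH].
- split=> _; last exact: (rc 12 0%N 0%N isT).
  by exists 0; rewrite /poly_code polyseq0.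
- rewrite /= -(unpairK c) poly_code_last -RC.
  case: (fst_code c) => [|m]; first by split=> [/(rc 18 0%N (snd_code c) isT)|[]].
  have := rc 16 m (snd_code c) isT; have := rc 17 m (snd_code c) isT.
  by rewrite /= => H1 H2; split=> [/H2|[_ /H1]].
rewrite [seq_code _]/= poly_code_cons -RC -IH /=.
have := rc 13 c (pair_code c' (seq_code s)) isT.
have := rc 14 c (pair_code c' (seq_code s)) isT.
have := rc 15 c (pair_code c' (seq_code s)) isT.
by rewrite /=; tauto.
Qed.

Lemma mem_unseq_lt t n : t \in unseq n -> (t < n)%N.
Proof.
have [s ->] := seq_code_surj n; rewrite unseqK; elim: s => //= c s IH.
rewrite inE ltnS => /predU1P[->|/IH lt]; first exact: leq_pair1.
exact: ltnW (leq_trans lt (leq_pair2 _ _)).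
Qed.

Section Valued.
Variables (K : fieldType) (O : subringClosed K).
Hypothesis valO : forall x, (x \in O) || (x^-1 \in O).
Hypothesis npO : p%:R^-1 \notin O.

Lemma valued_field_th_sound a w (e : nat -> K) (G : nat -> nat -> (nat -> K) -> K) :
  exists (val : nat -> K) (S : nat -> Prop),
  [/\ interprets val, eq_interp val S, holds a w S (valued_field_th p),
      forall i, val (pair_code 0 i) = e i &
      [/\ forall n, val (pair_code 7 n) = n%:R,
        forall k m, val (pair_code (10 + k) m) =
          G k m (fun j => if (j < pair_code (10 + k) m)%N then val j else 0),
        forall t, S (pair_code 6 t) = (val t \in O),
        forall t f, val (pair_code 9 (pair_code t (poly_code f))) = (map_poly ratr f).[val t] &
        forall n, S (pair_code 10 n) = is_poly_code n]].
Proof.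
have [val [vI v0 v7 v8]] := ex_interpretation e (fun k m f => match k with
  | 0%N => (int_decode m)%:~R
  | 1%N => horner_rec [seq frac_decode K c | c <- unseq (snd_code m)] (f (fst_code m))
  | k.+2 => G k m f end).
have [S [SE _ SQ]] := ex_truth a w val (fun k m => match k with
  | 6 => val m \in O : Prop | 8 => coprime (fst_code m) (snd_code m) : Prop
  | 9 => is_rat_code m | _ => is_poly_code m end).
exists val, S; have [v_0 v_1 [vD vB vM vV]] := vI.
have SO t : S (pair_code 6 t) = (val t \in O) by rewrite SQ.
have ZZ z : val (pair_code 8 z) = (int_decode z)%:~R := v8 0%N z.
have VQ t c : val (pair_code 9 (pair_code t c)) =
    horner_rec [seq frac_decode K c | c <- unseq c] (val t).
  by rewrite (v8 1%N) pairK1 pairK2 ltn_code1.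
have CP x y : S (pair_code 8 (pair_code x y)) = coprime x y by rewrite SQ // pairK1 pairK2.
have RC n : S (pair_code 9 n) = is_rat_code n by rewrite SQ.
have OK n : S (pair_code 10 n) = is_poly_code n by rewrite SQ.
split=> //; last first.
  by split=> // [k m|t f]; [exact: (v8 k.+2)|rewrite VQ horner_poly_code].
apply/holds_cat; split; first exact: field_th_sound vI SE.
apply/holds_cat; split; first exact: num_th_sound vI SE v7.
apply/holds_cat; split.
  do ![split] => //= env; rewrite ?SE ?SO ?vB ?vM ?v_1; first by move=> ->.
  - exact: rpred1.
  - exact: rpredB.
  - exact: rpredM.
apply/holds_cat; split.
  do ![split] => //= env; rewrite ?SO ?vV ?v7; last exact/negP.
  exact/orP.
apply/holds_cat; split.
  do ![split] => //= env; rewrite ?SE ?vD ?vB ?vM ?vV ?ZZ ?VQ ?v_0 ?v7.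
  - by rewrite int_decode_double.
  - by rewrite int_decode_doubleS NegzE mulrNz sub0r.
  - by [].
  - by rewrite unseq_cons /= /frac_decode pairK1 pairK2.
do ![split] => //= env; rewrite ?CP ?RC ?OK.
- by rewrite coprime_sym.
- by [].
- by [].
- by rewrite /coprime gcd0n.
- by rewrite /coprime gcdnDl.
- by rewrite /coprime gcdnDl.
- by rewrite addSn rat_code_evenP.
- by rewrite addSn rat_code_evenP.
- by rewrite addSn rat_code_oddP.
- by rewrite addSn rat_code_oddP.
- exact: rat_code_den0.
- exact: rat_code_odd_den.
- by exists 0; rewrite /poly_code polyseq0.
- by rewrite poly_code_cons => -[].
- by rewrite poly_code_cons => -[].
- by rewrite poly_code_cons.
- by rewrite poly_code_last => -[].
- by rewrite poly_code_last.
- by rewrite poly_code_last => -[].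
Qed.
End Valued.

Lemma henselian_th_model a w (L : fieldType) (val : nat -> L) (O : subringClosed L) S :
  interprets val -> eq_interp val S -> (forall x, exists t, val t = x) ->
  (forall t, (val t \in O) <-> S (pair_code 6 t)) -> (forall n, val (pair_code 7 n) = n%:R) ->
  p%:R != 0 :> L -> holds a w S (henselian_th p) ->
  (forall h : {poly int}, h \is monic -> (1 < size h)%N ->
    exists2 r, r \in O & pdvd p O 1 (map_poly intr h).[r]) /\
  (forall g, g \is a polyOver O -> exists2 x, x \in O & x = p%:R * g.[x]).
Proof.
move=> [v_0 v_1 [vD vB vM vV]] SE surj OE vN pn0 H.
have rule i x y z : (i < 10)%N ->
    clause_holds a w S (nth 0%N [:: x; y; z]) (nth [::] (henselian_th p) i).
  by move=> lti; apply: holds_nth H lti.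
split=> [h hmon h1|g gO].
  have [[|c s] [b [s0 hE]]] := monic_poly_modp (prime_gt0 p_prime) hmon h1; first by [].
  pose l := pair_code c (seq_code s); pose r := pair_code 11 l.+1.
  have rO : val r \in O by apply/OE; exact: (rule 2 l.+1 0%N 0%N isT).
  exists (val r) => //; have [ev evE] := int_poly_eval (val r).
  have HV t : val (pair_code 10 (pair_code r (seq_code t))) = ev (monic_poly t).
    elim: t => [|m t IH] /=; first by have := rule 0%N r 0%N 0%N isT; rewrite /= SE v_1 rmorph1.
    have := rule 1%N r m (seq_code t) isT; rewrite /= SE vD vM IH vN => ->.
    rewrite rmorphD rmorphM /= [ev 'X]evE map_polyX hornerX.
    by rewrite [ev _%:P]evE map_polyC hornerC /=.
  rewrite -evE hE rmorphD rmorphM rmorph_nat /= -(HV (c :: s)); apply: pdvdD.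
    by have := rule 3 l 0%N 0%N isT; rewrite /= => /OE; rewrite vM vV vN /pdvd expr1.
  rewrite /= mulrC -[p%:R]expr1 pdvd_expM // evE rpred_horner //.
  by apply/polyOverP => i; rewrite coef_rmap rpred_int.
have [c cE] : exists c, [seq val t | t <- c] = g.
  elim: (polyseq g) => [|x s [c <-]]; first by exists [::].
  by have [t <-] := surj x; exists (t :: c).
pose x := pair_code 14 (seq_code c).
have xO : val x \in O by apply/OE; exact: (rule 8 (seq_code c) 0%N 0%N isT).
exists (val x) => //; have := rule 9 (seq_code c) 0%N 0%N isT.
rewrite /= SE vM vN => {1}->; congr (_ * _).
rewrite /horner -cE; have : all (mem O) [seq val t | t <- c].
  by rewrite cE; apply/allP => y /(nthP 0)[i _ <-]; have /polyOverP/(_ i) := gO.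

rewrite -/x; move: (x) => y; elim: c {cE x xO} => [|t c IH] /=.
  by have := rule 6 y 0%N 0%N isT; rewrite /= SE v_0.
case/andP=> tO cO; have := rule 7 y t (seq_code c) isT; rewrite /= SE vD vM IH // => ->.
congr (_ + _); have := rule 4 t 0%N 0%N isT; rewrite /= SE; apply.
by apply/OE.
Qed.

Lemma decidable_zero_polys (E : fieldType) (O : subringClosed E) :
  (forall x, (x \in O) || (x^-1 \in O)) -> p%:R^-1 \notin O ->
  (forall h : {poly int}, h \is monic -> (1 < size h)%N ->
    exists2 r, r \in O & pdvd p O 1 (map_poly intr h).[r]) ->
  (forall g, g \is a polyOver O -> exists2 x, x \in O & x = p%:R * g.[x]) ->
  (forall x, x \in O -> algebraic x -> x^-1 \in O \/ x / p%:R \in O) ->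
  decidable_polys (has_zero_in E).
Proof.
move=> valO npO mod_roots fixpoints unram.
have char0 := val_pchar0 p_prime valO npO; have pn0 := val_pn0 npO.
have [phi phiE] := ex_rat_rmorphism char0.
have algE z := algebraicE char0 phi z.
have [A AP] : exists A : divringClosed E, forall x, (x \in A) <-> algebraic x.
  apply: ex_subfield => [|x y|x y]; rewrite ?algE.
  - by rewrite -(rmorph1 phi); apply: algebraic_id.
  - exact: algebraic_sub.
  - by move=> ax ay _; apply: algebraic_div.
pose K := subfield_elt A; pose incl : {rmorphism K -> E} := val.
have [OK OKP] : exists OK : subringClosed K, forall x, (x \in OK) <-> (incl x \in O).
  apply: ex_subring => [|x y|x y].
  - by rewrite rmorph1 rpred1.
  - by rewrite rmorphB; apply: rpredB.
  - by rewrite rmorphM; apply: rpredM.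
have valOK x : (x \in OK) || (x^-1 \in OK).
  by have /orP[H|H] := valO (incl x); apply/orP; [left|right]; apply/OKP; rewrite ?fmorphV.
have npOK : p%:R^-1 \notin OK.
  by apply/negP => /OKP; rewrite fmorphV rmorph_nat (negPf npO).
have unramK x : x \in OK -> x^-1 \in OK \/ x / p%:R \in OK.
  move=> /OKP xO; rewrite !OKP fmorphV fmorph_div rmorph_nat.
  by apply: unram xO _; apply/AP/subfield_valP.
have inclE f : map_poly incl (map_poly ratr f) = map_poly ratr f.
  have ratr0 (F : fieldType) : ratr 0 = 0 :> F by rewrite /ratr mul0r.
  by apply/polyP => i; rewrite coef_rmap !coef_map_id0 ?ratr0 // fmorph_rat.
have zeroK f : has_zero_in E f <-> exists x : K, root (map_poly ratr f) x.
  split=> [[z fz]|[z fz]]; last first.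
    by exists (incl z); rewrite -inclE fmorph_root.
  have [f0|f0] := eqVneq f 0.
    by exists 0; rewrite f0 (_ : map_poly _ _ = 0) ?root0 //; apply/polyP => i;
      rewrite coef_poly size_poly0 coef0.
  have [F F0 FE] := ratr_root_int f0.
  have zA : z \in A by apply/AP; exists F => //; rewrite -FE.
  by exists (SubfieldElt zA); rewrite -(fmorph_root incl) inclE.
apply: (decidable_by_refutation (P := no_zero_th p) (N := zero_th p)) => a.
  split=> [[f /zeroK fz fa]|[w /unsatP un]].
    exists 0%N; apply/unsatP => S /holds_cat[/valued_field_th_model[L [val [O2 []]]]].
    move=> vI SE surj OE [vN valO2 npO2 VQ SOK] /holds_cat[H [/= noroot _]].
    have [] := henselian_th_model vI SE surj OE vN (val_pn0 npO2) H.
    move=> mod_roots2 fixpoints2.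
    have [x fx] := root_transfer p_prime valOK npOK unramK valO2 npO2 mod_roots2 fixpoints2 fz.
    have [t tx] := surj x; have [v_0 _ _] := vI.
    apply: (noroot (fun=> t)); first by apply/SOK; exists f.
    by rewrite /= SE v_0 -fa VQ tx; apply/rootP.
  apply: contrapT => nD.
  pose cl (x : E) := if x \in O then x else 0.
  have clO x : cl x \in O by rewrite /cl; case: ifP => // _; apply: rpred0.
  have /choice[r rP] (c : nat) : exists r, r \in O /\
      ((0 < c)%N -> pdvd p O 1 (map_poly intr (monic_poly (unseq c))).[r]).
    have [l cE] := seq_code_surj c; rewrite cE unseqK.
    have [lmon lsz] := monic_monic_poly l; case: l lmon lsz cE => [|b l] lmon lsz cE.
      by exists 0; split=> //; apply: rpred0.
    by have [|x xO xr] := mod_roots _ lmon; rewrite ?lsz //; exists x.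
  have /choice[s sP] (l : seq E) : exists s, s \in O /\ s = p%:R * horner_rec (map cl l) s.
    have [|x xO xE] := fixpoints (Poly (map cl l)).
      apply/polyOverP => i; rewrite coef_Poly; have [lt|le] := ltnP i (size l).
        by rewrite (nth_map 0).
      by rewrite nth_default ?size_map // rpred0.
    by exists x; split=> //; rewrite {1}xE horner_Poly.
  have [val [S [vI SE H _ [v7 v8 SO VQ SOK]]]] :=
    valued_field_th_sound valO npO a w (fun=> 0) (fun k m f => match k with
      | 0%N => (map_poly intr (monic_poly (unseq (snd_code m)))).[f (fst_code m)]
      | 1%N => r m | 2 => cl (f m)
      | 3 => horner_rec [seq cl (f t) | t <- unseq (snd_code m)] (f (fst_code m))
      | _ => s [seq f t | t <- unseq m] end).
  have [v_0 v_1 [vD _ vM vV]] := vI.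
  have HV x c : val (pair_code 10 (pair_code x c)) =
      (map_poly intr (monic_poly (unseq c))).[val x].
    by rewrite (v8 0%N) pairK1 pairK2 ltn_code1.
  have RR c : val (pair_code 11 c) = r c := v8 1%N c.
  have CL t : val (pair_code 12 t) = cl (val t) by rewrite (v8 2) ltn_pair2.
  have VT x c : val (pair_code 13 (pair_code x c)) =
      horner_rec [seq cl (val t) | t <- unseq c] (val x).
    rewrite (v8 3) pairK1 pairK2 ltn_code1 //; congr horner_rec; apply/eq_in_map => t tc.
    by rewrite (ltn_trans (mem_unseq_lt tc)) // ltn_code2.
  have XX c : val (pair_code 14 c) = s [seq val t | t <- unseq c].
    rewrite (v8 4); congr s; apply/eq_in_map => t tc.
    by rewrite (ltn_trans (mem_unseq_lt tc)) // ltn_pair2.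
  apply: (un S); apply/holds_cat; split=> //; apply/holds_cat; split; last first.
    split=> // env; rewrite /= SOK SE v_0 => -[f fa]; rewrite -fa VQ => fx.
    by apply: nD; exists f => //; exists (val (env 0%N)); apply/rootP.
  have unseq0 : unseq 0 = [::] by [].
  do ![split] => //= env; rewrite ?SE ?SO ?vD ?vM ?vV ?v_0 ?v_1 ?HV ?RR ?CL ?VT ?XX ?v7 ?unseq0
      ?unseq_cons /=.
  - by rewrite rmorph1 hornerC.
  - have [ev evE] := int_poly_eval (val (env 0%N)).
    by rewrite -!evE rmorphD rmorphM /= [ev 'X]evE map_polyX hornerX [ev _%:P]evE map_polyC hornerC.
  - by have [] := rP (env 0%N).
  - by have [_ /(_ isT)] := rP (env 0%N).+1; rewrite /pdvd expr1.
  - by rewrite /cl => ->.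
  - exact: clO.
  - by [].
  - by [].
  - by have [] := sP [seq val t | t <- unseq (env 0%N)].
  - by have [_] := sP [seq val t | t <- unseq (env 0%N)]; rewrite -map_comp.
split=> [nD|[w /unsatP un] [f /zeroK[z fz] fa]].
  exists 0%N; apply/unsatP => S /holds_cat[/valued_field_th_model[L [val [O2 []]]]].
  move=> vI SE surj OE [vN valO2 npO2 VQ SOK] [/= H1 [/= H2 [/= H3 _]]].
  have [v_0 _ [_ _ vM vV]] := vI; have [f fa] := (SOK a).1 (H2 (fun=> 0%N)).
  apply: nD; exists f => //.
  apply: (root_transfer p_prime valO2 npO2 _ valO npO mod_roots fixpoints).
    move=> x xO; have [t tx] := surj x; rewrite -tx in xO *.
    have := H1 (fun=> t); rewrite /= => H1t.
    case: (H1t ((OE _).1 xO)) => /OE; rewrite ?vM ?vV ?vN; [by left|by right].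
  exists (val (pair_code 0 0)); have := H3 (fun=> 0%N).
  by rewrite /= SE v_0 -fa VQ => /rootP.
have [val [S [vI SE H v0 [v7 _ SO VQ SOK]]]] :=
  valued_field_th_sound valOK npOK a w (fun=> z) (fun _ _ _ => 0).
have [v_0 _ [_ _ vM vV]] := vI.
apply: (un S); apply/holds_cat; split=> //.
split=> [env /=|]; first by rewrite !SO vM !vV v7; apply: unramK.
split=> [env /=|]; first by rewrite SOK; exists f.
by split=> // env; rewrite /= SE v_0 -fa VQ v0; apply/rootP.
Qed.

End Theories.

(** * Completion of a discretely valued field *)

Section DvalTheory.
Variables (K : fieldType) (v : discrete_valuation K).
Local Notation ge := (dval_ge v).

Lemma dval_geW m n x : m <= n -> ge n x -> ge m x.
Proof. by rewrite /dval_ge => mn /orP[->//|nx]; rewrite (le_trans mn nx) orbT. Qed.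

Lemma dval_geN n x : ge n (- x) = ge n x.
Proof.
have aux y : ge n y -> ge n (- y) by rewrite -sub0r; apply/dval_geB/dval_ge0.
by apply/idP/idP => /aux; rewrite ?opprK.
Qed.

Lemma dval_geD n x y : ge n x -> ge n y -> ge n (x + y).
Proof. by move=> nx ny; rewrite -[y]opprK; apply: dval_geB; rewrite ?dval_geN. Qed.

Lemma dval_ge_val x : ge (v x) x. Proof. by rewrite /dval_ge lexx orbT. Qed.

Lemma dval_gePn n x : ~~ ge n x -> x != 0 /\ v x < n.
Proof. by rewrite negb_or -ltNge => /andP. Qed.

Lemma dval_ge_neq0 n x : x != 0 -> ge n x = (n <= v x).
Proof. by rewrite /dval_ge => /negPf ->. Qed.

Lemma dvalD_eq n x d : x != 0 -> v x < n -> ge n d -> x + d != 0 /\ v (x + d) = v x.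
Proof.
move=> x0 xn nd; have nge y : y - x = - d \/ y - x = d -> ge (v x + 1) y -> False.
  move=> E gy; have : ge (v x + 1) (y - (y - x)).
    have xn1 : v x + 1 <= n by rewrite lezD1.
    apply: dval_geB => //; apply: (dval_geW xn1).
    by case: E => ->; rewrite ?dval_geN.
  by rewrite subKr dval_ge_neq0 // lezD1 ltxx.
have xd0 : x + d != 0.
  apply/eqP => E; apply: (nge 0); last exact: dval_ge0.
  by right; rewrite sub0r -[RHS](addKr x) E addr0.
split=> //; apply/eqP; rewrite eq_le leNgt; apply/andP; split.
  apply/negP => lt; apply: (nge (x + d)); first by right; rewrite addrC addKr.
  by rewrite dval_ge_neq0 // lezD1.
rewrite -dval_ge_neq0 //; apply: dval_geD; first exact: dval_ge_val.
exact: dval_geW (ltW xn) nd.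
Qed.

End DvalTheory.

Section Completion.
Variables (K : fieldType) (v : discrete_valuation K).
Local Notation ge := (dval_ge v).

Let ev n (u : nat -> K) := exists N, forall i, (N <= i)%N -> ge n (u i).
Let near0 u := forall n, ev n u.
Let eq_val u n := exists N, forall i, (N <= i)%N -> u i != 0 /\ v (u i) = n.

Let evB n u w : ev n u -> ev n w -> ev n (fun i => u i - w i).
Proof.
move=> [N HN] [M HM]; exists (maxn N M) => i; rewrite geq_max => /andP[Ni Mi].
by apply: dval_geB; [apply: HN|apply: HM].
Qed.

Let evM m n u w : ev m u -> ev n w -> ev (m + n) (fun i => u i * w i).
Proof.
move=> [N HN] [M HM]; exists (maxn N M) => i; rewrite geq_max => /andP[Ni Mi].
by apply: dval_geM; [apply: HN|apply: HM].
Qed.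

Let cauchy_bound u : dval_cauchy v u -> exists n, ev n u.
Proof.
move=> cu; have [N HN] := cu 0; exists (Order.min 0 (v (u N))), N => i Ni.
rewrite -(subrK (u N) (u i)) dval_geD //.
  by apply: dval_geW (HN i N Ni (leqnn _)); rewrite ge_min lexx.
by apply: dval_geW (dval_ge_val v (u N)); rewrite ge_min lexx orbT.
Qed.

Let cauchy_val u : dval_cauchy v u -> near0 u \/ exists n, eq_val u n.
Proof.
move=> cu; have [H|/existsNP[n nev]] := EM (near0 u); [by left|right].
have [N HN] := cu n.
have [i Ni /negP/dval_gePn[ui0 uin]] : exists2 i, (N <= i)%N & ~ ge n (u i).
  apply: contrapT => H; apply: nev; exists N => i Ni; apply: contrapT => H'.
  by apply: H; exists i.
exists (v (u i)), N => j Nj; rewrite -(subrKC (u i) (u j)).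
exact: dvalD_eq ui0 uin (HN j i Nj Ni).
Qed.

Let cauchyB u w : dval_cauchy v u -> dval_cauchy v w -> dval_cauchy v (fun i => u i - w i).
Proof.
move=> cu cw n; have [[N HN] [M HM]] := (cu n, cw n).
exists (maxn N M) => i j; rewrite !geq_max => /andP[Ni Mi] /andP[Nj Mj].
have -> : u i - w i - (u j - w j) = (u i - u j) - (w i - w j) by ring.
by apply: dval_geB; [apply: HN|apply: HM].
Qed.

Let cauchyM u w : dval_cauchy v u -> dval_cauchy v w -> dval_cauchy v (fun i => u i * w i).
Proof.
move=> cu cw n; have [[a [A HA]] [b [B HB]]] := (cauchy_bound cu, cauchy_bound cw).
have [[N HN] [M HM]] := (cu (n - b), cw (n - a)).
exists (maxn (maxn A B) (maxn N M)) => i j; rewrite !geq_max.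
move=> /andP[/andP[Ai Bi] /andP[Ni Mi]] /andP[/andP[Aj Bj] /andP[Nj Mj]].
have -> : u i * w i - u j * w j = (u i - u j) * w i + u j * (w i - w j) by ring.
apply: dval_geD.
  by rewrite -(subrK b n); apply: dval_geM; [apply: HN|apply: HB].
by rewrite -(subrKC a n); apply: dval_geM; [apply: HA|apply: HM].
Qed.

Let cauchy_const x : dval_cauchy v (fun=> x).
Proof. by move=> n; exists 0%N => i j _ _; rewrite subrr dval_ge0. Qed.

Let cauchyV u n : dval_cauchy v u -> eq_val u n -> dval_cauchy v (fun i => (u i)^-1).
Proof.
move=> cu [N HN] m; have [M HM] := cu (m + n + n).
exists (maxn N M) => i j; rewrite !geq_max => /andP[Ni Mi] /andP[Nj Mj].
have [[ui0 uin] [uj0 ujn]] := (HN i Ni, HN j Nj).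
have -> : (u i)^-1 - (u j)^-1 = (u j - u i) * ((u i)^-1 * (u j)^-1).
  by field; rewrite ui0 uj0.
rewrite (_ : m = m + n + n + (- n + - n)); last by ring.
apply: dval_geM; first exact: HM.
by apply: dval_geM; rewrite /dval_ge dvalV // ?uin ?ujn lexx orbT.
Qed.

Let T := {u | dval_cauchy v u}.
Let R (x y : T) := near0 (fun i => sval x i - sval y i).
Let zero : T := exist _ _ (cauchy_const 0).
Let one : T := exist _ _ (cauchy_const 1).
Let sub (x y : T) : T := exist _ _ (cauchyB (svalP x) (svalP y)).
Let opp (x : T) : T := sub zero x.
Let add (x y : T) : T := sub x (opp y).
Let mul (x y : T) : T := exist _ _ (cauchyM (svalP x) (svalP y)).
Let inv (x : T) : T :=
  if pselect (dval_cauchy v (fun i => (sval x i)^-1)) is left c then exist _ _ c else x.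

Let eq_near0 u w : u =1 w -> near0 u -> near0 w.
Proof. by move=> uw H n; have [N HN] := H n; exists N => i Ni; rewrite -uw HN. Qed.

Let near0_ev u : (exists N, forall i, (N <= i)%N -> u i = 0) -> near0 u.
Proof. by move=> [N HN] n; exists N => i /HN ->; rewrite dval_ge0. Qed.

Let eqR x y : sval x =1 sval y -> R x y.
Proof. by move=> xy; apply: near0_ev; exists 0%N => i _; rewrite xy subrr. Qed.

Let near0B u w : near0 u -> near0 w -> near0 (fun i => u i - w i).
Proof. by move=> Hu Hw n; apply: evB. Qed.

Let near0M u w : near0 u -> dval_cauchy v w -> near0 (fun i => u i * w i).
Proof.
by move=> Hu /cauchy_bound[m Hm] n; rewrite -(subrK m n); apply: evM.
Qed.

Lemma ex_completion : exists (E : fieldType) (nu : discrete_valuation E) (iota : {rmorphism K -> E}),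
  [/\ dval_complete nu, forall n x, dval_ge nu n (iota x) = dval_ge v n x &
    forall z n, exists x, dval_ge nu n (z - iota x)].
Proof.
have Rrefl x : R x x by apply: eqR.
have subR x x' y y' : R x x' -> R y y' -> R (sub x y) (sub x' y').
  by move=> Hx Hy; apply: eq_near0 (near0B Hx Hy) => i /=; ring.
have Rsym x y : R x y -> R y x.
  by move=> H; apply: eq_near0 (near0B (Rrefl y) H) => i /=; ring.
have Rtrans x y z : R x y -> R y z -> R x z.
  by move=> H1 /Rsym H2; apply: eq_near0 (near0B H1 H2) => i /=; ring.
have oppR x x' : R x x' -> R (opp x) (opp x') by apply: subR.
have addR x x' y y' : R x x' -> R y y' -> R (add x y) (add x' y').
  by move=> Hx Hy; apply: subR => //; apply: oppR.
have mulR x x' y y' : R x x' -> R y y' -> R (mul x y) (mul x' y').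
  move=> Hx /Rsym Hy.
  apply: eq_near0 (near0B (near0M Hx (svalP y)) (near0M Hy (svalP x'))) => i /=; ring.
have one0 : ~ R one zero.
  by move=> /(_ 1)[N /(_ N (leqnn N))] /=; rewrite subr0 dval_ge_neq0 ?oner_neq0 // dval1.
have nz (x : T) : ~ R x zero -> exists n, eq_val (sval x) n.
  move=> nx; case: (cauchy_val (svalP x)) => // H; case: nx.
  by apply: eq_near0 H => i /=; rewrite subr0.
have invP x : ~ R x zero -> R (mul (inv x) x) one.
  move=> /nz[n /[dup] xn [N HN]]; rewrite /inv; case: pselect => [c|[]]; last first.
    exact: cauchyV (svalP x) xn.
  by apply: near0_ev; exists N => i /HN[xi0 _] /=; rewrite mulVf // subrr.
have [||||||||E [f [surj fE f0 f1 [fD fM fN]]]] := @field_of_setoid T R zero one add mul opp inv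
  Rrefl Rsym Rtrans addR mulR oppR _ _ _ _ _ _ _ _ one0 invP; try by move=> *; apply: eqR => i /=; ring.
pose cst x : T := exist _ _ (cauchy_const x).
have fB x y : f (sub x y) = f x - f y.
  by rewrite -fN -fD; apply/fE/eqR => i /=; ring.
have f_eq0 u : f u = 0 <-> near0 (sval u).
  rewrite -f0 fE; split; apply: eq_near0 => i /=; rewrite ?subr0 //.
have nz' u : f u != 0 -> exists n, eq_val (sval u) n.
  by move=> fu0; apply: nz => /fE; rewrite f0; apply/eqP.
have /choice[nu nuP] z : exists n, z != 0 -> exists2 u, f u = z & eq_val (sval u) n.
  have [->|z0] := eqVneq z 0; first by exists 0.
  have [u fu] := surj z; have [|n un] := nz' u; first by rewrite fu.
  by exists n => _; exists u.
have nuE u n : eq_val (sval u) n -> f u != 0 /\ nu (f u) = n.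
  move=> [N HN]; have fu0 : f u != 0.
    apply/eqP => /f_eq0/(_ (n + 1))[M HM]; have := HM _ (leq_maxr N M).
    have [ui0 uin] := HN _ (leq_maxl N M).
    by rewrite dval_ge_neq0 // uin lezD1 ltxx.
  split=> //; have [u' fu' [M HM]] := nuP _ fu0.
  move/esym/fE: fu' => /(_ (nu (f u) + 1))[M' HM'].
  have [ui0 <-] := HN _ (leq_maxl N (maxn M M')).
  have [u'i0 u'in] := HM _ (leq_trans (leq_maxl M M') (leq_maxr N _)).
  have H := HM' _ (leq_trans (leq_maxr M M') (leq_maxr N _)).
  have := @dvalD_eq _ v (nu (f u) + 1) _ _ u'i0 _ H.
  by rewrite subrKC u'in ltrDl ltr01 => /(_ isT)[_].
have geE u n : (f u == 0) || (n <= nu (f u)) <-> ev n (sval u).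
  split=> [/orP[/eqP/f_eq0 //|le]|un].
    have [/f_eq0 //|/eqP fu0] := pselect (f u = 0); have [m um] := nz' _ fu0.
    have [_ fun_m] := nuE _ _ um; case: um => [N HN]; exists N => i /HN[ui0 uin].
    by rewrite dval_ge_neq0 // uin -fun_m.
  case: eqVneq => //= fu0; have [m um] := nz' _ fu0; have [_ ->] := nuE _ _ um.
  have [[N HN] [M HM]] := (um, un); have [ui0 <-] := HN _ (leq_maxl N M).
  by rewrite -dval_ge_neq0 // HM // leq_maxr.
have nuM x y : x != 0 -> y != 0 -> nu (x * y) = nu x + nu y.
  move=> x0 y0; have [[u fu [N HN]] [w fw [M HM]]] := (nuP _ x0, nuP _ y0).
  rewrite -{1}fu -{1}fw -fM; apply: (nuE _ _ _).2; exists (maxn N M) => i.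
  rewrite geq_max => /andP[/HN[ui0 <-] /HM[wi0 <-]] /=.
  by rewrite mulf_neq0 // dvalM.
have nuD x y : x != 0 -> y != 0 -> x + y != 0 -> Order.min (nu x) (nu y) <= nu (x + y).
  have [[u <-] [w <-]] := (surj x, surj y) => fu0 fw0 fuw0.
  set n := Order.min _ _; suff : (f (add u w) == 0) || (n <= nu (f (add u w))).
    by rewrite fD (negPf fuw0).
  have un : ev n (sval u) by apply/geE; rewrite /n ge_min lexx orbT.
  have wn : ev n (sval w) by apply/geE; rewrite /n ge_min lexx !orbT.
  have [[N HN] [M HM]] := (un, wn); apply/geE; exists (maxn N M) => i.
  rewrite geq_max => /andP[Ni Mi] /=; rewrite sub0r opprK.
  by apply: dval_geD; [apply: HN|apply: HM].
have cstE x : x != 0 -> f (cst x) != 0 /\ nu (f (cst x)) = v x.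
  by move=> x0; apply: nuE; exists 0%N.
have nu_surj n : exists2 x, x != 0 & nu x = n.
  by have [x x0 <-] := dval_surj v n; have [] := cstE x x0; exists (f (cst x)).
pose vE := DiscreteValuation nuM nuD nu_surj.
have iB : zmod_morphism (f \o cst).
  by move=> x y /=; rewrite -fB; apply/fE/eqR => i.
have iM : monoid_morphism (f \o cst).
  by split=> [|x y] /=; rewrite -?f1 -?fM; apply/fE/eqR => i.
pose iA := GRing.isZmodMorphism.Build _ _ _ iB.
pose iMm := GRing.isMonoidMorphism.Build _ _ _ iM.
pose iota : {rmorphism K -> E} := HB.pack (f \o cst) iA iMm.
have geI n x : dval_ge vE n (iota x) = ge n x.
  rewrite /dval_ge fmorph_eq0; case: eqVneq => //= x0.
  by have [_ <-] := cstE x x0.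
have dense z n : exists x, dval_ge vE n (z - iota x).
  have [u <-] := surj z; have [N HN] := svalP u n; exists (sval u N).
  have -> : f u - iota (sval u N) = f (sub u (cst (sval u N))) by rewrite fB.
  by apply/geE; exists N => i Ni /=; apply: HN.
exists E, vE, iota; split=> // z cz.
have /choice[x xP] i := dense (z i) i%:Z.
have close n i : (`|n| <= i)%N -> dval_ge vE n (z i - iota (x i)).
  by move=> ni; apply: dval_geW (xP i); lia.
have cx : dval_cauchy v x.
  move=> n; have [N HN] := cz n; exists (maxn N `|n|) => i j.
  rewrite !geq_max => /andP[Ni ni] /andP[Nj nj]; rewrite -geI rmorphB.
  rewrite (_ : _ - _ = (z i - z j) - (z i - iota (x i)) + (z j - iota (x j))); last by ring.
  by apply: dval_geD; [apply: dval_geB|]; rewrite ?close ?HN.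
pose xs : T := exist _ _ cx; exists (f xs) => n; have [N HN] := cx n.
exists (maxn N `|n|) => i; rewrite geq_max => /andP[Ni ni].
rewrite -(subrK (iota (x i)) (z i)) -addrA; apply: dval_geD; first exact: close.
have -> : iota (x i) - f xs = f (sub (cst (x i)) xs) by rewrite fB.
by apply/geE; exists N => j Nj /=; apply: HN.
Qed.

End Completion.

(** * A valuation on an algebraically closed field *)

Lemma zorn_above (X : Type) (P : (X -> Prop) -> Prop) (A0 : X -> Prop) a0 :
  A0 a0 -> P A0 ->
  (forall F : (X -> Prop) -> Prop, (exists A, F A) ->
    (forall A, F A -> P A /\ forall x, A0 x -> A x) ->
    (forall A B, F A -> F B -> (forall x, A x -> B x) \/ (forall x, B x -> A x)) ->
    P (fun x => exists2 A, F A & A x)) ->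
  exists A, [/\ P A, forall x, A0 x -> A x &
    forall B, P B -> (forall x, A x -> B x) -> forall x, B x -> A x].
Proof.
move=> A0a0 PA0 chain.
pose Q (A : set X) := A = set0 \/ P A /\ forall x, A0 x -> A x.
have [F FQ Ftot|A [QA Amax]] := @Zorn_bigcup X Q.
  pose F' A := F A /\ A <> set0.
  have bigE : (\bigcup_(A in F) A)%classic = (fun x => exists2 A, F' A & A x).
    apply/seteqP; split=> x [A FA Ax]; last by exists A => //; case: FA.
    by exists A => //; split=> // A0E; rewrite A0E in Ax.
  have F'Q A : F' A -> P A /\ forall x, A0 x -> A x.
    by case=> /FQ[->|].
  have [[A F'A]|nF'] := EM (exists A, F' A); last first.
    left; rewrite bigE; apply/seteqP; split=> // x [A F'A _]; apply: nF'.
    by exists A.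
  right; split; last by move=> x A0x; exists A; [case: F'A|have [_] := F'Q A F'A; apply].
  rewrite bigE; apply: chain => //; first by exists A.
  by move=> B C [FB _] [FC _]; apply: Ftot.
have ltQ B : P B -> (forall x, A0 x -> B x) -> (forall x, A x -> B x) ->
    forall x, B x -> A x.
  move=> PB A0B AB x Bx; apply: contrapT => nAx; case: (Amax B).
    by rewrite properEneq; split=> //; apply/eqP => E; apply: nAx; rewrite E.
  by right.
case: QA => [A00|[PA A0A]]; last first.
  by exists A; split=> // B PB AB; apply: ltQ => // x /A0A/AB.
by have := ltQ A0 PA0 (fun _ H => H); rewrite A00 => /(_ (fun _ H => False_ind _ H) _ A0a0).
Qed.

Section ValuationRing.
Variables (L : fieldType) (a : L) (R0 : subringClosed L).
Hypothesis (aR0 : a \in R0) (aV : a^-1 \notin R0).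

Let P (A : L -> Prop) :=
  [/\ A 1, forall x y, A x -> A y -> A (x - y), forall x y, A x -> A y -> A (x * y) &
   ~ A a^-1].

Lemma ex_valuation_ring : exists O : subringClosed L,
  [/\ forall x, x \in R0 -> x \in O, forall x, (x \in O) || (x^-1 \in O) & a^-1 \notin O].
Proof.
have [|||A [[A1 AB AM Aa] R0A Amax]] := @zorn_above L P (fun x => x \in R0) 1.
- exact: rpred1.
- by split=> [|x y|x y|]; [exact: rpred1|exact: rpredB|exact: rpredM|exact/negP].
- move=> F [A0 FA0] FP Ftot; split=> [|x y [B FB Bx] [C FC Cy]|x y [B FB Bx] [C FC Cy]|[B FB]].
  + by exists A0 => //; have [[]] := FP A0 FA0.
  + by have [H|H] := Ftot B C FB FC; [exists C|exists B] => //;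
      [have [[_ HB _ _] _] := FP C FC|have [[_ HB _ _] _] := FP B FB]; apply: HB; auto.
  + by have [H|H] := Ftot B C FB FC; [exists C|exists B] => //;
      [have [[_ _ HB _] _] := FP C FC|have [[_ _ HB _] _] := FP B FB]; apply: HB; auto.
  + by have [[]] := FP B FB.
have [O OA] := ex_subring A1 AB AM.
have a0 : a != 0 by apply: contraNneq aV => ->; rewrite invr0 rpred0.
have aO : a \in O by apply/OA/R0A.
have {}Aa : a^-1 \notin O by apply/negP => /OA.
have grow (B : subringClosed L) : (forall x, x \in O -> x \in B) -> a^-1 \notin B ->
    forall x, x \in B -> x \in O.
  move=> OB aB x xB; apply/OA; apply: (Amax (fun x => x \in B)) xB => [|y /OA/OB //].
  by split=> [|y z|y z|]; [exact: rpred1|exact: rpredB|exact: rpredM|exact/negP].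
have ext x : x \notin O -> exists2 f : {poly L}, f \is a polyOver O & a^-1 = f.[x].
  move=> xO; have [|_ _ [f fO ->] [g gO ->]|_ _ [f fO ->] [g gO ->]|B BP] :=
      @ex_subring L (fun z => exists2 f : {poly L}, f \is a polyOver O & z = f.[x]).
  - by exists 1; rewrite ?rpred1 // hornerC.
  - by exists (f - g); rewrite ?rpredB // !hornerE.
  - by exists (f * g); rewrite ?rpredM // hornerM.
  apply: contrapT => nf; move/negP: xO; apply; apply: (grow B) => [y yO||].
  - by apply/BP; exists y%:P; rewrite ?polyOverC ?hornerC.
  - by apply/negP => /BP.
  - by apply/BP; exists 'X; rewrite ?polyOverX ?hornerX.
have unit1 c : c \in O -> 1 - a * c != 0 /\ (1 - a * c)^-1 \in O.
  move=> cO; set u := 1 - a * c; have uO : u \in O by rewrite rpredB ?rpred1 ?rpredM.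
  have u0 : u != 0.
    apply: contraNneq Aa => /eqP; rewrite subr_eq0 => /eqP E.
    by rewrite -[a^-1]mulr1 E mulKf.
  split=> //; apply: contraT => /ext[f fO fE]; case/negP: Aa.
  have [d dO dE] : exists2 d, d \in O & u ^+ size f = 1 - a * d.
    elim: (size f) => [|n [d dO dE]]; first by exists 0; rewrite ?rpred0 // mulr0 subr0.
    exists (c + d - a * c * d); first by rewrite rpredB ?rpredD ?rpredM.
    by rewrite exprS dE /u; ring.
  have -> : a^-1 = f.[u^-1] * u ^+ size f + d by rewrite -fE dE; field.
  rewrite rpredD // horner_coef mulr_suml rpred_sum // => i _.
  have uE : u ^+ size f = u ^+ (size f - i) * u ^+ i by rewrite -exprD subnK // ltnW.
  rewrite (_ : _ * _ = f`_i * u ^+ (size f - i)); last first.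
    by rewrite uE exprVn; field; rewrite expf_neq0.
  by rewrite rpredM ?rpredX ?(polyOverP fO).
have min x : x \notin O -> exists f : {poly L}, [/\ f \is a polyOver O, a^-1 = f.[x] &
    forall g : {poly L}, g \is a polyOver O -> a^-1 = g.[x] -> (size f <= size g)%N].
  move=> /ext[f0 f0O f0E].
  have [f [fO fE] fmin] := @ex_min_measure {poly L}
    (fun f => f \is a polyOver O /\ a^-1 = f.[x]) (fun f => size f) (ex_intro _ f0 (conj f0O f0E)).
  by exists f; split=> // g gO gE; apply: fmin.
exists O; split=> [x /R0A/OA //|x|//]; apply/norP => -[/min[f Hf] /min[g Hg]].
have [x0|x0] := eqVneq x 0.
  case: Hf => fO fE _; case/negP: Aa; rewrite fE x0; apply: rpred_horner => //; exact: rpred0.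
have [y [yx y0]] : exists y, y = x^-1 /\ y != 0 by exists x^-1; rewrite invr_eq0.
rewrite -yx in Hg; have {yx x0} xy : x * y = 1 by rewrite yx divff.
wlog le : x y y0 f g Hf Hg xy / (size g <= size f)%N.
  move=> W; have [le|/ltnW le] := leqP (size g) (size f); first exact: (W x y y0 f g).
  by apply: (W y x _ g f) => //; [apply: contra_eqN xy => /eqP ->; rewrite mul0r eq_sym
      oner_eq0|rewrite mulrC].
have [[fO fE fmin] [gO gE _]] := (Hf, Hg).
have [u0 uO] := unit1 _ (polyOverP gO 0%N); set u := 1 - a * _ in u0 uO.
have sf : (0 < size f)%N.
  rewrite lt0n size_poly_eq0; apply: contraNneq Aa => f0.
  by rewrite fE f0 horner0 rpred0.
set n := (size f).-1; have sfn : size f = n.+1 by rewrite prednK.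
pose h := \sum_(j < n) (a * u^-1 * g`_j.+1) *: 'X^(n - j.+1).
have hx : h.[x] = x ^+ n.
  have : u = a * \sum_(j < n) g`_j.+1 * y ^+ j.+1.
    have : a * a^-1 = a * g.[y] by rewrite -gE.
    rewrite divff // (horner_coef_wide _ (leq_trans le (eq_leq sfn))) big_ord_recl expr0 mulr1.
    by rewrite mulrDr => E1; apply/eqP; rewrite /u subr_eq addrC -E1.
  move=> E; have -> : x ^+ n = u^-1 * ((a * \sum_(j < n) g`_j.+1 * y ^+ j.+1) * x ^+ n).
    by rewrite -E mulKf.
  rewrite horner_sum mulr_sumr mulr_suml mulr_sumr.
  apply: eq_bigr => j _; rewrite hornerZ hornerXn.
  have -> : x ^+ n = x ^+ (n - j.+1) * x ^+ j.+1 by rewrite -exprD subnK.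
  by transitivity (a / u * g`_j.+1 * (x ^+ (n - j.+1) * (x * y) ^+ j.+1));
    [rewrite xy expr1n mulr1|rewrite exprMn; ring].
pose f' := \poly_(i < n) f`_i + f`_n *: h.
have f'O : f' \is a polyOver O.
  apply: rpredD; first by apply/polyOverP => i; rewrite coef_poly; case: ifP => _; rewrite
      ?(polyOverP fO) ?rpred0.
  apply: polyOverZ; first exact: (polyOverP fO).
  apply: rpred_sum => j _; apply: polyOverZ; last exact/rpredX/polyOverX.
  by rewrite !rpredM ?(polyOverP gO).
have f'E : a^-1 = f'.[x].
  rewrite fE hornerD hornerZ hx horner_poly horner_coef sfn big_ord_recr //.
have := fmin f' f'O f'E; rewrite sfn leqNgt ltnS => /negP; apply.
rewrite (leq_trans (size_polyD _ _)) // geq_max size_poly /=.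
rewrite (leq_trans (size_scale_leq _ _)) //; apply/leq_sizeP => i lei.
rewrite coef_sum big1 // => j _; rewrite coefZ coefXn.
by rewrite gtn_eqF ?mulr0 //; have := ltn_ord j; move: lei; lia.
Qed.
End ValuationRing.

Lemma ex_transcendental : exists (L : closedFieldType) (T : L), [pchar L] =i pred0 /\
  forall g : {poly int}, g != 0 -> (map_poly intr g).[T] != 0.
Proof.
pose Q := {fraction {poly rat}}.
pose num (x : Q) : {poly rat} * {poly rat} := val (repr x).
pose dec z : option Q := omap (fun r => \pi_Q r)%qT (insub z).
have numK : pcancel num dec by move=> x; rewrite /dec /num valK /= reprK.
pose C : countFieldType := HB.pack Q (PCanIsCountable numK).
have [L [f _]] := countable_algebraic_closure C.
pose iota : {rmorphism {poly rat} -> L} := f \o (@tofrac {poly rat} : {rmorphism {poly rat} -> C}).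
have iota0 q : (iota q == 0) = (q == 0) by rewrite /= fmorph_eq0 tofrac_eq0.
have intr0 (K : numDomainType) (g : {poly int}) : (map_poly intr g == 0 :> {poly K}) = (g == 0).
  by rewrite -size_poly_eq0 size_map_inj_poly ?size_poly_eq0 //; apply: intr_inj.
exists L, (iota 'X); split=> [|g g0].
  by apply/pcharf0P => n; rewrite -(rmorph_nat iota) iota0 -polyC_natr polyC_eq0 pnatr_eq0.
rewrite -rmorph_int_poly iota0 (_ : _.['X] = map_poly intr g) ?intr0 //.
rewrite -[RHS]comp_polyXr /comp_poly; congr _.['X]; apply/polyP => i.
by rewrite !coef_rmap rmorph_int.
Qed.

Section GaussRing.
Variables (p : nat) (p_prime : prime p).

Lemma ex_valued_closed_field : exists (L : closedFieldType) (O : subringClosed L) (T : L),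
  [/\ forall x, (x \in O) || (x^-1 \in O), p%:R^-1 \notin O, T \in O &
    forall (g : {poly int}) i, ~~ (p %| g`_i)%Z ->
      (map_poly intr g).[T] != 0 /\ (map_poly intr g).[T]^-1 \in O].
Proof.
have [L [T [char0 Ttr]]] := ex_transcendental.
have [ev evE] := int_poly_eval T.
have pF := pchar_Fp p_prime.
pose prim (g : {poly int}) := (map_poly intr g : {poly 'F_p}) != 0.
have primM g h : prim g -> prim h -> prim (g * h).
  by rewrite /prim rmorphM; apply: mulf_neq0.
have ev0 g : ev g = 0 -> g = 0.
  by move=> /eqP; rewrite evE; apply: contraTeq => /Ttr.
have prim0 g : prim g -> ev g != 0.
  by move=> pg; apply: contraNneq pg => /ev0 ->; rewrite rmorph0.
have prim1 : prim 1 by rewrite /prim rmorph1 oner_neq0.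
have [|_ _ [g [h [ph ->]]] [g' [h' [ph' ->]]]|_ _ [g [h [ph ->]]] [g' [h' [ph' ->]]]|R0 R0P] :=
    @ex_subring L (fun z => exists g h, prim h /\ z = ev g / ev h).
- by exists 1, 1; rewrite rmorph1 divr1.
- exists (g * h' - g' * h), (h * h'); split; first exact: primM.
  by rewrite rmorphB !rmorphM /=; field; rewrite !prim0.
- exists (g * g'), (h * h'); split; first exact: primM.
  by rewrite !rmorphM /=; field; rewrite !prim0.
have pn0 : p%:R != 0 :> L by move/pcharf0P: char0 => ->; rewrite -lt0n prime_gt0.
have prim_inv g h : prim h -> ev g / ev h \in R0 by move=> ph; apply/R0P; exists g, h.
have [||O [R0O valO pO]] := @ex_valuation_ring L p%:R R0.
- exact: rpred_nat.
- apply/negP => /R0P[g [h [ph E]]]; case/negP: (ph).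
  suff -> : h = p%:R * g by rewrite rmorphM rmorph_nat -polyC_natr (pcharf0 pF) mul0r.
  apply/eqP; rewrite -subr_eq0; apply/eqP/ev0; rewrite rmorphB rmorphM rmorph_nat.
  by apply: (mulIf (prim0 h ph)); rewrite -[ev g](divfK (prim0 h ph)) -E mulVKf // subrr mul0r.
have TE : T = ev 'X by rewrite evE map_polyX hornerX.
exists L, O, T; split=> // [|g i gi].
  by apply: R0O; rewrite TE -[ev _]divr1 -(rmorph1 ev); apply: prim_inv.
have pg : prim g.
  apply: contraNneq gi => g0; rewrite (dvdz_pcharf pF) -coef_rmap.
  by rewrite [map_poly _ _]g0 coef0.
by rewrite -evE; split; [exact: prim0|apply: R0O; rewrite -[_^-1]mul1r -(rmorph1 ev); apply: prim_inv].
Qed.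

End GaussRing.

(** * A residue field with prescribed roots of a transcendental element *)

Section ResidueSubfield.
Variables (p : nat) (p_prime : prime p) (kappa : fieldType) (pk : p \in [pchar kappa]).
Hypothesis closed : forall g : {poly kappa}, g \is monic -> (1 < size g)%N ->
  exists z, root g z.

Lemma ex_finite_closure : exists C : divringClosed kappa, forall z,
  z \in C <-> exists2 m, (0 < m)%N & z ^+ (p ^ m) = z.
Proof.
have common (x y : kappa) : (exists2 m, (0 < m)%N & x ^+ (p ^ m) = x) ->
    (exists2 m, (0 < m)%N & y ^+ (p ^ m) = y) ->
    exists m, [/\ (0 < m)%N, x ^+ (p ^ m) = x & y ^+ (p ^ m) = y :> kappa].
  move=> [m m0 xm] [n n0 yn]; exists (m * n)%N; split; first by rewrite muln_gt0 m0.
    by rewrite mulnC; exact: (pth_root_mul n xm).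
  exact: (pth_root_mul m yn).
apply: ex_subfield => [|x y|x y].
- by exists 1%N; rewrite ?expr1n.
- move=> Hx Hy; have [m [m0 xm ym]] := common _ _ Hx Hy; exists m => //.
  rewrite -{2}xm -{2}ym; elim: (m) (x) (y) => [|n IH] a b; first by rewrite !expr1.
  by rewrite expnS !exprM -!(pFrobenius_autE pk) rmorphB /= IH.
- move=> Hx Hy _; have [m [m0 xm ym]] := common _ _ Hx Hy; exists m => //.
  by rewrite expr_div_n xm ym.
Qed.

Lemma finite_closure_root (C : divringClosed kappa) :
  (forall z, z \in C <-> exists2 m, (0 < m)%N & z ^+ (p ^ m) = z) ->
  forall a z, a \is a polyOver C -> a != 0 -> root a z -> z \in C.
Proof.
move=> CP a z aC a0 az.
have l0 : lead_coef a != 0 by rewrite lead_coef_eq0.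
have [||c cC|f fmon fz] := @integral_root_monic int kappa intr z ((lead_coef a)^-1 *: a).
- by rewrite monicE lead_coefZ mulVf.
- by rewrite rootZ // invr_eq0.
- have /CP[m m0 cm] : c \in C.
    have : (lead_coef a)^-1 *: a \is a polyOver C.
      by apply: polyOverZ => //; rewrite rpredV lead_coefE; apply: (polyOverP aC).
    by move/polyOverP => H; case/(nthP 0): cC => i _ <-.
  exists ('X^(p ^ m) - 'X).
    have pm1 : (1 < p ^ m)%N by rewrite -(exp1n m) ltn_exp2r // prime_gt1.
    by rewrite monicE lead_coefDl ?lead_coefXn // size_polyN size_polyXn size_polyX ltnS.
  by rewrite rootE rmorphB rmorphXn /= map_polyX !hornerE ?hornerXn cm subrr.
apply/CP/(@algebraic_pth_root p kappa f z pk) => //.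
by rewrite -size_poly_eq0 size_map_poly_id0 ?size_poly_eq0 ?monic_neq0 //=
  (monicP fmon) oner_eq0.
Qed.

Variable t : kappa.
Hypothesis t_tr : forall g : {poly int}, (map_poly intr g).[t] = 0 -> forall i, (p %| g`_i)%Z.

Lemma ex_residue_subfield (r : nat -> nat) : (forall n, 0 < r n)%N ->
  exists S : divringClosed kappa,
  [/\ t \in S, forall z m, (0 < m)%N -> z ^+ (p ^ m) = z -> z \in S,
    forall n, exists2 z, z \in S & z ^+ r n = t &
    forall q, prime q -> (forall n, ~~ (q %| r n)%N) -> forall z, z \in S -> z ^+ q <> t].
Proof.
move=> r0; have [C CP] := ex_finite_closure; have Croot := finite_closure_root CP.
have tC : t \notin C.
  apply/negP => /CP[m m0 tm].
  have := @t_tr ('X^(p ^ m) - 'X); rewrite rmorphB rmorphXn /= map_polyX !hornerE ?hornerXn tm.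
  have pm1 : (1 < p ^ m)%N by rewrite -(exp1n m) ltn_exp2r // prime_gt1.
  rewrite subrr => /(_ erefl 1%N); rewrite coefB coefXn coefX ltn_eqF //= sub0r rpredN dvdzE /= dvdn1.
  by rewrite gtn_eqF ?prime_gt1.
have exr (x : kappa) n : exists y, y ^+ r n = x.
  have [||y] := closed (g := 'X^(r n) - x%:P).
  - exact: monicXnsubC.
  - by rewrite size_XnsubC // ltnS.
  by rewrite rootE hornerD hornerN hornerXn hornerC subr_eq0 => /eqP; exists y.
have /choice[nxt nxtP] (xn : kappa * nat) : exists y, y ^+ r xn.2 = xn.1 by apply: exr.
pose u := fix u n := if n is m.+1 then nxt (u m, m) else t.
have uS n : u n.+1 ^+ r n = u n by apply: (nxtP (u n, n)).
pose N n := (\prod_(i < n) r i)%N.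
have uN n : u n ^+ N n = t.
  elim: n => [|n IH]; first by rewrite /N big_ord0 expr1.
  by rewrite /N big_ord_recr /= mulnC exprM uS.
have u_tr n a : a \is a polyOver C -> a.[u n] = 0 -> a = 0.
  move=> aC /rootP au; apply/eqP; apply: contraNT tC => a0.
  by rewrite -(uN n) rpredX // (Croot a).
pose Lv n z := exists a b, [/\ a \is a polyOver C, b \is a polyOver C, b.[u n] != 0 & z = a.[u n] /
    b.[u n]].
have LvS n k z : Lv n z -> Lv (n + k)%N z.
  elim: k => [|k IH]; rewrite ?addn0 // => /IH[a [b [aC bC bu ->]]]; rewrite addnS.
  exists (a \Po 'X^(r (n + k))), (b \Po 'X^(r (n + k))).
  by rewrite !horner_comp hornerXn uS; split; rewrite ?polyOver_comp // rpredX ?polyOverX.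
have common x y : (exists n, Lv n x) -> (exists n, Lv n y) -> exists n, Lv n x /\ Lv n y.
  move=> [n nx] [m my]; exists (n + m)%N; split; first exact: LvS.
  by rewrite addnC; apply: LvS.
have LvC n a : a \is a polyOver C -> Lv n a.[u n].
  by exists a, 1; rewrite hornerC divr1 oner_neq0 rpred1.
have [|x y Hx Hy|x y Hx Hy y0|S SP] := @ex_subfield kappa (fun z => exists n, Lv n z).
- by exists 0%N; rewrite -[1](hornerC 1 (u 0%N)); apply: LvC; rewrite polyOverC rpred1.
- have [n [[a [b [aC bC b0 ->]]] [c [d [cC dC d0 ->]]]]] := common x y Hx Hy.
  exists n, (a * d - c * b), (b * d); rewrite rpredB ?rpredM // !hornerE mulf_neq0 //.
  by split=> //; field; rewrite b0 d0.
- have [n [[a [b [aC bC b0 ->]]] [c [d [cC dC d0 yE]]]]] := common x y Hx Hy.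
  have c0 : c.[u n] != 0 by apply: contraNneq y0 => c0; rewrite yE c0 mul0r.
  exists n, (a * d), (b * c); rewrite !rpredM // !hornerE mulf_neq0 //.
  by split=> //; rewrite yE; field; rewrite b0 c0 d0.
have uSS n : u n \in S.
  by apply/SP; exists n; rewrite -[X in Lv _ X]hornerX; apply: LvC; apply: polyOverX.
exists S; split=> [|z m m0 zm|n|q q_prime qr z /SP[n [a [b [aC bC b0 ->]]]] E].
- exact: (uSS 0%N).
- apply/SP; exists 0%N; rewrite -[z](hornerC z (u 0%N)); apply: LvC.
  by rewrite polyOverC; apply/CP; exists m.
- exists (u n.+1 ^+ N n); first exact: rpredX.
  by rewrite -exprM mulnC exprM uS.
have qN : ~~ (q %| N n)%N.
  rewrite /N; elim: (n) => [|k IH]; first by rewrite big_ord0 dvdn1 gtn_eqF // prime_gt1.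
  by rewrite big_ord_recr /= Euclid_dvdM // negb_or IH qr.
have /eqP : a ^+ q - b ^+ q * 'X^(N n) = 0.
  apply: (u_tr n); first by rewrite rpredB ?rpredM ?rpredX ?polyOverX.
  rewrite !hornerE ?hornerXn uN -E expr_div_n; field.
  by rewrite expf_neq0.
rewrite subr_eq0 => /eqP E'.
have bn0 : b != 0 by apply: contraNneq b0 => ->; rewrite horner0.
have an0 : a != 0.
  apply: contra_eq_neq E' => ->; rewrite expr0n gtn_eqF ?prime_gt0 // eq_sym.
  by rewrite mulf_neq0 ?expf_neq0 ?polyX_eq0.
have := congr1 (fun f : {poly kappa} => (size f).-1) E'.
rewrite size_mulXn ?expf_neq0 // size_exp.
have := size_exp b q; have := size_poly_gt0 (b ^+ q); rewrite expf_neq0 // => sb sbE.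
have -> : (N n + size (b ^+ q))%N.-1 = (N n + (size b).-1 * q)%N by rewrite -sbE; case: (size (b ^+
    q)) sb => // k _; rewrite addnS.
move=> H; case/negP: qN; rewrite -(dvdn_addl _ (dvdn_mull (size b).-1 (dvdnn q))) -H.
exact: dvdn_mull.
Qed.

End ResidueSubfield.

(** * Subfields with prescribed values and residues *)

Definition is_place (L : fieldType) (O : subringClosed L) (kappa : fieldType) (rs : L -> kappa) :=
  [/\ rs 1 = 1, {in O &, {morph rs : x y / x - y}}, {in O &, {morph rs : x y / x * y}},
    forall x, x \in O -> (rs x == 0) = val_nonunit O x &
    forall z, exists2 x, x \in O & rs x = z].

Section Place.
Variables (L : fieldType) (O : subringClosed L).
Hypothesis valO : forall x, (x \in O) || (x^-1 \in O).

Lemma ex_place : exists (kappa : fieldType) (rs : L -> kappa), is_place O rs.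
Proof.
have [kappa [res [res0 surj]]] := ex_residue_field valO.
pose rs (x : L) := res (insubd 0 x : subring_elt O).
have rsE (x : subring_elt O) : rs (val x) = res x by rewrite /rs valKd.
exists kappa, rs; split=> [|x y|x y|x|z].
- by rewrite -(rmorph1 (val : subring_elt O -> L)) rsE rmorph1.
- by move=> /ex_subring_elt[a <-] /ex_subring_elt[b <-]; rewrite -rmorphB !rsE rmorphB.
- by move=> /ex_subring_elt[a <-] /ex_subring_elt[b <-]; rewrite -rmorphM !rsE rmorphM.
- by move=> /ex_subring_elt[a <-]; rewrite rsE res0.
- by have [x <-] := surj z; exists (val x); rewrite ?subring_valP.
Qed.

Lemma val_integral (f : {poly L}) x : f \is monic -> f \is a polyOver O -> root f x -> x \in O.
Proof.
move=> fmon fO fx; case/orP: (valO x) => // xO.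
have [->|x0] := eqVneq x 0; first exact: rpred0.
have sf : size f = (size f).-1.+1 by rewrite prednK // size_poly_gt0 monic_neq0.
set n := (size f).-1 in sf.
move/rootP: fx; rewrite horner_coef sf big_ord_recr /= -[f`_n]/(lead_coef f) (monicP fmon) mul1r.
move/eqP; rewrite addr_eq0 => /eqP E.
case: n E {sf} => [|n E]; first by rewrite big_ord0 expr0 => /eqP; rewrite eq_sym oppr_eq0 oner_eq0.
have -> : x = - (\sum_(i < n.+1) f`_i * x ^+ i) * x^-1 ^+ n.
  by rewrite E opprK exprS -mulrA -exprMn divff // expr1n mulr1.
rewrite mulNr rpredN mulr_suml rpred_sum // => i _.
have -> : x^-1 ^+ n = x^-1 ^+ (n - i) * x^-1 ^+ i by rewrite -exprD subnK // -ltnS.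
by rewrite mulrACA -exprMn divff // expr1n mulr1 rpredM ?rpredX ?(polyOverP fO).
Qed.

Variables (kappa : fieldType) (rs : L -> kappa).
Hypothesis rsP : is_place O rs.

Let rs1 : rs 1 = 1. Proof. by case: rsP. Qed.
Let rsB : {in O &, {morph rs : x y / x - y}}. Proof. by case: rsP. Qed.
Let rsM : {in O &, {morph rs : x y / x * y}}. Proof. by case: rsP. Qed.
Let rs0 x : x \in O -> (rs x == 0) = val_nonunit O x. Proof. by case: rsP => _ _ _ H _; exact: H. Qed.

Lemma place0 : rs 0 = 0. Proof. by rewrite -{1}(subrr 1) rsB ?rpred1 // subrr. Qed.

Lemma placeN x : x \in O -> rs (- x) = - rs x.
Proof. by move=> xO; rewrite -sub0r rsB ?rpred0 // place0 sub0r. Qed.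

Lemma placeD x y : x \in O -> y \in O -> rs (x + y) = rs x + rs y.
Proof. by move=> xO yO; rewrite -{1}[y]opprK rsB ?rpredN // placeN // opprK. Qed.

Lemma placeX x n : x \in O -> rs (x ^+ n) = rs x ^+ n.
Proof. by move=> xO; elim: n => [|n IH]; rewrite ?expr0 // !exprS rsM ?rpredX // IH. Qed.

Lemma place_int (n : int) : rs n%:~R = n%:~R.
Proof.
have nat m : rs m%:R = m%:R.
  by elim: m => [|m IH]; rewrite ?place0 // -!natr1 placeD ?rpred_nat ?rpred1 // IH rs1.
by case: n => n; rewrite ?NegzE ?mulrNz -?pmulrn ?placeN ?rpred_nat ?nat.
Qed.

Lemma place_inv x : x \in O -> rs x != 0 -> x^-1 \in O /\ rs x^-1 = (rs x)^-1.
Proof.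
move=> xO xn; have := xn; rewrite rs0 // negb_or negbK => /andP[x0 xO'].
by split=> //; apply: (mulIf xn); rewrite -rsM // !mulVf // rs1.
Qed.

Lemma place_horner f x : f \is a polyOver O -> x \in O ->
  rs f.[x] = (map_poly rs f).[rs x].
Proof.
move=> fO xO; have H i : f`_i \in O by apply: (polyOverP fO).
have -> : (map_poly rs f).[rs x] = \sum_(i < size f) rs f`_i * rs x ^+ i.
  rewrite (horner_coef_wide _ (size_poly _ _)); apply: eq_bigr => i _.
  by rewrite coef_map_id0 ?place0.
rewrite horner_coef; elim: (size f) => [|n IH]; first by rewrite !big_ord0 place0.
rewrite !big_ord_recr /= placeD ?rpredM ?rpredX ?IH ?rsM ?rpredX ?placeX //.
by rewrite rpred_sum // => i _; rewrite rpredM ?rpredX.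
Qed.

Lemma place_int_poly (g : {poly int}) x : x \in O ->
  (map_poly intr g).[x] \in O /\ rs (map_poly intr g).[x] = (map_poly intr g).[rs x].
Proof.
move=> xO; have gO : (map_poly intr g : {poly L}) \is a polyOver O.
  by apply/polyOverP => i; rewrite coef_rmap rpred_int.
split; first exact: rpred_horner.
rewrite place_horner //; congr _.[_]; apply/polyP => i.
by rewrite coef_map_id0 ?place0 // !coef_rmap place_int.
Qed.

Section Good.
Variable S : divringClosed kappa.

Definition good_unit e := [/\ e \in O, rs e != 0 & rs e \in S].
Definition good pi x := exists n e, good_unit e /\ x = pi ^ (n : int) * e.

Lemma good_unitM e e' : good_unit e -> good_unit e' -> good_unit (e * e').
Proof.
move=> [eO e0 eS] [e'O e'0 e'S].
by split; rewrite ?rpredM // rsM // ?mulf_neq0 // rpredM.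
Qed.

Lemma good_unitV e : good_unit e -> good_unit e^-1.
Proof.
move=> [eO e0 eS]; have [eO' E] := place_inv eO e0.
by split=> //; rewrite E ?invr_eq0 // rpredV.
Qed.

Lemma good_unit1 : good_unit 1. Proof. by split; rewrite ?rs1 ?oner_neq0 ?rpred1. Qed.

Lemma good_unit_neq0 e : good_unit e -> e != 0.
Proof. by move=> [_ e0 _]; apply: contraNneq e0 => ->; rewrite place0. Qed.

Lemma goodM pi x y : pi != 0 -> good pi x -> good pi y -> good pi (x * y).
Proof.
move=> pi0 [n [e [eg ->]]] [m [e' [eg' ->]]]; exists (n + m), (e * e').
by split; [exact: good_unitM|rewrite expfzDr // mulrACA].
Qed.

Lemma goodV pi x : good pi x -> good pi x^-1.
Proof.
move=> [n [e [eg ->]]]; exists (- n), e^-1; split; first exact: good_unitV.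
by rewrite invfM invr_expz.
Qed.

Variables (pi : L).
Hypothesis piO : pi \in O.
Hypothesis pi0 : pi != 0.
Hypothesis piN : rs pi = 0.

Lemma good_unit_exp n e : good_unit e ->
  (pi ^ n * e \in O) = (0 <= n) /\ (0 < n -> rs (pi ^ n * e) = 0).
Proof.
move=> eg; have [eO e0 eS] := eg; split; last first.
  by case: n => [[|n]|n] // _; rewrite -exprnP rsM ?rpredX // placeX // piN exprS !mul0r.
case: n => n; first by rewrite -exprnP rpredM ?rpredX.
apply/negbTE/negP; rewrite NegzE -invr_expz -exprnP => H.
have [eV _] := place_inv eO e0.
have : pi^-1 \in O.
  rewrite (_ : pi^-1 = pi ^+ n * (pi ^- n.+1 * e * e^-1)).
    by rewrite rpredM ?rpredX // rpredM.
  by rewrite exprS; field; rewrite pi0 expf_neq0 // good_unit_neq0.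
move=> H'; have : rs (pi * pi^-1) = 0 by rewrite rsM // piN mul0r.
by rewrite divff // rs1 => /eqP; rewrite oner_eq0.
Qed.

Lemma good_residue x : good pi x -> x \in O -> rs x \in S.
Proof.
move=> [n [e [eg ->]]]; have [-> H] := good_unit_exp n eg.
rewrite le_eqVlt => /predU1P[<-|/H ->]; last exact: rpred0.
by rewrite expr0z mul1r; case: eg.
Qed.

Lemma extension (M : divringClosed L) a :
  (forall f, f \is a polyOver M -> f.[a] != 0 -> good pi f.[a]) ->
  exists M' : divringClosed L, [/\ forall x, x \in M -> x \in M', a \in M' &
    forall x, x \in M' -> x != 0 -> good pi x].
Proof.
move=> H; pose P x := exists f g, [/\ f \is a polyOver M, g \is a polyOver M, g.[a] != 0 & x =
    f.[a] / g.[a]].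
have PM f : f \is a polyOver M -> P f.[a].
  by move=> fM; exists f, 1; rewrite rpred1 hornerC oner_neq0 divr1.
have [|_ _ [f [g [fM gM g0 ->]]] [f' [g' [fM' gM' g0' ->]]]|
      _ _ [f [g [fM gM g0 ->]]] [f' [g' [fM' gM' g0' ->]]] fg'|M' M'P] := @ex_subfield L P.
- by rewrite -[1](hornerC 1 a); apply: PM; rewrite polyOverC rpred1.
- exists (f * g' - f' * g), (g * g'); rewrite rpredB ?rpredM // !hornerE mulf_neq0 //.
  by split=> //; field; rewrite g0 g0'.
- have f'0 : f'.[a] != 0 by apply: contraNneq fg' => ->; rewrite mul0r.
  exists (f * g'), (g * f'); rewrite !rpredM // !hornerE mulf_neq0 //.
  by split=> //; field; rewrite f'0 g0 g0'.
exists M'; split=> [x xM||x /M'P[f [g [fM gM g0 ->]]] fg].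
- by apply/M'P; rewrite -[x](hornerC x a); apply: PM; rewrite polyOverC.
- by apply/M'P; rewrite -[X in P X]hornerX; apply: PM; apply: polyOverX.
have f0 : f.[a] != 0 by apply: contraNneq fg => ->; rewrite mul0r.
by apply: goodM => //; [apply: H|apply/goodV/H].
Qed.

End Good.
End Place.

Section Unramified.
Variables (L : closedFieldType) (O : subringClosed L).
Hypothesis valO : forall x, (x \in O) || (x^-1 \in O).
Variables (kappa : fieldType) (rs : L -> kappa).
Hypothesis rsP : is_place O rs.
Let rs1 : rs 1 = 1. Proof. by case: rsP. Qed.
Let rsB : {in O &, {morph rs : x y / x - y}}. Proof. by case: rsP. Qed.
Let rsM : {in O &, {morph rs : x y / x * y}}. Proof. by case: rsP. Qed.
Let rs_surj z : exists2 x, x \in O & rs x = z. Proof. by case: rsP => _ _ _ _ H; exact: H. Qed.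
Variable S : divringClosed kappa.
Local Notation good := (good O rs S).

Let place0 := place0 rsP.

Lemma dominant_coef (f : {poly L}) : f != 0 ->
  exists2 i, f`_i != 0 & forall j, f`_j / f`_i \in O.
Proof.
move=> f0; have H n : (exists2 i, (i < n)%N & f`_i != 0) ->
    exists2 i, f`_i != 0 & forall j, (j < n)%N -> f`_j / f`_i \in O.
  elim: n => [|n IH] [i lti i0] //.
  have [/IH[k k0 kn]|nn] := EM (exists2 i, (i < n)%N & f`_i != 0); last first.
    exists i => // j; rewrite ltnS leq_eqVlt => /predU1P[->|ltj].
      rewrite ltnS leq_eqVlt in lti; case/predU1P: lti => [->|lti]; last by case: nn; exists i.
      by have [->|n0] := eqVneq f`_n 0; rewrite ?mul0r ?rpred0 // divff // rpred1.
    have [->|j0] := eqVneq f`_j 0; first by rewrite mul0r rpred0.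
    by case: nn; exists j.
  case/orP: (valO (f`_n / f`_k)) => nk.
    by exists k => // j; rewrite ltnS leq_eqVlt => /predU1P[->|/kn].
  have [n0|n0] := eqVneq f`_n 0.
    exists k => // j; rewrite ltnS leq_eqVlt => /predU1P[->|/kn //].
    by rewrite n0 mul0r rpred0.
  exists n => // j; rewrite ltnS leq_eqVlt => /predU1P[->|/kn jk].
    by rewrite divff // rpred1.
  by rewrite invf_div in nk; have := rpredM jk nk; rewrite mulrA divfK.
have [|i i0 Hi] := H (size f).
  by exists (size f).-1; rewrite ?prednK ?size_poly_gt0 // -lead_coefE lead_coef_eq0.
exists i => // j; have [/Hi //|le] := ltnP j (size f).
by rewrite nth_default // mul0r rpred0.
Qed.

Lemma monic_root_lift (c : {poly L}) b : c \is monic -> c \is a polyOver O ->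
  root (map_poly rs c) b -> exists a, [/\ a \in O, root c a & rs a = b].
Proof.
move=> cmon cO; have [x xO <-] := rs_surj b; rewrite rootE -(place_horner rsP) //.
have [r cE] := closed_field_poly_normal c; rewrite (monicP cmon) scale1r in cE.
have rO z : z \in r -> z \in O.
  by move=> zr; apply: (val_integral valO cmon cO); rewrite cE root_prod_XsubC.
rewrite cE horner_prod => H.
suff [z zr] : exists2 z, z \in r & rs (x - z) == 0.
  have zO := rO z zr; rewrite (rsB xO zO) subr_eq0 => /eqP E; exists z; split; [exact: zO|by
      rewrite root_prod_XsubC|by rewrite E].
elim: r rO H {cE} => [|z r IH] rO; first by rewrite big_nil rs1 oner_eq0.
have zO : z \in O by apply: rO; rewrite mem_head.
have {}IH := IH (fun y yr => rO y (mem_behead (s := z :: r) yr)).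
have prodO : \prod_(y <- r) ('X - y%:P).[x] \in O.
  rewrite big_seq; apply: rpred_prod => y yr.
  by rewrite hornerXsubC rpredB // rO // inE yr orbT.
rewrite big_cons hornerXsubC (rsM (rpredB xO zO) prodO).
rewrite mulf_eq0 => /orP[H|/IH[y yr yE]]; first by exists z; rewrite ?mem_head.
by exists y; rewrite // inE yr orbT.
Qed.

Lemma residue_closed (g : {poly kappa}) : g \is monic -> (1 < size g)%N -> exists z, root g z.
Proof.
move=> gmon g1; have /choice[lift liftP] z : exists x, x \in O /\ rs x = z.
  by have [x xO xE] := rs_surj z; exists x.
have sg : size g = (size g).-1.+1 by rewrite prednK // ltnW.
set n := (size g).-1 in sg; have n0 : (0 < n)%N by rewrite -ltnS -sg.
pose c' := \poly_(i < n) lift g`_i; pose c := 'X^n + c'.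
have sc : (size c' < size ('X^n : {poly L}))%N.
  by rewrite size_polyXn ltnS size_poly.
have cmon : c \is monic by rewrite monicE lead_coefDl // lead_coefXn.
have cO : c \is a polyOver O.
  apply: rpredD; first exact/rpredX/polyOverX.
  by apply/polyOverP => i; rewrite coef_poly; case: ifP => _; rewrite ?rpred0 //; case: (liftP g`_i).
have /closed_rootP[a /rootP ca] : size c != 1%N.
  by rewrite size_polyDl // size_polyXn eqSS -lt0n.
have aO : a \in O by apply: (val_integral valO cmon cO); apply/rootP.
exists (rs a); rewrite rootE (_ : g = map_poly rs c) -?(place_horner rsP) // ?ca ?place0 //.
apply/polyP => i; rewrite coef_map_id0 // coefD coefXn coef_poly.
case: ltngtP => [lti|gti|->]; rewrite ?add0r ?addr0.
- by case: (liftP g`_i).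
- by rewrite place0 nth_default // sg.
- by rewrite rs1 -[g`_n]/(lead_coef g) (monicP gmon).
Qed.

Lemma unramified_eval pi (M : divringClosed L) f a :
  pi \in O -> pi != 0 -> rs pi = 0 ->
  (forall x, x \in M -> x != 0 -> good pi x) ->
  f \is a polyOver M -> f != 0 -> a \in O -> rs a \in S ->
  (forall c, c \is monic -> c \is a polyOver M -> c \is a polyOver O ->
    root (map_poly rs c) (rs a) -> (size f < size c)%N) -> good pi f.[a].
Proof.
move=> piO pi0 piN Mgood fM f0 aO aS small; have [i fi0 fi] := dominant_coef f0.
pose f1 := (f`_i)^-1 *: f.
have f1O : f1 \is a polyOver O by apply/polyOverP => j; rewrite coefZ mulrC fi.
have f1M : f1 \is a polyOver M.
  by apply: polyOverZ => //; rewrite rpredV (polyOverP fM).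
have fE : f.[a] = f`_i * f1.[a] by rewrite hornerZ mulVKf.
have f1S j : rs f1`_j \in S.
  have fjO := polyOverP f1O j; have [->|fj0] := eqVneq f1`_j 0; first by rewrite place0 rpred0.
  apply: (good_residue rsP piO pi0 piN) => //; apply: Mgood => //.
  exact: (polyOverP f1M).
set g := map_poly rs f1; have gj j : g`_j = rs f1`_j by rewrite coef_map_id0.
have g0 : g != 0.
  by apply: contra_eq_neq (gj i) => ->; rewrite coef0 coefZ mulVf // rs1 eq_sym oner_eq0.
rewrite fE; apply: (goodM rsP) => //; first by apply: Mgood => //; apply: (polyOverP fM).
exists 0, f1.[a]; split; last by rewrite expr0z mul1r.
have gS : g.[rs a] \in S by apply: rpred_horner => //; apply/polyOverP => j; rewrite [_`_j]gj;
    exact: f1S.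
split; rewrite ?(place_horner rsP) //; first exact: rpred_horner.
apply/negP => ga; pose k := (size g).-1.
have sg : size g = k.+1 by rewrite prednK // size_poly_gt0.
have uO : f1`_k \in O := polyOverP f1O k.
have u0 : rs f1`_k != 0 by rewrite -gj -[g`_k]/(lead_coef g) lead_coef_eq0.
have [uV uE] := place_inv rsP uO u0.
have un0 : f1`_k != 0 by apply: contraNneq u0 => ->; rewrite place0.
pose c := (f1`_k)^-1 *: \poly_(j < k.+1) f1`_j.
have cj j : c`_j = if (j < k.+1)%N then (f1`_k)^-1 * f1`_j else 0.
  by rewrite coefZ coef_poly; case: ifP => // _; rewrite mulr0.
have sc : size c = k.+1.
  apply/eqP; rewrite eqn_leq; apply/andP; split.
    by apply/leq_sizeP => j lej; rewrite cj ltnNge lej.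
  by rewrite ltnNge; apply/negP => /leq_sizeP/(_ k (leqnn k))/eqP; rewrite cj ltnSn mulVf // oner_eq0.
have : (size f < size c)%N.
  apply: small.
  - by rewrite monicE lead_coefE sc cj ltnSn mulVf.
  - apply/polyOverP => j; rewrite cj; case: ifP => _; last exact: rpred0.
    by rewrite rpredM ?rpredV ?(polyOverP f1M).
  - apply/polyOverP => j; rewrite cj; case: ifP => _; last exact: rpred0.
    by rewrite rpredM ?(polyOverP f1O).
  rewrite (_ : map_poly rs c = (rs f1`_k)^-1 *: g) ?rootZ ?invr_eq0 //.
  apply/polyP => j; rewrite coef_map_id0 // [RHS]coefZ gj cj; case: ltnP => lej.
    by rewrite rsM ?uE ?(polyOverP f1O).
  by rewrite place0 -(gj j) [g`_j]nth_default ?mulr0 ?sg.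
rewrite sc -sg ltnNge => /negP; apply.
by rewrite (leq_trans (size_poly _ _)) // size_scale // invr_eq0.
Qed.

End Unramified.

Lemma polyOver_reduce (L : fieldType) (M : divringClosed L) c a f :
  c \is monic -> c \is a polyOver M -> root c a -> f \is a polyOver M ->
  exists2 g, g \is a polyOver M & g.[a] = f.[a] /\ (size g < size c)%N.
Proof.
move=> cmon cM /rootP ca; have [n] := ubnP (size f); elim: n f => // n IH f fn fM.
have [fc|cf] := ltnP (size f) (size c); first by exists f.
have c0 := monic_neq0 cmon; have sc : (0 < size c)%N by rewrite size_poly_gt0.
have sf : (0 < size f)%N := leq_trans sc cf.
pose f' := f - lead_coef f *: (c * 'X^(size f - size c)).
have f'M : f' \is a polyOver M.
  rewrite rpredB // polyOverZ // ?rpredM ?rpredX ?polyOverX // lead_coefE.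
  exact: (polyOverP fM).
have lt : (size f' < size f)%N.
  rewrite -(prednK sf) ltnS; apply/leq_sizeP => i lei.
  rewrite coefB coefZ coefMXn; case: ltnP => [lt|le].
    by exfalso; move: lt lei sf cf sc; clear; lia.
  move: lei; rewrite leq_eqVlt => /predU1P[<-|lt].
    have -> : ((size f).-1 - (size f - size c) = (size c).-1)%N.
      by move: sf cf sc; clear; move: (size f) (size c) => a b; lia.
    by rewrite -!lead_coefE (monicP cmon) mulr1 subrr.
  have [fi ci] : (size f <= i)%N /\ (size c <= i - (size f - size c))%N.
    by move: lt le sf cf sc; clear; move: (size f) (size c) => a b; lia.
  by rewrite !nth_default // mulr0 subrr.
have [|g gM [gE gc]] := IH f' _ f'M; first by rewrite (leq_trans lt).
exists g => //; split=> //; rewrite gE hornerD hornerN hornerZ hornerM ca.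
by rewrite mul0r mulr0 subr0.
Qed.

Section BaseField.
Variables (p : nat) (p_prime : prime p) (L : closedFieldType) (O : subringClosed L).
Hypothesis valO : forall x, (x \in O) || (x^-1 \in O).
Hypothesis npO : p%:R^-1 \notin O.
Variables (kappa : fieldType) (rs : L -> kappa).
Hypothesis rsP : is_place O rs.
Variable S : divringClosed kappa.
Local Notation good := (good O rs S).
Local Notation good_unit := (good_unit O rs S).

Let pO : p%:R \in O. Proof. exact: rpred_nat. Qed.
Let pn0 : p%:R != 0 :> L. Proof. exact: val_pn0 npO. Qed.
Let pN : rs p%:R = 0.
Proof. by case: rsP => _ _ _ H _; apply/eqP; rewrite H // /val_nonunit npO orbT. Qed.

Lemma good_int (n : int) : n != 0 -> good p%:R n%:~R.
Proof.
have good1 (m : int) : ~~ (p %| m)%Z -> good p%:R m%:~R.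
  move=> pm; have [m0 mO] := val_int_unit p_prime valO npO pm.
  exists 0, m%:~R; split; last by rewrite expr0z mul1r.
  have mO' : m%:~R \in O by apply: rpred_int.
  split=> //; last by rewrite (place_int rsP) rpred_int.
  by case: rsP => _ _ _ H _; rewrite H // /val_nonunit (negPf m0) mO.
move=> n0; have := n0; rewrite -absz_gt0 => /(pfactor_coprime p_prime)[d pd E].
rewrite [n]intEsg E PoszM mulrA rmorphM /=; apply: (goodM rsP) => //.
  by apply: good1; rewrite dvdzE abszM absz_sg n0 mul1n -prime_coprime.
rewrite -pmulrn natrX; exists (logn p `|n|)%:Z, 1.
by split; [exact: (good_unit1 rsP)|rewrite mulr1].
Qed.

Lemma ex_unramified : exists M : divringClosed L,
  (forall x, x \in M -> x != 0 -> good p%:R x) /\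
  forall b, b \in S -> exists x, [/\ x \in M, x \in O & rs x = b].
Proof.
pose P (A : L -> Prop) := [/\ A 1, forall x y, A x -> A y -> A (x - y),
  forall x y, A x -> A y -> y != 0 -> A (x / y) & forall x, A x -> x != 0 -> good p%:R x].
pose A0 (x : L) := exists m n : int, n != 0 /\ x = m%:~R / n%:~R.
have i0 (n : int) : n != 0 -> n%:~R != 0 :> L by exact: (val_int_neq0 p_prime valO npO).
have [|||A [[A1 AB AD Ag] _ Amax]] := @zorn_above L P A0 1.
- by exists 1, 1; rewrite divr1.
- split=> [|_ _ [m [n [n0 ->]]] [k [l [l0 ->]]]|_ _ [m [n [n0 ->]]] [k [l [l0 ->]]]|_ [m [n [n0 ->]]]].
  + by exists 1, 1; rewrite divr1.
  + exists (m * l - k * n), (n * l); rewrite mulf_neq0 // rmorphB !rmorphM /=.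
    by split=> //; field; rewrite !i0.
  + move=> kl; have k0 : k != 0 by apply: contraNneq kl => ->; rewrite mul0r.
    exists (m * l), (n * k); rewrite mulf_neq0 // !rmorphM /=.
    by split=> //; field; rewrite !i0.
  + move=> mn; have m0 : m != 0 by apply: contraNneq mn => ->; rewrite mul0r.
    by apply: (goodM rsP) => //; [|apply: (goodV rsP)]; apply: good_int.
- move=> F [B0 FB0] FP Ftot; split=> [|x y [B FB Bx] [C FC Cy]|x y [B FB Bx] [C FC Cy]|x [B FB Bx]].
  + by exists B0 => //; have [[]] := FP B0 FB0.
  + by have [H|H] := Ftot B C FB FC; [exists C|exists B] => //;
      [have [[_ HB _ _] _] := FP C FC|have [[_ HB _ _] _] := FP B FB]; apply: HB; auto.
  + by have [H|H] := Ftot B C FB FC => y0; [exists C|exists B] => //;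
      [have [[_ _ HB _] _] := FP C FC|have [[_ _ HB _] _] := FP B FB]; apply: HB; auto.
  + by have [[_ _ _ Bg] _] := FP B FB; apply: Bg.
have [M MA] := ex_subfield A1 AB AD.
have Mg x : x \in M -> x != 0 -> good p%:R x by move=> /MA; apply: Ag.
have max (M' : divringClosed L) : (forall x, x \in M -> x \in M') ->
    (forall x, x \in M' -> x != 0 -> good p%:R x) -> forall x, x \in M' -> x \in M.
  move=> MM' M'g x xM'; apply/MA; apply: (Amax (fun x => x \in M')) xM' => [|y /MA/MM' //].
  split=> [|y z|y z yM zM _|//]; [exact: rpred1|exact: rpredB|exact: rpred_div].
exists M; split=> // b bS.
pose Mon c := [/\ c \is monic, c \is a polyOver M, c \is a polyOver O & root (map_poly rs c) b].
suff [a [aO ab small]] : exists a, [/\ a \in O, rs a = b &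
    forall f, f \is a polyOver M -> f.[a] != 0 -> exists2 g, g \is a polyOver M &
      [/\ g.[a] = f.[a] , g != 0 & forall c, Mon c -> (size g < size c)%N]].
  have [|M' [MM' aM' M'g]] := @extension L O kappa rs rsP S p%:R pn0 M a.
    move=> f fM fa; have [g gM [<- g0 gsmall]] := small f fM fa.
    by apply: (unramified_eval valO rsP pO pn0 pN Mg) => //; rewrite ?ab // => c *; apply: gsmall.
  by exists a; split=> //; apply: (max M').
have [exM|noM] := EM (exists c, Mon c); last first.
  case: rsP => _ _ _ _ /(_ b)[a aO ab]; exists a; split=> // f fM fa; exists f => //.
  split=> // [|c Mc]; first by apply: contraNneq fa => ->; rewrite horner0.
  by case: noM; exists c.
have [c [cmon cM cO cb] cmin] := @ex_min_measure _ Mon (fun c => size c) exM.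
have [a [aO ca ab]] := monic_root_lift valO rsP cmon cO cb.
exists a; split=> // f fM fa.
suff [g gM [gE gc]] : exists2 g, g \is a polyOver M & g.[a] = f.[a] /\ (size g < size c)%N.
  exists g => //; split=> // [|d Md]; last exact: leq_trans gc (cmin d Md).
  by apply: contraNneq fa => g0; rewrite -gE g0 horner0.
exact: polyOver_reduce.
Qed.
End BaseField.

Section Ramified.
Variables (p : nat) (p_prime : prime p) (L : closedFieldType) (O : subringClosed L).
Hypothesis valO : forall x, (x \in O) || (x^-1 \in O).
Hypothesis npO : p%:R^-1 \notin O.
Variables (kappa : fieldType) (rs : L -> kappa).
Hypothesis rsP : is_place O rs.
Variable S : divringClosed kappa.
Local Notation good := (good O rs S).
Local Notation good_unit := (good_unit O rs S).

Let pO : p%:R \in O. Proof. exact: rpred_nat. Qed.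
Let pn0 : p%:R != 0 :> L. Proof. exact: val_pn0 npO. Qed.
Let pN : rs p%:R = 0.
Proof. by case: rsP => _ _ _ H _; apply/eqP; rewrite H // /val_nonunit npO orbT. Qed.
Let rs1 : rs 1 = 1. Proof. by case: rsP. Qed.
Let rsM : {in O &, {morph rs : x y / x * y}}. Proof. by case: rsP. Qed.

Lemma good_unitX e (n : int) : good_unit e -> good_unit (e ^ n).
Proof.
have nat m x : good_unit x -> good_unit (x ^+ m).
  by move=> xg; elim: m => [|m IH]; rewrite ?expr0 ?exprS; [exact: (good_unit1 rsP)|exact:
      (good_unitM rsP)].
move=> eg; case: n => n; first exact: nat.
by rewrite NegzE -invr_expz; apply/(good_unitV rsP)/nat.
Qed.

Lemma good_add w k l e e' : w \in O -> w != 0 -> rs w = 0 -> good_unit e -> good_unit e' ->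
  k < l -> exists2 e'', good_unit e'' & w ^ (k : int) * e + w ^ (l : int) * e' = w ^ k * e''.
Proof.
move=> wO w0 wN eg eg' kl; have lk : 0 < l - k by rewrite subr_gt0.
have [O' N'] := good_unit_exp rsP wO w0 wN (l - k) eg'.
exists (e + w ^ (l - k) * e').
  have [eO en eS] := eg; have dO : w ^ (l - k) * e' \in O by rewrite O' ltW.
  by split; rewrite ?(placeD rsP) ?N' ?addr0 // rpredD.
by rewrite mulrDr mulrA -expfzDr // subrKC.
Qed.

Variables (M : divringClosed L) (T : L).
Hypothesis Mgood : forall x, x \in M -> x != 0 -> good p%:R x.
Hypotheses (TM : T \in M) (TO : T \in O).

Lemma ex_ramified : exists (M' : divringClosed L) (w : L),
  [/\ forall x, x \in M -> x \in M', w \in M', forall x, x \in M' -> x != 0 -> good w x,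
    w ^+ p = p%:R * (1 + T * w) & [/\ w \in O, w != 0 & rs w = 0]].
Proof.
have p0 := prime_gt0 p_prime; have p1 := prime_gt1 p_prime.
pose d : {poly L} := (p%:R * T) *: 'X + p%:R%:P; pose c := 'X^p - d.
have sd : (size d < size ('X^p : {poly L}))%N.
  rewrite size_polyXn ltnS (leq_trans (size_polyD _ _)) // geq_max.
  rewrite (leq_trans (size_scale_leq _ _)) ?size_polyX //=.
  by rewrite (leq_trans (size_polyC_leq1 _)) // ltnW.
have sc : size c = p.+1 by rewrite size_polyDl ?size_polyXn // size_polyN; move: sd; rewrite size_polyXn.
have cmon : c \is monic by rewrite monicE lead_coefDl ?lead_coefXn // size_polyN.
have over (A : subringClosed L) : T \in A -> c \is a polyOver A.
  move=> TA; rewrite rpredB ?rpredX ?polyOverX // rpredD // ?polyOverC ?rpred_nat //.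
  by rewrite polyOverZ ?polyOverX // rpredM ?rpred_nat.
have /closed_rootP[w cw] : size c != 1%N by rewrite sc eqSS -lt0n.
have wE : w ^+ p = p%:R * (1 + T * w).
  by have /rootP := cw; rewrite !hornerE ?hornerXn => /eqP; rewrite subr_eq0 => /eqP ->; ring.
have wO : w \in O by apply: (val_integral valO cmon (over O TO)).
have uO : 1 + T * w \in O by rewrite rpredD ?rpred1 ?rpredM.
have wN : rs w = 0.
  have : rs w ^+ p == 0 by rewrite -(placeX rsP) // wE rsM // pN mul0r.
  by rewrite expf_eq0 p0 => /eqP.
have u1 : rs (1 + T * w) = 1.
  by rewrite (placeD rsP) ?rpred1 ?rpredM // rs1 rsM // wN mulr0 addr0.
have ug : good_unit (1 + T * w) by split; rewrite // u1 ?oner_neq0 ?rpred1.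
have un0 := good_unit_neq0 rsP ug.
have w0 : w != 0.
  have : w ^+ p != 0 by rewrite wE mulf_neq0.
  by rewrite expf_eq0 p0.
have goodw x : good p%:R x -> good w x.
  move=> [n [e [eg ->]]]; exists (p%:Z * n), ((1 + T * w)^-1 ^ n * e); split.
    by apply: (good_unitM rsP) => //; apply/good_unitX/(good_unitV rsP).
  rewrite -exprz_exp -exprnP wE expfzMl mulrA; congr (_ * _).
  by rewrite -mulrA -expfzMl divff // exp1rz mulr1.
have [|M' [MM' wM' M'g]] := @extension L O kappa rs rsP S w w0 M w.
  move=> f fM fw.
  have [g gM [gE gs]] := polyOver_reduce cmon (over M TM) cw fM; rewrite -gE in fw *.
  move: fw; rewrite (horner_coef_wide _ (_ : size g <= p)%N); last by rewrite -ltnS -sc.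
  have H m : (m <= p)%N -> \sum_(i < m) g`_i * w ^+ i = 0 \/ exists k e,
      [/\ good_unit e, \sum_(i < m) g`_i * w ^+ i = w ^ (k : int) * e & (k %% p)%Z < m%:Z].
    elim: m => [|m IH] mp; first by left; rewrite big_ord0.
    rewrite big_ord_recr /=; have {}IH := IH (ltnW mp).
    have [->|gm0] := eqVneq g`_m 0.
      rewrite mul0r addr0; case: IH => [->|[k [e [eg -> km]]]]; first by left.
      by right; exists k, e; split=> //; apply: lt_trans km _; rewrite ltz_nat.
    have [n [e [eg gmE]]] : good p%:R g`_m by apply: Mgood => //; apply: (polyOverP gM).
    pose l := n * p%:Z + m%:Z; pose e' := (1 + T * w)^-1 ^ n * e.
    have e'g : good_unit e'.
      by apply: (good_unitM rsP) => //; apply/good_unitX/(good_unitV rsP).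
    have lm : (l %% p)%Z = m%:Z by rewrite modzMDl modz_small // ltz_nat mp.
    have tE : g`_m * w ^+ m = w ^ l * e'.
      rewrite gmE /l /e' expfzDr // [n * _]mulrC -exprz_exp -(exprnP w p) wE expfzMl -exprnP.
      have E : (1 + T * w) ^ n * (1 + T * w)^-1 ^ n = 1 by rewrite -expfzMl divff // exp1rz.
      transitivity (p%:R ^ n * ((1 + T * w) ^ n * (1 + T * w)^-1 ^ n) * w ^+ m * e); last by ring.
      by rewrite E mulr1; ring.
    right; case: IH => [->|[k [e1 [e1g -> km]]]].
      by exists l, e'; rewrite add0r tE lm ltz_nat.
    rewrite tE; case: (ltgtP k l) => [kl|lk|kl].
    - have [e2 e2g ->] := good_add wO w0 wN e1g e'g kl; exists k, e2; split=> //.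
      by apply: lt_trans km _; rewrite ltz_nat.
    - have [e2 e2g E] := good_add wO w0 wN e'g e1g lk; exists l, e2; split=> //.
        by rewrite addrC.
      by rewrite lm ltz_nat.
    by rewrite kl lm ltxx in km.
  by case: (H p (leqnn p)) => [->|[k [e [eg -> _]]]]; [rewrite eqxx|exists k, e].
by exists M', w; split.
Qed.

End Ramified.

(** * The base field *)

Section DvalOfPlace.
Variables (L : fieldType) (O : subringClosed L) (kappa : fieldType) (rs : L -> kappa).
Hypothesis rsP : is_place O rs.
Variables (S : divringClosed kappa) (M : divringClosed L) (w : L).
Hypotheses (wM : w \in M) (wO : w \in O) (w0 : w != 0) (wN : rs w = 0).
Hypothesis Mgood : forall x, x \in M -> x != 0 -> good O rs S w x.

Lemma good_ge1 x : good O rs S w x -> x \in O -> rs x = 0 -> x / w \in O.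
Proof.
move=> [n [e [eg ->]]]; have [-> _] := good_unit_exp rsP wO w0 wN n eg => n0 xN.
have n1 : 1 <= n.
  move: n0; rewrite le_eqVlt => /predU1P[n0|//]; case: eg => _ /eqP e0 _; case: e0.
  by rewrite -n0 expr0z mul1r in xN.
rewrite mulrAC -[w^-1]/(w ^ (-1)) -expfzDr //.
by have [-> _] := good_unit_exp rsP wO w0 wN (n - 1) eg; rewrite subr_ge0.
Qed.

Lemma ex_dval : exists v : discrete_valuation (subfield_elt M),
  v (SubfieldElt wM) = 1 /\ forall n x, dval_ge v n x = (val x * w ^ (- n) \in O).
Proof.
have uniq n m e e' : good_unit O rs S e -> good_unit O rs S e' ->
    w ^ (n : int) * e = w ^ m * e' -> n <= m -> n = m.
  move=> eg e'g E; rewrite le_eqVlt => /predU1P[//|nm].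
  have [_ N'] := good_unit_exp rsP wO w0 wN (m - n) e'g.
  case: (eg) => _ /eqP[]; rewrite -N' ?subr_gt0 //; congr rs.
  by apply: (mulfI (expfz_neq0 n w0)); rewrite E mulrA -expfzDr // subrKC.
have /choice[v vP] (x : subfield_elt M) : exists n : int, x != 0 -> exists2 e,
    good_unit O rs S e & val x = w ^ n * e.
  have [->|x0] := eqVneq x 0; first by exists 0.
  have [||n [e [eg xE]]] := Mgood (x := val x); first exact: subfield_valP.
    by rewrite fmorph_eq0.
  by exists n => _; exists e.
have vE x n e : x != 0 -> good_unit O rs S e -> val x = w ^ n * e -> v x = n.
  move=> x0 eg xE; have [e' e'g xE'] := vP x x0.
  have [le|/ltW le] := leP (v x) n; last symmetry.
    by apply: (uniq _ _ e' e); rewrite // -xE'.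
  by apply: (uniq _ _ e e'); rewrite // -xE'.
have key x n : x != 0 -> (n <= v x) = (val x * w ^ (- n) \in O).
  move=> x0; have [e eg ->] := vP x x0; rewrite mulrAC -expfzDr //.
  by have [-> _] := good_unit_exp rsP wO w0 wN (v x - n) eg; rewrite subr_ge0.
have vM x y : x != 0 -> y != 0 -> v (x * y) = v x + v y.
  move=> x0 y0; have [[e eg xE] [e' e'g yE]] := (vP x x0, vP y y0).
  apply: (vE _ _ (e * e')); rewrite ?mulf_neq0 //; first exact: (good_unitM rsP).
  by rewrite rmorphM /= xE yE expfzDr // mulrACA.
have vD x y : x != 0 -> y != 0 -> x + y != 0 -> Order.min (v x) (v y) <= v (x + y).
  move=> x0 y0 xy0; rewrite key // rmorphD mulrDl rpredD // -key // ge_min lexx ?orbT //.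
have v_surj n : exists2 x, x != 0 & v x = n.
  have xM : w ^ n \in M by case: n => n; rewrite ?NegzE -?invr_expz ?rpredV rpredX.
  have x0 : SubfieldElt xM != 0.
    by rewrite -(fmorph_eq0 (val : subfield_elt M -> L)) /= expfz_neq0.
  exists (SubfieldElt xM) => //; apply: (vE _ _ 1) => //; first exact: (good_unit1 rsP).
  by rewrite mulr1.
exists (DiscreteValuation vM vD v_surj); split=> [|n x].
  apply: (vE _ _ 1); [|exact: (good_unit1 rsP)|by rewrite mulr1 expr1z].
  by rewrite -(fmorph_eq0 (val : subfield_elt M -> L)).
rewrite /dval_ge; have [->|x0] := eqVneq x 0; last exact: key.
by rewrite rmorph0 mul0r rpred0.
Qed.

End DvalOfPlace.

Lemma ex_base_field p (p_prime : prime p) (r : nat -> nat) : (forall n, 0 < r n)%N ->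
  exists (K : fieldType) (v : discrete_valuation K) (T w : K),
  [/\ dval_ge v 0 T, w != 0 /\ v w = 1, w ^+ p = p%:R * (1 + T * w) &
  [/\ forall n, exists2 z, dval_ge v 0 z & dval_ge v 1 (z ^+ r n - T),
    forall q, prime q -> (forall n, ~~ (q %| r n)%N) ->
      forall z, dval_ge v 0 z -> ~~ dval_ge v 1 (z ^+ q - T),
    forall g : {poly int}, dval_ge v 1 (map_poly intr g).[T] -> forall i, (p %| g`_i)%Z &
    forall h : {poly int}, h \is monic -> (1 < size h)%N ->
      exists2 z, dval_ge v 0 z & dval_ge v p%:Z (map_poly intr h).[z]]].
Proof.
move=> r0; have [L [O [T0 [valO npO T0O T0tr]]]] := ex_valued_closed_field p_prime.
have [kappa [rs rsP]] := ex_place valO; have [rs1 rsB rsM rs0 rs_surj] := rsP.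
have pn0 := val_pn0 npO; have pO : p%:R \in O by apply: rpred_nat.
have pN : rs p%:R = 0 by apply/eqP; rewrite rs0 // /val_nonunit npO orbT.
have pk : p \in [pchar kappa].
  by rewrite inE p_prime; have := place_int rsP p; rewrite -!pmulrn pN => <-; rewrite eqxx.
have t_tr (g : {poly int}) : (map_poly intr g).[rs T0] = 0 -> forall i, (p %| g`_i)%Z.
  move=> gt i; apply: contraT => /T0tr[gT0 gTO].
  have [gO gE] := place_int_poly rsP g T0O.
  have : rs (map_poly intr g).[T0] == 0 by rewrite gE gt.
  by rewrite rs0 // /val_nonunit (negPf gT0) gTO.
have [S [tS finS rootS nrootS]] :=
  ex_residue_subfield p_prime pk (residue_closed valO rsP) t_tr r0.
have [M [Mg Mres]] := ex_unramified p_prime valO npO rsP S.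
have [T [TM TO Tt]] := Mres _ tS.
have [M' [w [MM' wM' M'g wE [wO w0 wN]]]] := ex_ramified p_prime valO npO rsP Mg TM TO.
have [v [vw vE]] := ex_dval rsP wM' wO w0 wN M'g.
pose K := subfield_elt M'; pose incl : {rmorphism K -> L} := val.
have ge0 (x : K) : dval_ge v 0 x = (val x \in O) by rewrite vE oppr0 expr0z mulr1.
have ge1 (x : K) : val x \in O -> dval_ge v 1 x <-> rs (val x) = 0.
  move=> xO; rewrite vE -[w ^ _]/(w^-1); split=> H.
    by rewrite -(divfK w0 (val x)) rsM // wN mulr0.
  have [x0|x0] := eqVneq (val x) 0; first by rewrite x0 mul0r rpred0.
  by apply: (good_ge1 rsP wO w0 wN) => //; apply: M'g => //; apply: subfield_valP.
have lift b : b \in S -> exists x : K, [/\ val x \in M, val x \in O & rs (val x) = b].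
  by move=> /Mres[x [xM xO xb]]; exists (SubfieldElt (MM' _ xM)).
pose T' : K := SubfieldElt (MM' _ TM); pose w' : K := SubfieldElt wM'.
have XT n (z : K) : val z \in O ->
    val (z ^+ n - T') \in O /\ rs (val (z ^+ n - T')) = rs (val z) ^+ n - rs T0.
  move=> zO; rewrite rmorphB rmorphXn /=; split; first by rewrite rpredB ?rpredX.
  by rewrite rsB ?rpredX // (placeX rsP) // Tt.
have w'0 : w' != 0 by rewrite -(fmorph_eq0 incl).
exists K, v, T', w'; split=> //; first by rewrite ge0.
  by apply: val_inj; rewrite rmorphXn rmorphM rmorphD rmorph1 rmorphM rmorph_nat /=.
split=> [n|q q_prime qr z|g|h hmon h1].
- have [b bS bt] := rootS n; have [z [_ zO zb]] := lift b bS.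
  have [zO' zE] := XT (r n) z zO; exists z; first by rewrite ge0.
  by apply/ge1 => //; rewrite zE zb bt subrr.
- rewrite ge0 => zO; have [zO' zE] := XT q z zO; apply/negP => /(ge1 _ zO').
  rewrite zE => /eqP; rewrite subr_eq0 => /eqP; apply: nrootS => //.
  have [z0|z0] := eqVneq (val z) 0; first by rewrite z0 (place0 rsP) rpred0.
  apply: (good_residue rsP wO w0 wN) => //; apply: M'g => //; exact: subfield_valP.
- have [gO gE] := place_int_poly rsP g TO.
  have E : val (map_poly intr g).[T'] = (map_poly intr g).[T] by rewrite (rmorph_int_poly incl).
  by rewrite ge1 E // gE Tt; apply: t_tr.
have [||b hb] := residue_closed valO rsP (g := map_poly intr h).
- exact: monic_map.
- by rewrite size_map_poly_id0 ?(monicP hmon) //= oner_eq0.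
have [|m m0 bm] := @algebraic_pth_root p kappa h b pk _ hb.
  by rewrite monic_neq0 // monic_map.
have [z [zM zO zb]] := lift b (finS b m m0 bm); exists z; first by rewrite ge0.
have [hO hE] := place_int_poly rsP h zO.
rewrite vE (rmorph_int_poly incl) /=; set y := (map_poly intr h).[val z] in hO hE *.
have yp : y / p%:R \in O.
  have [->|y0] := eqVneq y 0; first by rewrite mul0r rpred0.
  apply: (good_ge1 rsP pO pn0 pN) => //; last by rewrite hE zb (rootP hb).
  apply: Mg => //; apply: rpred_horner => //; apply/polyOverP => i.
  by rewrite coef_rmap rpred_int.
have uO : 1 + T * w \in O by rewrite rpredD ?rpred1 ?rpredM.
have [|uV _] := place_inv rsP uO.
  by rewrite (placeD rsP) ?rpred1 ?rpredM // rs1 rsM // wN mulr0 addr0 oner_eq0.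
by rewrite -invr_expz -exprnP wE invfM mulrA rpredM.
Qed.

(** * Complete fields *)

Lemma ring_eval_dval (E : fieldType) (v : discrete_valuation E) (e : nat -> E) t :
  (forall i, dval_ge v 0 (e i)) -> dval_ge v 0 (ring_eval e t).
Proof. by move=> H; exact: (@ring_eval_in E (valuation_ring_pred v) e t H). Qed.

Section CompleteField.
Variables (E : fieldType) (v : discrete_valuation E).
Hypothesis complete : dval_complete v.
Local Notation ge := (dval_ge v).
Local Notation O := (valuation_ring_pred v).

Lemma dval_valO x : (x \in O) || (x^-1 \in O).
Proof.
rewrite !unfold_in /dval_ge invr_eq0; case: eqVneq => //= x0.
by rewrite dvalV // oppr_ge0 le_total.
Qed.

Lemma dval_nonunit x : ge 0 x -> val_nonunit O x = ge 1 x.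
Proof.
rewrite /val_nonunit unfold_in /dval_ge invr_eq0; case: eqVneq => //= x0 vx.
by rewrite dvalV // oppr_ge0 -ltNge gtz0_ge1.
Qed.

Lemma dvalX x n : x != 0 -> v (x ^+ n) = v x * n%:Z.
Proof.
move=> x0; elim: n => [|n IH]; first by rewrite expr0 dval1 mulr0.
by rewrite exprS dvalM ?expf_neq0 // IH -addn1 PoszD mulrDr mulr1 addrC.
Qed.

Lemma dval_div n x y : y != 0 -> ge n (x / y) = ge (n + v y) x.
Proof.
move=> y0; rewrite /dval_ge mulf_eq0 invr_eq0 (negPf y0) orbF.
case: eqVneq => //= x0; rewrite dvalM ?invr_eq0 // dvalV //.
by rewrite lerBrDr.
Qed.

Lemma dval_horner_sub g n x y : g \is a polyOver O -> ge 0 x -> ge 0 y ->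
  ge n (x - y) -> ge n (g.[x] - g.[y]).
Proof.
move=> gO xO yO xy; rewrite !horner_coef -sumrB.
apply: (big_ind (fun z => ge n z)) => [|a b|i _]; first exact: dval_ge0.
  exact: dval_geD.
rewrite -mulrBr subrXX -[n]add0r; apply: dval_geM; first exact: (polyOverP gO).
rewrite -[n]addr0; apply: dval_geM => //.
have : \sum_(j < i) x ^+ (i.-1 - j) * y ^+ j \in O.
  by apply: rpred_sum => j _; rewrite rpredM ?rpredX.
by [].
Qed.

Lemma dval_fixpoint c g : ge 1 c -> g \is a polyOver O ->
  exists2 x, x \in O & x = c * g.[x].
Proof.
move=> c1 gO; pose u := fix u n := if n is m.+1 then c * g.[u m] else 0.
have cO : c \in O by apply: dval_geW c1.
have uO n : u n \in O by elim: n => [|n IH] /=; rewrite ?rpred0 // rpredM ?rpred_horner.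
have step n : ge n%:Z (u n.+1 - u n).
  elim: n => [|n IH]; first exact: (rpredB (uO 1%N) (uO 0%N)).
  rewrite -addn1 addnC PoszD [u _]/= [u n.+1 in X in _ - X]/= -mulrBr.
  exact: dval_geM c1 (dval_horner_sub gO (uO n.+1) (uO n) IH).
have far n k : ge n%:Z (u (n + k)%N - u n).
  elim: k => [|k IH]; first by rewrite addn0 subrr dval_ge0.
  rewrite -(subrK (u (n + k)%N) (u _)) -addrA; apply: dval_geD => //.
  by rewrite addnS; apply: dval_geW (step _); rewrite lez_nat leq_addr.
have cu : dval_cauchy v u.
  move=> n; exists `|n|%N => i j ni nj.
  have H k : (`|n| <= k)%N -> ge n (u k - u `|n|%N).
    by move=> nk; rewrite -(subnKC nk); apply: dval_geW (far _ _); lia.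
  rewrite (_ : u i - u j = (u i - u `|n|%N) - (u j - u `|n|%N)); last by ring.
  by apply: dval_geB; apply: H.
have [l ul] := complete cu.
have lO : ge 0 l.
  have [N HN] := ul 0; rewrite -(subKr (u N) l).
  by apply: dval_geB; [apply: uO|apply: HN].
exists l => //; apply/eqP; rewrite -subr_eq0; apply: contraT => d0.
pose n := v (l - c * g.[l]) + 1.
suff : ge n (l - c * g.[l]) by rewrite /dval_ge (negPf d0) lezD1 ltxx.
have [N HN] := ul n.
have -> : l - c * g.[l] = c * (g.[u N] - g.[l]) - (u N.+1 - l) by rewrite /=; ring.
apply: dval_geB; last by apply: HN.
by rewrite -[n]add0r; apply: dval_geM cO (dval_horner_sub gO (uO N) lO (HN N (leqnn N))).
Qed.

Lemma residue_morphism : exists pi : {rmorphism valuation_ring v -> residue_field v},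
  forall x, ge 1 (val x) -> pi x = 0.
Proof.
exists (\pi_({ideal_quot (@maximal_ideal E v)}))%qT => x mx.
rewrite -(raddf0 (\pi_({ideal_quot (@maximal_ideal E v)}))%qT).
apply/eqP; rewrite -Quotient.idealrBE subr0; exact: mx.
Qed.

Section Uniformizer.
Variables (p : nat) (p_prime : prime p) (T w : E).
Hypotheses (TO : ge 0 T) (w0 : w != 0) (vw : v w = 1).
Hypothesis wE : w ^+ p = p%:R * (1 + T * w).

Lemma dval_1D x : ge 1 x -> 1 + x != 0 /\ v (1 + x) = 0.
Proof. by move=> x1; have := dvalD_eq (oner_neq0 E) _ x1; rewrite dval1; apply. Qed.

Lemma dval_p : p%:R != 0 :> E /\ v p%:R = p.
Proof.
have := expf_neq0 p w0; rewrite wE mulf_eq0 negb_or => /andP[p0 u0]; split=> //.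
have Tw : ge 1 (T * w) by rewrite -[1]add0r; apply: dval_geM => //; rewrite /dval_ge vw lexx orbT.
have := congr1 v wE; rewrite dvalX // vw mul1r dvalM //.
by have [_ ->] := dval_1D Tw; rewrite addr0.
Qed.

Lemma dval_npO : p%:R^-1 \notin O.
Proof.
have [p0 vp] := dval_p; rewrite unfold_in /dval_ge invr_eq0 (negPf p0) /= dvalV // vp.
by rewrite oppr_ge0 -ltNge ltz_nat prime_gt0.
Qed.

Lemma dval_ge_p x : ge 0 x -> ge 2 (p%:R * x).
Proof.
move=> xO; have [p0 vp] := dval_p; rewrite -[2]addr0; apply: dval_geM => //.
by rewrite dval_ge_neq0 // vp lez_nat prime_gt1.
Qed.

Lemma dval_pow1 u : ge 0 u -> ge 1 (u ^+ p - 1) -> ge 2 (u ^+ p - 1).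
Proof.
move=> uO u1; have [c cE] := term_addX p_prime (TVar 0) (TVar 1).
pose e i := if i is 0%N then 1 else u - 1; have eO i : ge 0 (e i).
  case: i => [|i] /=; first by rewrite /dval_ge dval1 lexx orbT.
  by apply: dval_geB => //; rewrite /dval_ge dval1 lexx orbT.
have := cE E e; rewrite /= subrKC expr1n => E1.
have pc := dval_ge_p (ring_eval_dval c eO).
have E2 : u ^+ p - 1 = (u - 1) ^+ p + p%:R * ring_eval e c by rewrite E1; ring.
have : ge 1 ((u - 1) ^+ p).
  have -> : (u - 1) ^+ p = (u ^+ p - 1) - p%:R * ring_eval e c by rewrite E2; ring.
  by apply: dval_geB => //; apply: dval_geW pc.
rewrite E2 {E1 E2 cE u1} => u1; apply: dval_geD => //.
have p0 := prime_gt0 p_prime; have p1 := prime_gt1 p_prime.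
have [->|d0] := eqVneq (u - 1) 0; first by rewrite expr0n gtn_eqF // dval_ge0.
move: u1; rewrite !dval_ge_neq0 ?expf_neq0 // dvalX //; move: (v _) => n.
by case: n => [[|n]|n] /=; nia.
Qed.

Lemma uniformizer_eq pi : pi != 0 -> v pi = 1 -> ge 1 (pi ^+ p / p%:R - 1) ->
  ge 1 ((pi ^+ p / p%:R - 1) / pi - T).
Proof.
move=> pi0 vpi H1; have [p0 vp] := dval_p.
have w1 : ge 1 w by rewrite /dval_ge vw lexx orbT.
have Tw : ge 1 (T * w) by rewrite -[1]add0r; apply: dval_geM.
have [n0 vn] := dval_1D Tw.
pose u := pi / w; have uO : ge 0 u by rewrite dval_div // vw add0r /dval_ge vpi lexx orbT.
have piE : pi ^+ p / p%:R = u ^+ p * (1 + T * w).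
  by rewrite /u expr_div_n wE; field; rewrite ?n0 ?p0.
have u2 : ge 2 (u ^+ p - 1).
  apply: dval_pow1 => //.
  have -> : u ^+ p - 1 = (pi ^+ p / p%:R - 1 - T * w) / (1 + T * w) by rewrite piE; field.
  by rewrite dval_div // vn addr0; apply: dval_geB.
have u1 : ge 1 (u - 1).
  have [c cE] := term_addX p_prime (TVar 0) (TVar 1).
  pose e i := if i is 0%N then 1 else u - 1; have eO i : ge 0 (e i).
    case: i => [|i] /=; first by rewrite /dval_ge dval1 lexx orbT.
    by apply: dval_geB => //; rewrite /dval_ge dval1 lexx orbT.
  have := cE E e; rewrite /= subrKC expr1n => E1.
  have : ge 2 ((u - 1) ^+ p).
    rewrite (_ : (u - 1) ^+ p = (u ^+ p - 1) - p%:R * ring_eval e c); last by rewrite E1; ring.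
    by apply: dval_geB => //; apply: dval_ge_p; apply: ring_eval_dval.
  have p2 := prime_gt0 p_prime.
  have [->|d0] := eqVneq (u - 1) 0; first by rewrite dval_ge0.
  rewrite !dval_ge_neq0 ?expf_neq0 // dvalX //; move: (v _) => n.
  by case: n => [[|n]|n] /=; nia.
rewrite (_ : _ - T = ((u ^+ p - 1) * (1 + T * w) - T * w * (u - 1)) / pi); last first.
  by rewrite piE /u; field; rewrite w0 pi0.
rewrite dval_div // vpi -[1 + 1]/2; apply: dval_geB.
  by rewrite -[2]addr0; apply: dval_geM => //; rewrite dval_ge_neq0 // vn.
by rewrite -[2]/(1 + 1); apply: dval_geM.
Qed.

Hypothesis T_tr : forall g : {poly int}, ge 1 (map_poly intr g).[T] -> forall i, (p %| g`_i)%Z.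

Let char0 : [pchar E] =i pred0 := val_pchar0 p_prime dval_valO dval_npO.

Lemma algebraic_subfield : exists A : divringClosed E, forall x, (x \in A) <-> algebraic x.
Proof.
have [phi _] := ex_rat_rmorphism char0.
apply: ex_subfield => [|x y|x y]; rewrite ?(algebraicE char0 phi).
- by rewrite -(rmorph1 phi); apply: algebraic_id.
- exact: algebraic_sub.
- by move=> ax ay _; apply: algebraic_div.
Qed.

(* The residue of T would be the residue of an algebraic element. *)
Lemma no_algebraic_uniformizer pi : algebraic pi -> pi != 0 -> v pi = 1 -> False.
Proof.
move=> api pi0 vpi; have [A AP] := algebraic_subfield.
have piA : pi \in A by apply/AP.
have [p0 vp] := dval_p; pose y := pi ^+ p / p%:R.
have yA : y \in A by rewrite rpred_div ?rpredX ?rpred_nat.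
have y0 : y != 0 by rewrite mulf_neq0 ?invr_eq0 ?expf_neq0.
have vy : v y = 0 by rewrite dvalM ?invr_eq0 ?expf_neq0 // dvalX // vpi mul1r dvalV // vp subrr.
have yO : ge 0 y by rewrite dval_ge_neq0 // vy.
have [[|m] // _ ym] := algebraic_residue p_prime dval_valO dval_npO yO ((AP y).1 yA).
have ymO : ge 0 (y ^+ (p ^ m.+1) - y).
  have yO' : y \in O by [].
  have : y ^+ (p ^ m.+1) - y \in O by rewrite rpredB ?rpredX.
  by [].
rewrite dval_nonunit // in ym.
pose rho := pi / y ^+ (p ^ m).
have rho0 : rho != 0 by rewrite mulf_neq0 ?invr_eq0 ?expf_neq0.
have vrho : v rho = 1.
  by rewrite dvalM ?invr_eq0 ?expf_neq0 // dvalV ?expf_neq0 // dvalX // vy mul0r subr0.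
have rhoE : rho ^+ p / p%:R = y / y ^+ (p ^ m.+1).
  by rewrite /rho expr_div_n -exprM -expnSr /y; field; rewrite p0 -/y expf_neq0.
have rho1 : ge 1 (rho ^+ p / p%:R - 1).
  rewrite rhoE (_ : _ - 1 = - (y ^+ (p ^ m.+1) - y) / y ^+ (p ^ m.+1)); last first.
    by field; rewrite expf_neq0.
  by rewrite dval_div ?expf_neq0 // dvalX // vy mul0r addr0 dval_geN.
have H := uniformizer_eq rho0 vrho rho1; set s := _ / rho in H.
have sA : s \in A by rewrite rpred_div ?rpredB ?rpred1 ?rpred_div ?rpredX ?rpred_nat // rpred_div
    ?rpredX.
have [F F0 Fs] := (AP s).1 sA.
have sO : ge 0 s by rewrite -(subrK T s); apply: dval_geD => //; apply: dval_geW H.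
pose G := zprimitive F.
have Gs : (map_poly intr G).[s] = 0.
  apply/eqP; move: Fs; rewrite /int_root {1}(zpolyEprim F) -mul_polyC rmorphM /= map_polyC.
  rewrite rootE hornerM hornerC mulf_eq0.
  by rewrite (intr_eq0_pchar0 char0) zcontents_eq0 (negPf F0).
have GO : map_poly intr G \is a polyOver O.
  by apply/polyOverP => i; rewrite coef_rmap rpred_int.
have GT : ge 1 (map_poly intr G).[T].
  rewrite -[_.[T]]subr0 -Gs; apply: dval_horner_sub => //.
  by rewrite -opprB dval_geN.
have : (p %| zcontents G)%Z.
  by rewrite dvdz_contents; apply/polyOverP => i; apply: T_tr GT i.
by rewrite zcontents_primitive F0 dvdzE /= dvdn1 gtn_eqF ?prime_gt1.
Qed.

Lemma algebraic_unramified x : x \in O -> algebraic x -> x^-1 \in O \/ x / p%:R \in O.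
Proof.
move=> xO ax; have [->|x0] := eqVneq x 0; first by left; rewrite invr0 rpred0.
have [A AP] := algebraic_subfield; have xA : x \in A by apply/AP.
have [p0 vp] := dval_p; have xO' : ge 0 x by [].
have [le|lt] := leP (p%:Z) (v x).
  by right; rewrite unfold_in; change (ge 0 (x / p%:R)); rewrite dval_div // add0r vp dval_ge_neq0.
have : 0 <= v x by rewrite -dval_ge_neq0.
case vx: (v x) lt => [k|k] // kp _; case: k vx kp => [|k] vx kp.
  by left; change (ge 0 x^-1); rewrite dval_ge_neq0 ?invr_eq0 // dvalV // vx oppr0.
have cop : coprime k.+1 p.
  rewrite coprime_sym prime_coprime //; apply/negP => /dvdn_leq -/(_ isT).
  by rewrite leqNgt => /negP; apply; rewrite -ltz_nat.
case: (egcdnP p (ltn0Sn k)) => a b ab _; rewrite (eqP cop) in ab.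
case: (@no_algebraic_uniformizer (x ^+ a / p%:R ^+ b)).
- by apply/AP; rewrite rpred_div ?rpredX ?rpred_nat.
- by rewrite mulf_neq0 ?invr_eq0 ?expf_neq0.
rewrite dvalM ?invr_eq0 ?expf_neq0 // dvalV ?expf_neq0 // !dvalX // vx vp.
by rewrite -!PoszM [(k.+1 * a)%N]mulnC ab [(b * p)%N]mulnC PoszD addrC addKr.
Qed.

End Uniformizer.
End CompleteField.

Lemma ex_complete_field p (p_prime : prime p) (r : nat -> nat) : (forall n, 0 < r n)%N ->
  exists (E : fieldType) (v : discrete_valuation E) (T w : E),
  [/\ dval_complete v, dval_ge v 0 T, w != 0 /\ v w = 1, w ^+ p = p%:R * (1 + T * w) &
  [/\ forall n, exists2 z, dval_ge v 0 z & dval_ge v 1 (z ^+ r n - T),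
    forall q, prime q -> (forall n, ~~ (q %| r n)%N) ->
      forall z, dval_ge v 0 z -> ~~ dval_ge v 1 (z ^+ q - T),
    forall g : {poly int}, dval_ge v 1 (map_poly intr g).[T] -> forall i, (p %| g`_i)%Z &
    forall h : {poly int}, h \is monic -> (1 < size h)%N ->
      exists2 z, dval_ge v 0 z & dval_ge v p%:Z (map_poly intr h).[z]]].
Proof.
move=> r0; have [K [v [T [w [TO [w0 vw] wE [H1 H2 H3 H4]]]]]] := ex_base_field p_prime r0.
have [E [nu [iota [complete ge dense]]]] := ex_completion v.
have iw0 : iota w != 0 by rewrite fmorph_eq0.
exists E, nu, (iota T), (iota w); split; rewrite ?ge //.
- split=> //; apply/eqP; rewrite eq_le -dval_ge_neq0 // ge dval_ge_neq0 // vw lexx andbT.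
  by rewrite leNgt -lezD1 -dval_ge_neq0 // ge dval_ge_neq0 // vw.
- by rewrite -rmorphXn wE rmorphM rmorphD rmorph1 rmorphM rmorph_nat.
split=> [n|q q_prime qr z zO|g|h hmon h1].
- have [z zO zT] := H1 n; exists (iota z); rewrite ?ge //.
  by rewrite -rmorphXn -rmorphB ge.
- have [x zx] := dense z 1; have xO : dval_ge nu 0 (iota x).
    by rewrite -(subKr z (iota x)); apply: dval_geB => //; apply: dval_geW zx.
  have xq : dval_ge nu 1 (z ^+ q - iota x ^+ q).
    have XO : 'X^q \is a polyOver (valuation_ring_pred nu) by apply/rpredX/polyOverX.
    by have := dval_horner_sub XO zO xO zx; rewrite !hornerXn.
  apply/negP => zT; have := H2 q q_prime qr x; rewrite -!ge => /(_ xO)/negP; apply.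
  rewrite rmorphB rmorphXn (_ : _ - _ = z ^+ q - iota T - (z ^+ q - iota x ^+ q)); last by ring.
  exact: dval_geB.
- by rewrite -rmorph_int_poly ge; apply: H3.
have [z zO hz] := H4 h hmon h1; exists (iota z); rewrite ?ge //.
by rewrite -rmorph_int_poly ge.
Qed.

(** * Undecidability by diagonalization *)

(* Over the complete field, [z] is integral because 1 + p z^(p+1) is a (p+1)-th
   power; the equation for [pi] then forces [z ^ q] to reduce to the residue of T. *)
Definition root_sentence p q :=
  let X i n := term_pow (TVar i) n in
  FExists 0 (FExists 1%N (FExists 2%N (FAnd
    (FEq (TMul (term_nat p) (TAdd TOne (TMul (X 1%N q) (TVar 0%N)))) (X 0%N p))
    (FEq (TAdd TOne (TMul (term_nat p) (X 1%N p.+1))) (X 2%N p.+1))))).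

Lemma root_sentenceP p q : sentence (root_sentence p q) /\ existential (root_sentence p q).
Proof.
split=> //; rewrite /sentence /=; set s := _ ++ _.
have : all (gtn 3) s.
  have npow i n : (i < 3)%N -> all (gtn 3) (term_vars (term_pow (TVar i) n)).
    by move=> i3; elim: n => //= n ->; rewrite i3.
  have nnat n : all (gtn 3) (term_vars (term_nat n)) by elim: n.
  by rewrite /s /= ?all_cat /= ?all_cat /= ?nnat ?npow /= ?all_cat /= ?nnat ?npow.
by elim: s => //= -[|[|[|i]]] s IH.
Qed.

Lemma root_sentence_holds p q (E : fieldType) : holds_in E (root_sentence p q) <->
  exists pi z y : E, p%:R * (1 + z ^+ q * pi) = pi ^+ p /\ 1 + p%:R * z ^+ p.+1 = y ^+ p.+1.
Proof.
split=> [/(_ (fun=> 0))[pi [z [y]]]|[pi [z [y H]]] e]; last exists pi, z, y.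
  rewrite /= !term_evalE /= !ring_eval_pow !ring_eval_nat /update /= => H.
  by exists pi, z, y; rewrite !exprS.
by rewrite /= !term_evalE /= !ring_eval_pow !ring_eval_nat /update /= -!exprS.
Qed.

Section RootSentence.
Variables (p q : nat) (p_prime : prime p) (q_prime : prime q) (qp : q != p).
Variables (E : fieldType) (v : discrete_valuation E) (T w : E).
Hypothesis complete : dval_complete v.
Local Notation ge := (dval_ge v).
Local Notation O := (valuation_ring_pred v).
Hypotheses (TO : ge 0 T) (w0 : w != 0) (vw : v w = 1).
Hypothesis wE : w ^+ p = p%:R * (1 + T * w).
Hypothesis T_tr : forall g : {poly int}, ge 1 (map_poly intr g).[T] -> forall i, (p %| g`_i)%Z.

Let w1 : ge 1 w. Proof. by rewrite /dval_ge vw lexx orbT. Qed.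
Let npO : p%:R^-1 \notin O := dval_npO p_prime TO w0 vw wE.

Lemma hensel_root n c a : ~~ (p %| n)%N -> ge 0 c -> ge 0 a -> ~~ ge 1 a ->
  ge 1 (a ^+ n - c) -> exists2 z, ge 0 z & z ^+ n = c.
Proof.
move=> pn cO aO a1 ac; have [a0 va] := dval_gePn a1.
have {}va : v a = 0.
  by apply/le_anti; rewrite -(dval_ge_neq0 _ _ a0) aO andbT -ltzD1 add0r.
have [n0 nO] := val_int_unit p_prime (@dval_valO E v) npO (pn : ~~ (p %| n%:Z)%Z).
have nO' : n%:R^-1 \in O by [].
have {}n0 : n%:R != 0 :> E by [].
pose d := n%:R * a ^+ n.-1.
have d0 : d != 0 by rewrite mulf_neq0 // expf_neq0.
have dO : d^-1 \in O.
  rewrite invfM rpredM //; change (ge 0 (a ^+ n.-1)^-1).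
  by rewrite dval_ge_neq0 ?invr_eq0 ?expf_neq0 // dvalV ?expf_neq0 // dvalX // va mul0r oppr0.
have acw : (a ^+ n - c) / w \in O by change (ge 0 ((a ^+ n - c) / w)); rewrite dval_div // vw add0r.
have [x xO xE] : exists2 x, x \in O & ('X^n - c%:P).[x] = 0.
  apply: (@newton E O w _ _ _ a (d^-1 ^+ 2 * ((a ^+ n - c) / w))) => //.
  - exact: dval_geW w1.
  - by move=> g; apply: dval_fixpoint.
  - by rewrite rpredB ?polyOverC //; apply/rpredX/polyOverX.
  - by rewrite rpredM ?rpredX.
  have -> : ('X^n - c%:P)^`().[a] = d.
    by rewrite derivB derivXn derivC subr0 hornerMn hornerXn -mulr_natl.
  have -> : ('X^n - c%:P).[a] = a ^+ n - c by rewrite hornerD hornerN hornerXn hornerC.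
  by field; rewrite w0 d0.
by exists x => //; move/eqP: xE; rewrite !hornerE ?hornerXn subr_eq0 => /eqP.
Qed.

Lemma root_sentence_true z : ge 0 z -> ge 1 (z ^+ q - T) -> holds_in E (root_sentence p q).
Proof.
move=> zO zT; have T1 : ~~ ge 1 T.
  apply/negP => T1; have := @T_tr 'X; rewrite map_polyX hornerX => /(_ T1 1%N).
  by rewrite coefX dvdzE /= dvdn1 gtn_eqF ?prime_gt1.
have z1 : ~~ ge 1 z.
  apply: contra T1 => z1; rewrite -(subKr (z ^+ q) T); apply: dval_geB => //.
  have XO : 'X^q \is a polyOver O by apply/rpredX/polyOverX.
  have := dval_horner_sub XO zO (dval_ge0 v 0); rewrite !hornerXn expr0n gtn_eqF ?prime_gt0 //.
  by rewrite !subr0; apply.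
have [|y yO yE] := @hensel_root q T z _ TO zO z1 zT.
  by rewrite dvdn_prime2 // eq_sym.
have one_O : ge 0 1 by rewrite /dval_ge dval1 lexx orbT.
have [p0 vp] := dval_p TO w0 vw wE.
have pz1 : ge 1 (p%:R * y ^+ p.+1).
  rewrite -[1]addr0; apply: dval_geM; first by rewrite dval_ge_neq0 // vp lez_nat prime_gt0.
  exact: (rpredX p.+1 (yO : y \in O)).
have [||||x xO xE] := @hensel_root p.+1 (1 + p%:R * y ^+ p.+1) 1 _ _ one_O.
- by rewrite -addn1 dvdn_addr // dvdn1 gtn_eqF ?prime_gt1.
- by apply: dval_geD => //; apply: dval_geW pz1.
- by rewrite dval_ge_neq0 ?oner_neq0 // dval1.
- by rewrite expr1n opprD addNKr dval_geN.
by apply/root_sentence_holds; exists w, y, x; rewrite yE wE xE.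
Qed.

Lemma root_sentence_root : holds_in E (root_sentence p q) ->
  exists2 z, ge 0 z & ge 1 (z ^+ q - T).
Proof.
move=> /root_sentence_holds[pi [z [y [piE yE]]]].
have [p0 vp] := dval_p TO w0 vw wE; have p_gt1 := prime_gt1 p_prime.
have zO : ge 0 z.
  apply: contraT => /dval_gePn[z0 vz].
  have pz0 : p%:R * z ^+ p.+1 != 0 by rewrite mulf_neq0 // expf_neq0.
  have vpz : v (p%:R * z ^+ p.+1) = p%:Z + v z * p.+1%:Z.
    by rewrite dvalM ?expf_neq0 // vp dvalX.
  have lt0 : v (p%:R * z ^+ p.+1) < 0 by rewrite vpz; move: (v z) vz => a; nia.
  have one_O : ge 0 1 by rewrite /dval_ge dval1 lexx orbT.
  have [] := dvalD_eq pz0 lt0 one_O; rewrite addrC yE expf_eq0 /= => y0.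
  rewrite dvalX // vpz; move: (v y) (v z) vz => a b _ E1.
  by have [le|lt] := leP a b; nia.
have ZO : ge 0 (z ^+ q) by exact: (rpredX q (zO : z \in O)).
have pi0 : pi != 0.
  apply: contraNneq p0 => pi0; move: piE; rewrite pi0 mulr0 addr0 mulr1 expr0n.
  by rewrite gtn_eqF ?prime_gt0 // => ->.
have vpi : v pi = 1.
  have vE := dvalX v p pi0; have [n1|n1] := leP 1 (v pi).
    have [u0 vu] : 1 + z ^+ q * pi != 0 /\ v (1 + z ^+ q * pi) = 0.
      by apply: dval_1D; rewrite -[1]add0r; apply: dval_geM => //; rewrite dval_ge_neq0.
    by move: vE; rewrite -piE dvalM // vp vu; move: (v pi) => n; nia.
  have : ge (p%:Z + v pi) (pi ^+ p).
    rewrite -piE; apply: dval_geM; first by rewrite dval_ge_neq0 // vp.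
    apply: dval_geD; first by rewrite /dval_ge dval1; move: n1; rewrite -ltzD1; lia.
    by rewrite -[v pi]add0r; apply: dval_geM; rewrite // dval_ge_val.
  by rewrite dval_ge_neq0 ?expf_neq0 // vE; move: (v pi) n1 => n; nia.
have E1 : pi ^+ p / p%:R - 1 = z ^+ q * pi by rewrite -piE; field.
exists z => //; have := uniformizer_eq p_prime TO w0 vw wE pi0 vpi.
rewrite E1 mulfK //; apply; rewrite -[1]add0r; apply: dval_geM => //.
by rewrite dval_ge_neq0 // vpi.
Qed.

End RootSentence.

Lemma ex_prime_seq p : exists q : nat -> nat,
  [/\ forall n, prime (q n), forall n, q n != p & injective q].
Proof.
pose q := fix q n := s2val (prime_above (if n is m.+1 then q m else p)).
have qP n : prime (q n) by case: n => [|n] /=; case: prime_above.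
have qS n : (q n < q n.+1)%N by rewrite [q n.+1]/=; case: prime_above.
have q0 : (p < q 0)%N by rewrite /=; case: prime_above.
have qlt m n : (m < n)%N -> (q m < q n)%N.
  elim: n => // n IH; rewrite ltnS leq_eqVlt => /predU1P[->|/IH lt]; first exact: qS.
  exact: ltn_trans lt (qS n).
have qp n : (p < q n)%N by case: n => // n; apply: ltn_trans q0 (qlt _ _ _).
exists q; split=> // [n|m n E]; first by rewrite gtn_eqF.
by case: (ltngtP m n) => // /qlt; rewrite E ltnn.
Qed.

Theorem theorem5p1 (p : nat) (p_prime : prime p) :
  exists (E : fieldType) (v : discrete_valuation E),
    [/\ dval_complete v,
        [pchar E]%R =i pred0,
        p \in [pchar (residue_field v)]%R,
        decidable_formulas (existential_theory (residue_field v)) &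
        ~ decidable_formulas (existential_theory E)]
    /\ decidable_polys (has_zero_in E).
Proof.
have [q [q_prime qp q_inj]] := ex_prime_seq p.
pose A n := ~ accepts n (formula_code (root_sentence p (q n))).
pose r n := if `[< A n >] then q n else 1%N.
have r0 n : (0 < r n)%N by rewrite /r; case: ifP => // _; apply: prime_gt0.
have [E [v [T [w [complete TO [w0 vw] wE [rootA nrootA T_tr lift_root]]]]]] :=
  ex_complete_field p_prime r0.
have [p0 vp] := dval_p TO w0 vw wE.
have valO := @dval_valO E v; have npO := dval_npO p_prime TO w0 vw wE.
have [red redP] := residue_morphism v.
have red_p : p \in [pchar residue_field v].
  rewrite inE p_prime -(rmorph_nat red) redP ?eqxx // rmorph_nat.
  by rewrite dval_ge_neq0 // vp lez_nat prime_gt0.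
exists E, v; split; first split=> //.
- exact: (val_pchar0 p_prime valO npO).
- apply: (decidable_existential_theory p_prime red_p) => h hmon h1.
  have [z zO hz] := lift_root h hmon h1.
  pose x : valuation_ring v := ValuationRing (zO : z \in valuation_ring_pred v).
  exists (red x); rewrite -rmorph_int_poly; apply: redP.
  rewrite (rmorph_int_poly (val : valuation_ring v -> E)); apply: dval_geW hz.
  by rewrite lez_nat prime_gt0.
- move=> /decidable_accepts[j jP].
  have [sen ext] := root_sentenceP p (q j).
  have thE : holds_in E (root_sentence p (q j)) <->
      accepts j (formula_code (root_sentence p (q j))).
    rewrite -jP; split=> [H|[phi [_ _ H] /formula_code_inj <- //]].
    by exists (root_sentence p (q j)).
  have [Aj|nAj] := EM (A j).
    apply: (Aj); apply/thE; have [z zO] := rootA j; rewrite /r asboolT // => zT.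
    exact: (root_sentence_true p_prime (q_prime j) (qp j) complete TO w0 vw wE T_tr zO zT).
  have /thE/(root_sentence_root p_prime (q_prime j) (qp j) TO w0 vw wE)[z zO zT] :
      accepts j (formula_code (root_sentence p (q j))) by apply: contrapT.
  suff qr n : ~~ (q j %| r n)%N by have := nrootA (q j) (q_prime j) qr z zO; rewrite zT.
  rewrite /r; case: asboolP => An; last by rewrite dvdn1 gtn_eqF ?prime_gt1.
  rewrite dvdn_prime2 //; apply/eqP => /q_inj jn; apply: nAj; rewrite jn; exact: An.
apply: (decidable_zero_polys p_prime valO npO) => [h hmon h1|g gO|x].
- have [z zO hz] := lift_root h hmon h1; exists z => //.
  by rewrite /pdvd expr1; change (dval_ge v 0 ((map_poly intr h).[z] / p%:R)); rewrite dval_div // add0r vp.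
- apply: dval_fixpoint => //; rewrite dval_ge_neq0 // vp lez_nat prime_gt0 //.
exact: (algebraic_unramified p_prime TO w0 vw wE T_tr).
Qed.
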